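(* Let $G$ be a (cap, even hole)-free graph. Then $\chi(G)\leq\lceil\frac{5}{4}\omega(G)\rceil$. Moreover, if $G$ is further $5$-hole-free, then $\chi(G)\leq\lceil\frac{7}{6}\omega(G)\rceil$. Both bounds are attained: there exist (cap, even hole)-free graphs $G$ with $\chi(G)=\lceil\frac{5}{4}\omega(G)\rceil$, and (cap, even hole, $5$-hole)-free graphs $G$ with $\chi(G)=\lceil\frac{7}{6}\omega(G)\rceil$.
   Context: All graphs are finite and simple; $\chi(G)$ is the chromatic number and $\omega(G)$ the clique number of $G$. A graph $G$ contains $H$ if $H$ is isomorphic to an induced subgraph of $G$; $G$ is $H$-free if it does not contain $H$, and $(H_1,H_2,\dots)$-free if it is $H_i$-free for every $i$; ''even hole-free'' means containing no even hole, and similarly for the other families. A hole is an induced cycle of length at least $4$; an even hole is a hole of even length; a $5$-hole is a hole of length $5$. A cap is a graph obtained from a hole by adding one new vertex adjacent to exactly two vertices of the hole, these two vertices being adjacent. *)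

(* Defs.v *)
From mathcomp Require Import all_boot.
Set Implicit Arguments. Unset Strict Implicit. Unset Printing Implicit Defensive.

Definition simple_graph (T : finType) (e : rel T) : Prop :=
  symmetric e /\ irreflexive e.

Definition contains (T : finType) (e : rel T) (U : finType) (h : rel U) : Prop :=
  exists f : U -> T, injective f /\ forall x y, e (f x) (f y) = h x y.

Definition cycle_rel (k : nat) : rel 'I_k :=
  fun i j => ((i.+1 %% k == j) || (j.+1 %% k == i)) && (i != j).

Definition cap_rel (k : nat) : rel (option 'I_k) :=
  fun x y => match x, y with
             | Some i, Some j => cycle_rel i j
             | None, Some j => (val j == 0) || (val j == 1)
             | Some i, None => (val i == 0) || (val i == 1)
             | None, None => false
             end.

Definition has_hole_of_length (T : finType) (e : rel T) (k : nat) : Prop :=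
  4 <= k /\ contains e (@cycle_rel k).

Definition even_hole_free (T : finType) (e : rel T) : Prop :=
  forall k, ~~ odd k -> ~ has_hole_of_length e k.

Definition five_hole_free (T : finType) (e : rel T) : Prop :=
  ~ has_hole_of_length e 5.

Definition cap_free (T : finType) (e : rel T) : Prop :=
  forall k, 4 <= k -> ~ contains e (@cap_rel k).

Definition proper_coloring (T : finType) (e : rel T) (k : nat) (c : T -> 'I_k) : Prop :=
  forall x y, e x y -> c x != c y.

Definition colorableb (T : finType) (e : rel T) (k : nat) : bool :=
  [exists c : {ffun T -> 'I_k}, [forall x, forall y, e x y ==> (c x != c y)]].

(* chromatic number: least k with a proper k-colouring (#|T| always suffices). *)
Definition chi (T : finType) (e : rel T) : nat :=
  \big[minn/#|T|]_(k < #|T|.+1 | colorableb e k) k.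

Definition cliqueb (T : finType) (e : rel T) (A : {set T}) : bool :=
  [forall x in A, forall y in A, (x != y) ==> e x y].

Definition omega (T : finType) (e : rel T) : nat :=
  \max_(A : {set T} | cliqueb e A) #|A|.

Definition ceil_div (a b : nat) : nat := (a + b.-1) %/ b.

(* Main.v *)
Require Import Defs.
From mathcomp Require Import all_boot zify.
Set Implicit Arguments. Unset Strict Implicit. Unset Printing Implicit Defensive.

(** Let r = 1 in general and r = 2 if 5-holes are excluded too. By induction on the
    number of vertices, a graph of the class whose cliques have at most t vertices has a
    colouring with t + ceil(t / (2r + 2)) colours. Clique cutsets and universal vertices
    are easily removed. Without them every triangle contains two true twins, so that the
    graph is a blow-up, by cliques, of a triangle-free graph F without even holes, clique
    cutsets or universal vertices. In such an F a minimal piece hanging on a star cutset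
    contains either 2r + 1 consecutive vertices of degree 2, or a vertex of degree 3 from
    which two runs of 2r vertices of degree 2 start. If t <= 2r + 2, a colouring of the
    graph without the twin classes of this configuration extends to them. If t > 2r + 2,
    a suitable number of vertices of each class spans a graph of clique number at most
    2r + 2, whose removal lowers the clique number by 2r + 2. The cycles of length 5 and
    7 attain the bounds. *)

(** For r = 1 and r = 2 the number t + ceil(t / (2r + 2)) equals ceil(5t/4) and ceil(7t/6). The
    structure rests on parity: in a triangle-free graph whose holes are all odd, a vertex off a hole
    with a neighbour on it has an odd number of neighbours there. So if three neighbours of v attach
    to one connected set of non-neighbours of v, one of them becomes a hub of a hole through v and
    the other two, and a hub is the centre of a star cutset. A vertex of degree 3 thus always points
    to a star cutset; in a smallest piece this can only be the one at its root, and the vertices not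
    adjacent to the root have degree 2. Holes of length at least 2r + 3 make the resulting runs
    long. A run of 2r vertices whose ends are coloured can be completed with t + 1 <= 2r + 3 colours
    unless both ends carry the same r + 1 colours: identifying the ends could then leave a cycle of
    length 2r + 1 with r + 1 colours at each vertex, which needs more than 2r + 3 colours. The
    additional vertex of a run of 2r + 1, or the centre of a fork, is used to avoid that
    coincidence. *)

Lemma split_first (V : eqType) (P : pred V) (s : seq V) :
  has P s -> exists s1 x s2, [/\ s = s1 ++ x :: s2, ~~ has P s1 & P x].
Proof.
elim: s => //= y s IH; case: (boolP (P y)) => [Py _|nPy /IH [s1 [x [s2 [-> h1 h2]]]]].
  by exists [::], y, s.
by exists (y :: s1), x, s2; split=> //=; rewrite negb_or nPy.
Qed.

Lemma split_last (V : eqType) (P : pred V) (s : seq V) :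
  has P s -> exists s1 x s2, [/\ s = s1 ++ x :: s2, ~~ has P s2 & P x].
Proof.
rewrite -has_rev => /split_first [s1 [x [s2 [E h1 h2]]]].
exists (rev s2), x, (rev s1); split=> //; last by rewrite has_rev.
by rewrite -[s]revK E rev_cat rev_cons cat_rcons.
Qed.

Lemma last_cat_cons (V : Type) (x y : V) s t : last x (s ++ y :: t) = last y t.
Proof. by rewrite last_cat. Qed.

Lemma notin_mid (V : eqType) (u s t : V) P R :
  (u \notin s :: P ++ t :: R) = [&& u != s, u \notin P, u != t & u \notin R].
Proof. by rewrite inE mem_cat inE !negb_or. Qed.

(** * Induced paths, holes and star cutsets *)

Section Holes.
Variables (V : finType) (e : rel V).
Hypotheses (sym : symmetric e) (irr : irreflexive e).

Section InducedPaths.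
Implicit Types (s t p c : seq V) (x y z u v w : V) (D : {set V}).

Definition nn x y := (x != y) && ~~ e x y.
Definition nad x s := all (nn x) s.
Definition far s t := all (fun y => nad y t) s.

Lemma nnC x y : nn x y = nn y x.
Proof. by rewrite /nn eq_sym sym. Qed.

Lemma farC s t : far s t = far t s.
Proof.
apply/allP/allP => H y yt; apply/allP => z /H /allP /(_ _ yt); by rewrite nnC.
Qed.

Lemma nad_nil x : nad x [::] = true. Proof. by []. Qed.
Lemma nad_cons x y s : nad x (y :: s) = nn x y && nad x s. Proof. by []. Qed.
Lemma nad_cat x s t : nad x (s ++ t) = nad x s && nad x t.
Proof. exact: all_cat. Qed.
Lemma nad_rcons x y s : nad x (rcons s y) = nn x y && nad x s.
Proof. exact: all_rcons. Qed.
Lemma nad_rev x s : nad x (rev s) = nad x s. Proof. exact: all_rev. Qed.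
Lemma far_nill t : far [::] t = true. Proof. by []. Qed.
Lemma far_nilr s : far s [::] = true. Proof. by rewrite farC. Qed.
Lemma far_consl x s t : far (x :: s) t = nad x t && far s t. Proof. by []. Qed.
Lemma far_consr x s t : far s (x :: t) = nad x s && far s t.
Proof. by rewrite farC far_consl farC. Qed.
Lemma far_catl s s' t : far (s ++ s') t = far s t && far s' t.
Proof. exact: all_cat. Qed.
Lemma far_catr s t t' : far s (t ++ t') = far s t && far s t'.
Proof. by rewrite farC far_catl ![far _ s]farC. Qed.
Lemma far_rconsl x s t : far (rcons s x) t = nad x t && far s t.
Proof. exact: all_rcons. Qed.
Lemma far_rconsr x s t : far s (rcons t x) = nad x s && far s t.
Proof. by rewrite farC far_rconsl farC. Qed.
Lemma far_revl s t : far (rev s) t = far s t. Proof. exact: all_rev. Qed.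
Lemma far_revr s t : far s (rev t) = far s t.
Proof. by rewrite farC far_revl farC. Qed.
Definition farE := (far_nill, far_nilr, far_consl, far_consr, far_catl, far_catr,
  far_rconsl, far_rconsr, far_revl, far_revr, nad_nil, nad_cons, nad_cat, nad_rcons,
  nad_rev).

Fixpoint ipath s :=
  if s is x :: s' then
    if s' is y :: s'' then [&& e x y, nad x s'' & ipath s'] else true
  else true.

Lemma ipath_cons2 x y s : ipath (x :: y :: s) = [&& e x y, nad x s & ipath (y :: s)].
Proof. by []. Qed.

Lemma ipath1 x : ipath [:: x]. Proof. by []. Qed.

Arguments ipath : simpl never.

Lemma ipath_behead x s : ipath (x :: s) -> ipath s.
Proof. by case: s => // y s; rewrite ipath_cons2; case/and3P. Qed.

Lemma ipath_cat s x t :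
  ipath (s ++ x :: t) = [&& ipath (rcons s x), ipath (x :: t) & far s t].
Proof.
elim: s => [|y s IH]; first by rewrite /= andbT.
case: s IH => [|z s] IH.
  by rewrite [rcons _ _]/= [_ ++ _]/= !ipath_cons2 !farE /= !andbT; case: (e y x) => //=;
     rewrite andbC.
rewrite [_ ++ _]/= [rcons _ _]/= ipath_cons2 IH !ipath_cons2.
rewrite [far (y :: _) _]far_consl nad_rcons nad_cat nad_cons.
rewrite -[z :: rcons s x]/(rcons (z :: s) x).
by case: (e y z); case: (nad y s); case: (nad y t); case: (nn y x);
   rewrite ?andbF ?andbT //=.
Qed.

Definition seg x s y := ipath (x :: rcons s y).

Lemma ipath_seg x s y t :
  ipath (x :: s ++ y :: t) = [&& seg x s y, ipath (y :: t), nad x t & far s t].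
Proof. by rewrite -[x :: s ++ _]/((x :: s) ++ _) ipath_cat. Qed.

Lemma seg0 x y : seg x [::] y = e x y.
Proof. by rewrite /seg /= ipath_cons2 ipath1 !andbT. Qed.

Lemma seg_cons x y s z : seg x (y :: s) z = [&& e x y, nad x (rcons s z) & seg y s z].
Proof. by []. Qed.

Lemma seg_cat x s y t z : seg x (s ++ y :: t) z =
  [&& seg x s y, seg y t z, nad x (rcons t z) & far s (rcons t z)].
Proof. by rewrite /seg rcons_cat rcons_cons ipath_seg. Qed.

Lemma ipath_rev s : ipath (rev s) = ipath s.
Proof.
have H t : ipath t -> ipath (rev t).
  elim: t => // x [|y t] IH //; rewrite ipath_cons2 => /and3P [exy nxt /IH].
  rewrite !rev_cons -[rcons (rcons _ _) _]cats1 cat_rcons ipath_cat => -> /=.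
  by rewrite ipath_cons2 ipath1 sym exy !farE nxt.
apply/idP/idP; [by rewrite -{2}[s]revK; exact: H | exact: H].
Qed.

Lemma seg_rev x s y : seg x (rev s) y = seg y s x.
Proof. by rewrite /seg -ipath_rev rev_cons rev_rcons revK. Qed.

Lemma ipath_catl s t : ipath (s ++ t) -> ipath s.
Proof.
case: t => [|y t]; first by rewrite cats0.
rewrite ipath_cat => /and3P [+ _ _]; case: (lastP s) => // s' z.
by rewrite -[rcons (rcons _ _) _]cats1 cat_rcons ipath_cat => /andP [].
Qed.

Lemma ipath_catr s t : ipath (s ++ t) -> ipath t.
Proof. by rewrite -ipath_rev rev_cat => /ipath_catl; rewrite ipath_rev. Qed.

Lemma nad_notin x s : nad x s -> x \notin s.
Proof. by move=> /allP H; apply/negP => /H; rewrite /nn eqxx. Qed.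

Lemma nadP x s : reflect (x \notin s /\ ~~ has (e x) s) (nad x s).
Proof.
apply: (iffP idP) => [H|[xs /hasPn H]].
  split; first exact: nad_notin.
  by apply/hasPn => y /(allP H) /andP [].
apply/allP => y ys; rewrite /nn H // andbT; apply/eqP => E; by rewrite E ys in xs.
Qed.

Lemma ipath_uniq s : ipath s -> uniq s.
Proof.
elim: s => // x s IH H; have := IH (ipath_behead H) => /= ->; rewrite andbT.
case: s H {IH} => // y s; rewrite ipath_cons2 inE negb_or => /and3P [exy nx _].
by rewrite (nad_notin nx) andbT; apply: contraTN exy => /eqP ->; rewrite irr.
Qed.

(* The cycle is x :: p, of length (size p).+1; so ~~ odd (size p) excludes even holes. *)
Definition hole x p :=
  [&& ipath p, 2 < size p, x \notin p, e x (head x p), e x (last x p)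
    & count (e x) p == 2].

Lemma hole_seg x a m b :
  hole x (a :: rcons m b) = [&& m != [::], seg a m b, e x a, e x b & nad x m].
Proof.
rewrite /hole [head _ _]/= [last _ _]/= last_rcons [size _]/= size_rcons [count _ _]/=
  -cats1 count_cat /= addn0 /seg -cats1 inE mem_cat inE.
have -> : (2 < (size m).+2) = (m != [::]) by case: m.
case: ipath; rewrite /= ?andbF //; case: (m != [::]) => //=.
case: (boolP (e x a)) => xa; rewrite /= ?andbF //.
case: (boolP (e x b)) => xb; rewrite /= ?andbF //.
have -> : (x == a) = false by apply/eqP=> E; rewrite E irr in xa.
have -> : (x == b) = false by apply/eqP=> E; rewrite E irr in xb.
rewrite orbF /= addn1 add1n eqSS eqSS; apply/andP/nadP => [[-> ]|[-> ]].
  by rewrite has_count => /eqP ->.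
by rewrite has_count -leqNgt leqn0.
Qed.

Lemma holeP x p : hole x p -> exists a m b,
  [/\ p = a :: rcons m b, [/\ m != [::], seg a m b & nad x m], e x a & e x b].
Proof.
move=> H; have: 2 < size p by case/and5P: H.
case: p H => // a p; case: (lastP p) => // m b.
rewrite hole_seg => /and5P [h1 h2 h3 h4 h5] _.
by exists a, m, b.
Qed.

Definition icyc c := if c is x :: p then hole x p else false.

Lemma hole_rot x y s : hole x (y :: s) -> hole y (rcons s x).
Proof.
move=> /holeP [a [m [b [[<- ->] [m0 sg nx] xa xb]]]].
case: m m0 sg nx => // z m _; rewrite /seg [rcons _ _]/= ipath_cons2.
rewrite !farE -[z :: _]/(rcons (z :: m) b) => /and3P [yz].
move=> /andP [ynb nym] zmb /andP [nxz nxm].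
rewrite [rcons _ _]/= hole_seg /= -[_ == _]/(_ == [::]).
have -> : (rcons m b != [::]) = true by case: (m).
rewrite yz sym xa /= nad_rcons ynb nym /seg !andbT.
rewrite -[rcons (rcons _ _) _]cats1 cat_rcons ipath_seg [seg _ _ _]zmb ipath_cons2 ipath1.
by rewrite !farE sym xb /= nnC nxz nxm.
Qed.

Lemma icyc_catC s t : icyc (s ++ t) -> icyc (t ++ s).
Proof.
elim: s t => [|x s IH] t; first by rewrite cats0.
rewrite -cat_rcons => H; apply: IH; rewrite -rcons_cat.
have {H} : hole x (s ++ t) by [].
case: (s ++ t) => // y r /hole_rot; exact.
Qed.

Lemma icyc_split x s y t : s != [::] -> t != [::] ->
  icyc (x :: s ++ y :: t) = [&& seg x s y, seg y t x & far s t].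
Proof.
case: s => // a s _; case: (lastP t) => // {}t z _.
rewrite [icyc _]/= -rcons_cons -rcons_cat hole_seg.
have -> : (s ++ y :: t != [::]) = true by case: (s).
rewrite [seg x _ _]/seg [seg y _ x]/seg /seg rcons_cat rcons_cons ipath_seg.
rewrite -[rcons (rcons t z) x]cats1 cat_rcons ipath_seg [rcons (_ :: _) _]/=.
rewrite !ipath_cons2 ipath1 !farE [nn y x]nnC [e z x]sym [e x z]sym.
rewrite -[ipath (y :: rcons t z)]/(seg y t z) -[ipath (a :: _)]/(seg a s y).
case: (e x a); rewrite ?andbF //=; case: (e z x); rewrite ?andbF //=.
case: (seg a s y); rewrite ?andbF //=; case: (seg y t z); rewrite ?andbF //=.
case: (nad x s); rewrite ?andbF ?andbT //=; case: (nn x y); rewrite ?andbF ?andbT //=.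
by case: (nad x t); rewrite ?andbF ?andbT //= !andbA.
Qed.

Lemma icyc_uniq c : icyc c -> uniq c.
Proof.
case: c => // x p; rewrite /= /hole; case/and5P => h1 _ -> _ _ /=.
exact: ipath_uniq.
Qed.

Definition rel_in (D : {set V}) := [rel x y | [&& x \in D, y \in D & e x y]].
Definition conn (D : {set V}) := connect (rel_in D).

Lemma conn_sym D x y : conn D x y = conn D y x.
Proof. by apply: sym_connect_sym => u v /=; rewrite sym andbCA. Qed.

(** Continuing from the last neighbour of [x] on [q] leaves no chord at [x]. *)
Lemma ipath_extend x q : e x (head x q) -> ipath q -> x \notin q ->
  exists q', [/\ ipath (x :: q'), last x q' = last x q & {subset q' <= q}].
Proof.
move=> xh pq xq; case: q xh pq xq => [|y q]; first by rewrite /= irr.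
move=> xy pq xq; have /split_last [s1 [z [s2 [E h h']]]] : has (e x) (y :: q) by rewrite /= xy.
exists (z :: s2); split.
- rewrite ipath_cons2 h' /=; apply/andP; split; last by move: pq; rewrite E => /ipath_catr.
  apply/nadP; split => //; apply: contra xq; rewrite E mem_cat inE => ->; by rewrite !orbT.
- by rewrite E last_cat.
- by move=> u; rewrite E mem_cat => ->; rewrite orbT.
Qed.

Lemma conn_ipath D x y : x \in D -> conn D x y ->
  exists p, [/\ ipath (x :: p), last x p = y & {subset x :: p <= D}].
Proof.
move=> xD /connectP [p + ->]; elim: p x xD => [|z p IH] x xD /=.
  by exists [::]; split=> // u; rewrite inE => /eqP ->.
case/andP => /and3P [_ zD xz] /IH [] // q [h1 h2 h3].
rewrite -[last z q]/(last x (z :: q)) in h2.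
case: (boolP (x \in z :: q)) => [xq|xq].
  case/splitPr: xq h1 h2 h3 => q1 q2 h1 h2 h3; exists q2; split.
  - exact: ipath_catr h1.
  - by rewrite -h2 last_cat.
  - by move=> u uq; apply: h3; rewrite mem_cat uq orbT.
have [q' [h4 h5 h6]] := ipath_extend (q := z :: q) xz h1 xq.
exists q'; split=> //; first by rewrite h5 h2.
by move=> u; rewrite inE => /orP [/eqP -> //|/h6 /h3].
Qed.

(** An induced path of [D] is cut at its last vertex in [X] and then at the first following vertex
    in [Y]. The link then meets [X] and [Y] only in its two ends, which is what makes the holes
    closed along it induced. *)
Lemma conn_link D (X Y : pred V) x y : x \in D -> conn D x y -> X x -> Y y ->
  exists z p, [/\ ipath (z :: p), {subset z :: p <= D}, X z /\ ~~ has X p &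
     Y (last z p) /\ ~~ has Y (belast z p)].
Proof.
move=> xD /(conn_ipath xD) [p [h1 h2 h3]] Xx Yy.
have /split_last [s1 [a [s2 [E h h']]]] : has X (x :: p) by rewrite /= Xx.
have /split_first [t1 [b [t2 [E' g g']]]] : has Y (a :: s2).
  apply/hasP; exists y => //; rewrite -h2 -[last x p]/(last x (x :: p)) E last_cat /=.
  exact: mem_last.
rewrite E in h1 h3.
have h4 := ipath_catr h1; rewrite E' -cat_rcons in h4; have {}h4 := ipath_catl h4.
have sub : {subset rcons t1 b <= D}.
  move=> u ut; apply: h3; rewrite mem_cat E' -cat_rcons mem_cat ut; by rewrite orbT.
case: t1 E' g h4 sub => [|a' t1] E' g h4 sub.
  by case: E' => E1 _; exists b, [::]; split=> //; rewrite -?E1.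
case: E' => E1 E2; subst a'; exists a, (rcons t1 b); split=> //; split=> //.
- by apply: contra h; rewrite E2 -cat_rcons has_cat => ->.
- by rewrite last_rcons.
- by rewrite belast_rcons.
Qed.

End InducedPaths.

Arguments ipath : simpl never.

Hypothesis tri : forall x y z, e x y -> e y z -> ~~ e x z.
Hypothesis hodd : forall x p, hole x p -> ~~ odd (size p).

(** * Parity of the number of neighbours on a hole *)

Section Parity.
Implicit Types (s t p m : seq V) (x y z u v w a b : V) (D : {set V}).

Lemma e_neq x y : e x y -> x != y.
Proof. by apply: contraTneq => ->; rewrite irr. Qed.

Lemma nn_tri x y z : e x y -> e x z -> y != z -> nn y z.
Proof. by move=> xy xz yz; rewrite /nn yz /=; apply: tri xz; rewrite sym. Qed.

Lemma hole_even v a m b : seg a m b -> e v a -> e v b -> nad v m -> m != [::] ->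
  ~~ odd (size m).
Proof.
move=> h1 h2 h3 h4 h5; have : hole v (a :: rcons m b).
  by rewrite hole_seg // h1 h2 h3 h4 h5.
by move/hodd; rewrite /= size_rcons /= negbK.
Qed.

(** Without triangles a 4-cycle has no chord, hence would be an even hole. *)
Lemma c4 a b c d : e a b -> e b c -> e c d -> e d a -> a != c -> b != d -> False.
Proof.
move=> ab bc cd da ac bd.
have : ~~ odd (size [:: c]).
  apply: (@hole_even a b [:: c] d) => //; last by rewrite /= andbT /nn ac (tri ab).
  - rewrite /seg /= !ipath_cons2 ipath1 bc cd !andbT /= andbT.
    by rewrite /nn bd (tri bc).
  - by rewrite sym.
by [].
Qed.

(* The neighbours of v cut the path into pieces that v closes to holes. *)
Lemma path_parity v a s : ipath (a :: s) -> v \notin a :: s -> e v a ->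
  e v (last a s) -> odd (size s) = odd (count (e v) s).
Proof.
have [n] := ubnP (size s); elim: n a s => // n IH a s ltn ps vs va.
case: s ltn ps vs => // x s ltn ps vs; rewrite [last _ _]/= => vl.
have /split_first [s1 [c [s2 [E h1 h2]]]] : has (e v) (x :: s).
  by apply/hasP; exists (last x s) => //; exact: mem_last.
rewrite E in ps vs ltn *; rewrite -[last x s]/(last x (x :: s)) E last_cat in vl.
move: ps; rewrite ipath_seg => /and4P [sg pc nc f].
have [vs1 vc] : v \notin s1 /\ v \notin c :: s2.
  by move: vs; rewrite inE mem_cat !negb_or => /and3P [].
have s10 : s1 != [::].
  case: (s1) sg => // /[!seg0] ac; by have := tri va ac; rewrite h2.
have ev := hole_even sg va h2 _ s10.
have {}ev : ~~ odd (size s1) by apply: ev; apply/nadP.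
have {}IH : odd (size s2) = odd (count (e v) s2).
  by apply: IH pc vc h2 vl; move: ltn; rewrite size_cat /=; lia.
have c0 : count (e v) s1 = 0 by apply/eqP; rewrite -leqn0 leqNgt -has_count.
by rewrite size_cat count_cat /= oddD c0 h2 (negbTE ev) /= IH.
Qed.

Lemma count0 v s : ~~ has (e v) s -> count (e v) s = 0.
Proof. by rewrite has_count -leqNgt leqn0 => /eqP. Qed.

Lemma hole_rev x p : hole x p -> hole x (rev p).
Proof.
case/(holeP) => a [m [b [-> [m0 sg nx] xa xb]]].
rewrite rev_cons rev_rcons rcons_cons hole_seg // seg_rev // sg nad_rev nx xa xb !andbT.
by rewrite -size_eq0 size_rev size_eq0.
Qed.

(** The vertices [v], [x], [a], [s1], [f] span a hole of length [size s1 + 4]. *)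
Lemma first_adj_odd v x a s1 f s2 b : hole x (a :: rcons (s1 ++ f :: s2) b) -> e v x ->
  v \notin a :: rcons (s1 ++ f :: s2) b -> ~~ has (e v) s1 -> e v f -> odd (size s1).
Proof.
rewrite hole_seg // => /and5P [m0 sg xa xb nx] vx vm h1 vf.
have H : hole v (x :: rcons (a :: s1) f).
  rewrite hole_seg // vx vf /= seg_cons xa.
  move: sg; rewrite seg_cat // => /and4P [-> _ _ _].
  move: nx; rewrite nad_cat nad_cons !nad_rcons => /and3P [-> -> _] /=.
  apply/andP; split.
    rewrite /nn (tri vx xa) andbT; apply: contraNneq vm => ->; by rewrite inE eqxx.
  apply/nadP; split => //.
  by apply: contra vm; rewrite inE mem_rcons inE mem_cat => ->; rewrite !orbT.
by have := hodd H; rewrite /= size_rcons /= negbK negbK.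
Qed.

(** Neither neighbour of [x] on the hole is adjacent to [v], so the other neighbours of [v] lie in
    [m]. The two outer gaps have odd size by [first_adj_odd], [m] has even size, and [path_parity]
    links the size of the middle piece to the number of neighbours in it. *)
Lemma count_adj v x a m b : hole x (a :: rcons m b) -> e v x ->
  v \notin a :: rcons m b -> ~~ odd (count (e v) m) .
Proof.
move=> H vx vm; case: (boolP (has (e v) m)) => [hm|]; last first.
  by rewrite has_count -leqNgt leqn0 => /eqP ->.
have [s1 [f [s2 [E h1 vf]]]] := split_first hm.
have : has (e v) (f :: s2) by rewrite /= vf.
move=> /split_last [t1 [l [t2 [E' h3 vl]]]].
have ev1 : odd (size s1).
  by move: H vm; rewrite E => H vm; apply: first_adj_odd H vx vm h1 vf.
have ev2 : odd (size t2).
  have H' := hole_rev H; move: H'; rewrite rev_cons rev_rcons rcons_cons E E'.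
  rewrite -[rev _]/(rev (s1 ++ t1 ++ l :: t2)) catA rev_cat rev_cons cat_rcons => H'.
  rewrite -size_rev; apply: first_adj_odd H' vx _ _ vl; last by rewrite has_rev.
  apply: contra vm; rewrite E E' -rcons_cons -!cats1 !(inE, mem_cat, mem_rev).
  by do ![case: (_ == _) => //= | case: (_ \in _) => //=].
have [sg nx xa xb m0] : [/\ seg a m b, nad x m, e x a, e x b & m != [::]].
  by move: H; rewrite hole_seg // => /and5P [].
have evm := hole_even sg xa xb nx m0.
case: t1 E' => [|f' t1] E'.
  case: E' => E1 E2; subst l t2.
  by move: evm; rewrite E size_cat /= addnS /= oddD ev1 ev2.
case: E' => E1 E2; subst f' s2.
have P : ipath (f :: rcons t1 l).
  by move: sg; rewrite E seg_cat // => /and4P [_ + _ _]; rewrite seg_cat // => /and4P [].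
have vP : v \notin f :: rcons t1 l.
  apply: contra vm; rewrite E !(inE, mem_cat, mem_rcons).
  by do ![case: (_ == _) => //= | case: (_ \in _) => //=].
have := path_parity P vP vf; rewrite last_rcons => /(_ vl).
rewrite -cats1 size_cat count_cat /= vl.
move: evm ev1 ev2; rewrite E !(size_cat, count_cat) /= !(size_cat, count_cat) /= vf vl.
rewrite (count0 h1) (count0 h3); move: (size _) (size _) (size _) (count _ _) => i j k l'.
rewrite !(oddD, oddS) /=.
by case: (odd i); case: (odd j); case: (odd k); case: (odd l').
Qed.

(** Rotated so that a neighbour of [v] comes first, the hole has an even number of further
    neighbours by [count_adj]. *)
Lemma icyc_count c v : icyc c -> v \notin c -> has (e v) c -> odd (count (e v) c).
Proof.
move=> H vc /hasP [x xc vx]; case/splitPr: xc H vc => s t.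
move=> /(icyc_catC) H vc; rewrite count_cat addnC -count_cat.
move: H => /=; set p := t ++ s => H; have := H => /(holeP) [a [m [b [E [m0 sg nx] xa xb]]]].
have vp : v \notin p.
  by apply: contra vc; rewrite !mem_cat inE orbC => /orP [->|->]; rewrite ?orbT.
rewrite E in H vp *; have := count_adj H vx vp.
rewrite vx /= -cats1 count_cat /= (negbTE (tri vx xa)) (negbTE (tri vx xb)) !addn0 add0n /=.
by [].
Qed.

(** The neighbours of [x] cut the path into sectors, each of which [x] closes to a hole. By
    [count_adj] each sector contributes an even number, and a neighbour of [x] is never adjacent to
    [y]. *)
Lemma sector_even x y a s : ipath (a :: s) -> e x a -> e x (last a s) -> x \notin a :: s ->
  y \notin a :: s -> e y x -> ~~ odd (count (e y) s).
Proof.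
have [n] := ubnP (size s); elim: n a s => // n IH a s ltn ps xa xl xs ys yx.
case: s ltn ps xl xs ys => // z s ltn ps; rewrite [last _ _]/= => xl xs ys.
have /split_first [s1 [b [s2 [E h1 xb]]]] : has (e x) (z :: s).
  by apply/hasP; exists (last z s) => //; exact: mem_last.
rewrite E in ps xs ys ltn *; rewrite -[last z s]/(last z (z :: s)) E last_cat in xl.
move: ps; rewrite ipath_seg // => /and4P [sg pb na f].
have [xs1 xb2] : x \notin s1 /\ x \notin b :: s2.
  by move: xs; rewrite inE mem_cat !negb_or => /and3P [].
have [[ya ys1] yb2] : (y != a /\ y \notin s1) /\ y \notin b :: s2.
  by move: ys; rewrite inE mem_cat !negb_or => /and3P [].
have s10 : s1 != [::].
  by case: (s1) sg => // /[!seg0] ab; have := tri xa ab; rewrite xb.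
have nx : nad x s1 by apply/nadP.
have Hh : hole x (a :: rcons s1 b) by rewrite hole_seg // s10 sg xa xb nx.
have c1 : ~~ odd (count (e y) s1).
  apply: count_adj Hh yx _; rewrite inE mem_rcons inE !negb_or ya ys1 andbT /=.
  by move: yb2; rewrite inE negb_or => /andP [].
have {}IH : ~~ odd (count (e y) s2).
  by apply: IH pb xb xl xb2 yb2 yx; move: ltn; rewrite size_cat /=; lia.
by rewrite count_cat /= (negbTE (tri yx xb)) add0n oddD (negbTE c1) (negbTE IH).
Qed.

(* A neighbour of x meets each sector of x in an even number of vertices, hence meets
   the hole in an even number of vertices, which must then be 0. *)
Lemma adjacent_hub c x y : icyc c -> x \notin c -> y \notin c -> e x y ->
  1 < count (e x) c -> ~~ has (e y) c.
Proof.
move=> H xc yc xy cx; apply/negP => hy; have := icyc_count H yc hy.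
have /hasP [w wc xw] : has (e x) c by rewrite has_count; lia.
case/splitPr: wc H xc yc cx {hy} => s t /(icyc_catC) H.
have Ev v : (v \notin s ++ w :: t) = (v \notin w :: (t ++ s)).
  by rewrite mem_cat !inE mem_cat orbCA [(_ \in s) || _]orbC.
have E v : count (e v) (s ++ w :: t) = count (e v) (w :: (t ++ s)).
  by rewrite count_cat /= count_cat; lia.
rewrite !Ev !E {E Ev}; move: H => /=; move: (t ++ s) => {s t} p H xp yp.
have yx : e y x by rewrite sym.
rewrite xw (negbTE (tri yx xw)) add1n ltnS -has_count add0n => /split_last.
case=> [p1 [l [p2 [E h xl]]]].
have p20 : p2 != [::].
  apply: contraTneq xl => p20; move: H; rewrite E p20 cats1 /hole last_rcons.
  by case/and5P => _ _ _ _ /andP [wl _]; exact: tri xw wl.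
have p10 : p1 != [::].
  apply: contraTneq xl => p10; move: H; rewrite E p10 /hole /=.
  by case/and5P => _ _ _ wl _; exact: tri xw wl.
move: (H : icyc (w :: p)); rewrite E icyc_split // => /and3P [sg1 sg2 _].
have [[xw' xp1] xl2] : (x != w /\ x \notin p1) /\ x \notin l :: p2.
  by move: xp; rewrite E inE mem_cat !negb_or => /and3P [].
have [[yw' yp1] yl2] : (y != w /\ y \notin p1) /\ y \notin l :: p2.
  by move: yp; rewrite E inE mem_cat !negb_or => /and3P [].
have e1 : ~~ odd (count (e y) (rcons p1 l)).
  apply: (sector_even sg1 xw _ _ _ yx); first by rewrite last_rcons.
    rewrite inE mem_rcons inE !negb_or xw' xp1 /= andbT.
    by move: xl2; rewrite inE negb_or => /andP [].
  rewrite inE mem_rcons inE !negb_or yw' yp1 /= andbT.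
  by move: yl2; rewrite inE negb_or => /andP [].
have e2 : ~~ odd (count (e y) p2).
  have Hh : hole x (l :: rcons p2 w).
    rewrite hole_seg // p20 sg2 xl xw; apply/nadP; split=> //.
    by move: xl2; rewrite inE negb_or => /andP [].
  apply: count_adj Hh yx _; move: yl2; rewrite !inE mem_rcons inE !negb_or yw'.
  by [].
rewrite -cat_rcons count_cat oddD (negbTE e1) (negbTE e2).
by [].
Qed.

End Parity.

(** * Holes closed along links; three neighbours attached to one connected set *)

Section Links.
Implicit Types (p m : seq V) (x y z u v w a b s t : V) (D : {set V}).

(** The list [L] has even size. A single neighbour of [q] leaves an odd rest; otherwise the piece
    strictly between [f] and [l] has odd size by [icyc_count] and [path_parity], so the two outer
    pieces have odd total size. *)
Lemma ends_parity x L q : hole x L -> nn q x -> q \notin L -> has (e q) L ->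
  exists A f l B, [/\ ~~ has (e q) A, ~~ has (e q) B, e q f /\ e q l, odd (size A + size B) &
    (f = l /\ L = A ++ f :: B) \/ exists2 M, M != [::] & L = A ++ f :: M ++ l :: B].
Proof.
move=> H /andP [qx nqx] qL hL.
have qc : q \notin x :: L by rewrite inE negb_or qx.
have := icyc_count (H : icyc (x :: L)) qc.
rewrite /= (negbTE nqx) hL add0n => /(_ isT) oc.
have [A [f [R [E hA qf]]]] := split_first hL.
have : has (e q) (f :: R) by rewrite /= qf.
case/split_last => R0 [l [B [E' hB ql]]].
exists A, f, l, B; have evL := hodd H.
case: R0 E' => [|f' R1] E'.
  case: E' => E1 E2; subst l B; split=> //; last by left.
  by move: evL; rewrite E size_cat /= addnS /= negbK.
case: E' => E1 E2; subst f' R.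
have pP : ipath (f :: rcons R1 l).
  move: H; rewrite E /hole => /andP [+ _].
  by move=> /(ipath_catr); rewrite -cat_rcons -cat_cons; exact: ipath_catl.
split=> //; last first.
  right; exists R1 => //; apply/eqP => R10; subst R1.
  by move: pP; rewrite /= ipath_cons2 => /and3P [fl _ _]; move: (tri qf fl); rewrite ql.
have qP : q \notin f :: rcons R1 l.
  apply: contra qL; rewrite E !(inE, mem_cat, mem_rcons).
  by do ![case: (_ == _) => //= | case: (_ \in _) => //=].
have := path_parity pP qP qf; rewrite last_rcons => /(_ ql).
move: evL oc; rewrite E.
rewrite -cats1 !(size_cat, count_cat) /= ?(size_cat, count_cat) /= qf ql.
rewrite (count0 hA) (count0 hB); move: (size A) (size R1) (size B) (count _ _) => i j k n.
rewrite !(oddD, oddS) /=.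
by case: (odd i); case: (odd j); case: (odd k); case: (odd n).
Qed.

Lemma seg_of_link x y z p : ipath (z :: p) -> e x z -> ~~ has (e x) p ->
  e y (last z p) -> ~~ has (e y) (belast z p) -> x \notin z :: p -> y \notin z :: p ->
  nn x y -> seg x (z :: p) y.
Proof.
move=> pp xz hx yl hy xp yp nxy; rewrite seg_cons xz nad_rcons nxy /=.
apply/andP; split.
  by apply/nadP; split=> //; move: xp; rewrite inE negb_or => /andP [].
have E : forall w, z :: rcons p w = belast z p ++ last z p :: [:: w].
  by move=> w; rewrite -cat_rcons -lastI cats1.
rewrite /seg E ipath_cat // -lastI pp ipath_cons2 ipath1 sym yl /=.
rewrite farC // far_consl far_nill andbT; apply/nadP; split=> //.
by apply: contra yp => /mem_belast.
Qed.

(** Meant for a third neighbour [b] of [v]: it sees both [v] and the part of the hole inside [D], so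
    it is a hub of that hole. *)
Definition between v D s t b :=
  exists P, [/\ hole v (s :: rcons P t), {subset P <= D} & has (e b) P].

Lemma between_sym v D s t b : between v D s t b -> between v D t s b.
Proof.
case=> P [H sP hb]; exists (rev P); split.
- by have := hole_rev H; rewrite rev_cons rev_rcons.
- by move=> u; rewrite mem_rev; apply: sP.
- by rewrite has_rev.
Qed.

Lemma link_hole v D z p s t : (forall d, d \in D -> nn v d) -> {subset z :: p <= D} ->
  e v s -> e v t -> s != t -> ipath (z :: p) -> e s z -> ~~ has (e s) p ->
  e t (last z p) -> ~~ has (e t) (belast z p) -> hole v (s :: rcons (z :: p) t).
Proof.
move=> vD sD vs vt st pp sz hs tl ht.
have nD w : e v w -> w \notin z :: p.
  by move=> vw; apply/negP => /sD /vD /andP [_]; rewrite vw.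
have sg : seg s (z :: p) t by apply: seg_of_link; rewrite ?nD //; exact: nn_tri vs vt _.
by rewrite hole_seg // vs vt sg; apply/allP => d /sD /vD.
Qed.

(** For [l] an extreme neighbour, on some path, of the end of the link [w :: q]: the part [B] of
    that path behind [l] is then untouched by the link, and the two pieces close through [v]. *)
Lemma ext_hole v D w q l B y t : (forall d, d \in D -> nn v d) ->
  ipath (w :: q) -> {subset w :: q <= D} -> e y w -> ~~ has (e y) q -> e (last w q) l ->
  seg l B t -> {subset l :: B <= D} -> far (belast w q) (l :: B) -> nad (last w q) B ->
  ~~ has (e t) (w :: q) -> ~~ has (e y) (l :: B) -> e v y -> e v t -> y != t ->
  hole v (y :: rcons ((w :: q) ++ l :: B) t).
Proof.
move=> vD pq sQ yw yq ll sB BD fB nB tQ yB vy vt yt.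
have nD u : e v u -> u \notin D by move=> vu; apply/negP => /vD /andP [_]; rewrite vu.
have [yD tD] := (nD _ vy, nD _ vt).
have sg : seg y ((w :: q) ++ l :: B) t; last first.
  rewrite hole_seg // vy vt sg; apply/allP => d.
  by rewrite mem_cat => /orP [/sQ /vD|/BD /vD].
rewrite seg_cat // sB; apply/and4P; split=> //.
- apply: seg_of_link => //; first by rewrite sym.
  + move: fB; rewrite farC // far_consl => /andP [/nadP []] //.
  + by apply: contra yD => /sQ.
  + move: fB ll; case: (lastP q) sQ {pq yq tQ} => [|q' u] sQ.
      by move=> _; rewrite /= inE => wl; apply: contraTneq wl => ->; rewrite irr.
    rewrite last_rcons belast_rcons => /(allP) fB ul; apply/negP.
    rewrite -rcons_cons mem_rcons inE => /orP [/eqP E|/fB].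
      by move: ul; rewrite E irr.
    by rewrite nad_cons /nn eqxx.
  + have lD : l \in D by apply: BD; rewrite inE eqxx.
    rewrite /nn; apply/andP; split; first by apply: contraNneq yD => ->.
    by move: yB; rewrite /= negb_or => /andP [].
- rewrite nad_rcons (nn_tri vy vt yt) /=; apply/nadP; split.
    by apply: contra yD => h; apply: BD; rewrite inE h orbT.
  by move: yB; rewrite /= negb_or => /andP [].
- rewrite far_rconsr //; apply/andP; split.
    by apply/nadP; split=> //; apply: contra tD => /sQ.
  rewrite lastI far_rconsl nB /=; move: fB; rewrite farC // far_consl => /andP [_].
  by rewrite farC.
Qed.

(* If no vertex of D separates the others in the sense of the conclusion, then D contains
   a subdivided claw joining the three y's, and two of the three holes through v have lengths of
   different parities. *)
Lemma triple_aux v D y1 y2 y3 P w q Q1 a Q2 : (forall d, d \in D -> nn v d) ->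
  e v y1 -> e v y2 -> e v y3 -> y1 != y2 -> y1 != y3 -> y2 != y3 ->
  hole v (y1 :: rcons P y2) -> {subset P <= D} -> ~~ has (e y3) P ->
  ipath (w :: q) -> {subset w :: q <= D} -> e y3 w -> ~~ has (e y3) q ->
  far (belast w q) P -> last w q \notin P -> has (e (last w q)) P ->
  w :: q = Q1 ++ a :: Q2 -> ~~ has (e y2) Q1 -> e y1 a -> between v D y3 y2 y1.
Proof.
move=> vD vy1 vy2 vy3 y12 y13 y23 HP sP h3 pq sQ y3w y3q fQ lP lh EQ h2 y1a.
have aD : a \in D by apply: sQ; rewrite EQ mem_cat inE eqxx orbT.
have nav : v != a by have /andP [] := vD _ aD.
have y2a : ~~ e y2 a.
  by apply/negP => y2a; apply: (@c4 v y1 a y2); rewrite // sym.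
(* If [y2] touches the link from [y3] beyond [a], the hole stays on the link; otherwise it runs
   through the whole link and continues along [P] to [y2]. *)
case: (boolP (has (e y2) Q2)) => hQ2.
  have [Q3 [b [Q4 [E hQ3 y2b]]]] := split_first hQ2.
  have [w' [q' E']] : exists w' q', Q1 ++ a :: rcons Q3 b = w' :: q'.
    by case: (Q1) => [|c Q1']; [exists a, (rcons Q3 b)|exists c, (Q1' ++ a :: rcons Q3 b)].
  have EE : w :: q = (w' :: q') ++ Q4 by rewrite -E' EQ E -catA /= cat_rcons.
  case: EE => E1 E2; subst w' q.
  have Ei : w :: q' = rcons (Q1 ++ a :: Q3) b by rewrite -E' rcons_cat rcons_cons.
  have lE : last w q' = b by rewrite -[last _ _]/(last w (w :: q')) Ei last_rcons.
  have bE : belast w q' = Q1 ++ a :: Q3.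
    by move: Ei; rewrite lastI => /rcons_inj [].
  exists (w :: q'); split.
  - apply: (link_hole vD) => //; first 1 last.
    + by rewrite eq_sym.
    + exact: (ipath_catl (s := w :: q') (t := Q4) pq).
    + by apply: contra y3q; rewrite has_cat => ->.
    + by rewrite lE.
    + by rewrite bE has_cat /= (negbTE h2) (negbTE y2a).
    + by move=> u uq; apply: sQ; rewrite -cat_cons mem_cat uq.
  - by move=> u uq; apply: sQ; rewrite -cat_cons mem_cat uq.
  - by rewrite Ei has_rcons has_cat /= y1a !orbT.
have y2Q : ~~ has (e y2) (w :: q) by rewrite EQ has_cat /= negb_or h2 negb_or y2a.
have [R [l [B [E hB ll]]]] := split_last lh.
have sBP : {subset l :: B <= P} by move=> u uB; rewrite E mem_cat uB orbT.
have sg : seg l B y2.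
  move: HP; rewrite hole_seg // E => /and5P [_ + _ _ _].
  by rewrite seg_cat // => /and4P [].
exists ((w :: q) ++ l :: B); split; last by rewrite has_cat EQ has_cat /= y1a !orbT.
- apply: (ext_hole vD) => //.
  + by move=> u /sBP /sP.
  + by apply/allP => u /(allP fQ) /allP H; apply/allP => z /sBP /H.
  + by apply/nadP; split=> //; apply: contra lP => h; apply: sBP; rewrite inE h orbT.
  + by apply: contra h3 => /hasP [u /sBP uP h]; apply/hasP; exists u.
  + by rewrite eq_sym.
- by move=> u; rewrite mem_cat => /orP [/sQ|/sBP /sP].
Qed.

Lemma triple v y1 y2 y3 D : (forall d, d \in D -> nn v d) ->
  (forall a b, a \in D -> b \in D -> conn D a b) ->
  e v y1 -> e v y2 -> e v y3 -> y1 != y2 -> y1 != y3 -> y2 != y3 ->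
  (exists2 d, d \in D & e y1 d) -> (exists2 d, d \in D & e y2 d) ->
  (exists2 d, d \in D & e y3 d) ->
  [\/ between v D y1 y2 y3, between v D y1 y3 y2 | between v D y2 y3 y1].
Proof.
move=> vD cD vy1 vy2 vy3 y12 y13 y23 [d1 d1D a1] [d2 d2D a2] [d3 d3D a3].
have notD w : e v w -> w \notin D.
  by move=> vw; apply/negP => /vD /andP [_]; rewrite vw.
have [z [p [pp sP [y1z hy1] [y2l hy2]]]] := conn_link d1D (cD _ _ d1D d2D) a1 a2.
have HP := link_hole vD sP vy1 vy2 y12 pp y1z hy1 y2l hy2.
case: (boolP (has (e y3) (z :: p))) => [h3|h3]; first by constructor 1; exists (z :: p).
have [k kD kP] : exists2 k, k \in D & k \in z :: p.
  by exists z; [apply: sP|]; rewrite inE eqxx.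
move: (z :: p) HP h3 sP kP => {z p pp y1z hy1 y2l hy2} P HP h3 sP kP.
have kk : ~~ nad k P by apply/negP => /nad_notin; rewrite kP.
(* The predicate [~~ nad d P] also holds for the vertices of [P]; the link stops at the first vertex
   on or adjacent to [P], and [lP] rules out the former. *)
have [w [q [pq sQ [y3w hy3] [Yl Yb]]]] :=
  conn_link (X := e y3) (Y := fun d => ~~ nad d P) d3D (cD _ _ d3D kD) a3 kk.
have fQ : far (belast w q) P.
  by apply/allP => u; move/hasPn: Yb => /(_ u); rewrite negbK.
have lP : last w q \notin P.
  case: (lastP q) Yb pq sQ Yl {hy3} fQ => [|q' u] Yb pq sQ Yl fQ.
    by apply/negP => wP; case/hasP: h3; exists w.
  rewrite last_rcons belast_rcons in fQ *; apply/negP => uP.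
  have : ipath (belast w q' ++ last w q' :: [:: u]) by rewrite -cat_rcons -lastI cats1.
  rewrite ipath_cat // ipath_cons2 => /and3P [_ /andP [lu _] _].
  move: fQ; rewrite lastI => /allP /(_ (last w q')); rewrite mem_rcons inE eqxx => /(_ isT).
  by move/allP => /(_ _ uP); rewrite /nn lu andbF.
have lhas : has (e (last w q)) P.
  by apply: contraR Yl => h; apply/nadP.
have lD : last w q \in D by apply: sQ; exact: mem_last.
case: (boolP (has (fun u => e y1 u || e y2 u) (w :: q))) => [|hn].
  case/split_first => Q1 [a [Q2 [EQ hQ1 /orP ha]]].
  have [h1 h2] : ~~ has (e y1) Q1 /\ ~~ has (e y2) Q1.
    by split; apply: contra hQ1 => /hasP [u uQ h]; apply/hasP; exists u; rewrite // h ?orbT.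
  case: ha => ha.
    constructor 3; apply: between_sym.
    exact: triple_aux HP sP h3 pq sQ y3w hy3 fQ lP lhas EQ h2 ha.
  constructor 2; apply: between_sym.
  have HP' : hole v (y2 :: rcons (rev P) y1).
    by have := hole_rev HP; rewrite rev_cons rev_rcons.
  apply: triple_aux HP' _ _ pq sQ y3w hy3 _ _ _ EQ h1 ha => //.
  - by rewrite eq_sym.
  - by move=> u; rewrite mem_rev => /sP.
  - by rewrite has_rev.
  - by rewrite far_revr.
  - by rewrite mem_rev.
  - by rewrite has_rev.
(* Neither [y1] nor [y2] touches the link from [y3]. Its last vertex sees the path first at [f] and
   last at [l]; by [ends_parity] the pieces beyond [f] and [l] have sizes of different parity, so
   one of the holes [H1], [H2] is even. *)
exfalso.
have [n1 n2] : ~~ has (e y1) (w :: q) /\ ~~ has (e y2) (w :: q).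
  by split; apply: contra hn => /hasP [u uQ h]; apply/hasP; exists u; rewrite // h ?orbT.
have lQ : last w q \in w :: q by exact: mem_last.
have ln1 : ~~ e (last w q) y1 by rewrite sym; apply: (hasPn n1).
have ln2 : ~~ e (last w q) y2 by rewrite sym; apply: (hasPn n2).
have nlv : nn (last w q) v by rewrite nnC //; exact: vD.
have lL : last w q \notin y1 :: rcons P y2.
  rewrite inE mem_rcons inE !negb_or lP andbT; apply/andP; split.
    by apply: contraTneq lD => ->; apply: notD.
  by apply: contraTneq lD => ->; apply: notD.
have hL : has (e (last w q)) (y1 :: rcons P y2) by rewrite /= has_rcons lhas !orbT.
have [A [f [l [B [hA hB [lf ll] od EL]]]]] := ends_parity HP nlv lL hL.
have [R E1] : exists R, y1 :: rcons P y2 = A ++ f :: R.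
  by case: EL => [[_ ->]|[M _ ->]]; eexists.
have [R' E2] : exists R', y1 :: rcons P y2 = R' ++ l :: B.
  case: EL => [[<- ->]|[M _ ->]]; first by eexists.
  by exists (A ++ f :: M); rewrite -catA.
move=> {EL}.
have HPs := HP; move: HPs; rewrite hole_seg // => /and5P [_ sgP _ _ _].
have [A' EA] : exists A', A = y1 :: A'.
  case: A E1 {hA od} => [|c A'] E1; last by exists A'; case: E1 => ->.
  by case: E1 => E1; move: ln1; rewrite E1 lf.
have [B' EB] : exists B', B = rcons B' y2.
  case: (lastP B) E2 {hB od} => [|B' c] E2.
    have : last y1 (y1 :: rcons P y2) = l by rewrite E2 last_cat.
    by rewrite /= last_rcons => E; move: ln2; rewrite E ll.
  exists B'; have : last y1 (y1 :: rcons P y2) = c by rewrite E2 last_cat /= last_rcons.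
  by rewrite /= last_rcons => ->.
subst A B; case: E1 => E1.
have [R0 ER] : exists R0, R = rcons R0 y2.
  case: (lastP R) E1 => [|R0 c] E1.
    have : last y1 (rcons P y2) = f by rewrite E1 last_cat.
    by rewrite last_rcons => E; move: ln2; rewrite E lf.
  exists R0; have : last y1 (rcons P y2) = c by rewrite E1 last_cat /= last_rcons.
  by rewrite last_rcons => ->.
have EP1 : P = A' ++ f :: R0.
  by move: E1; rewrite ER -rcons_cons -rcons_cat => /rcons_inj [].
have [R1 ER'] : exists R1, R' = y1 :: R1.
  case: R' E2 => [|c R1] E2; last by exists R1; case: E2 => ->.
  by case: E2 => E2; move: ln1; rewrite E2 ll.
have EP2 : P = R1 ++ l :: B'.
  by move: E2; rewrite ER' => -[]; rewrite -rcons_cons -rcons_cat => /rcons_inj [].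
have H1 : hole v (y3 :: rcons ((w :: q) ++ f :: rev A') y1).
  have sA : {subset f :: rev A' <= P}.
    by move=> u; rewrite EP1 inE mem_rev mem_cat inE => /orP [->|->] //; rewrite orbT.
  apply: (ext_hole vD) => //.
  - by move: sgP; rewrite EP1 -seg_rev // rev_cat rev_cons cat_rcons seg_cat // => /and4P [].
  - by move=> u /sA /sP.
  - by apply/allP => u /(allP fQ) /allP H; apply/allP => c /sA /H.
  - rewrite nad_rev; apply/nadP; split; last by move: hA; rewrite /= negb_or => /andP [].
    by apply: contra lP => h; rewrite EP1 mem_cat h.
  - by apply: contra h3 => /hasP [u /sA uP h]; apply/hasP; exists u.
  - by rewrite eq_sym.
have H2 : hole v (y3 :: rcons ((w :: q) ++ l :: B') y2).
  have sA : {subset l :: B' <= P} by move=> u uB; rewrite EP2 mem_cat uB orbT.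
  apply: (ext_hole vD) => //.
  - by move: sgP; rewrite EP2 seg_cat // => /and4P [].
  - by move=> u /sA /sP.
  - by apply/allP => u /(allP fQ) /allP H; apply/allP => c /sA /H.
  - apply/nadP; split; last by move: hB; rewrite has_rcons negb_or => /andP [].
    by apply: contra lP => h; apply: sA; rewrite inE h orbT.
  - by apply: contra h3 => /hasP [u /sA uP h]; apply/hasP; exists u.
  - by rewrite eq_sym.
move: (hodd H1) (hodd H2) od; rewrite /= !size_rcons !size_cat /= size_rev.
move: (size q) (size A') (size B') => i1 i2 i3; rewrite !addnS !(oddS, oddD) /=.
by case: (odd i1); case: (odd i2); case: (odd i3).
Qed.

End Links.

(** * Thetas and attachments shared by two components *)

Section Theta.
Implicit Types (c m P Q S A U W : seq V) (p q h x y z u v w a b s t : V) (D E : {set V}).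

Lemma icyc_odd c : icyc c -> odd (size c).
Proof. by case: c => // x p /hodd; rewrite /= negbK. Qed.

Lemma icyc_rot u c : icyc c -> u \in c -> exists2 c', icyc (u :: c') & perm_eq c (u :: c').
Proof.
move=> H uc; case/splitPr: uc H => s t /(icyc_catC) H.
by exists (t ++ s) => //; rewrite perm_catC.
Qed.

(* D supplies a hole through v and two of the y's that has the third one as a further hub;
   rerouting that hole through E contradicts [adjacent_hub]. *)
Lemma three_attachments v D E y1 y2 y3 :
  (forall d, d \in D -> nn v d) -> v \notin E ->
  (forall a b, a \in D -> b \in D -> conn D a b) ->
  (forall a b, a \in E -> b \in E -> conn E a b) ->
  (forall a b, a \in D -> b \in E -> nn a b) ->
  y1 != y2 -> y1 != y3 -> y2 != y3 ->
  (forall y, y \in [:: y1; y2; y3] -> [/\ e v y, y \notin E, exists2 d, d \in D & e y d &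
     exists2 d, d \in E & e y d]) -> False.
Proof.
move=> vD vE cD cE DE y12 y13 y23 H.
have key s t b : s \in [:: y1; y2; y3] -> t \in [:: y1; y2; y3] -> b \in [:: y1; y2; y3] ->
    s != t -> s != b -> t != b -> between v D s t b -> False.
  move=> /H [vs sE aDs [d1 d1E a1]] /H [vt tE aDt [d2 d2E a2]] /H [vb bE _ _] st sb tb.
  case=> P [HP sP hb].
  have [z [p [pp sQ [sz hs] [tl ht]]]] := conn_link d1E (cE _ _ d1E d2E) a1 a2.
  have sgQ : seg s (z :: p) t.
    apply: (seg_of_link) => //; first by apply: contra sE => /sQ.
      by apply: contra tE => /sQ.
    exact: nn_tri vs vt st.
  move: (HP); rewrite hole_seg // => /and5P [P0 sgP _ _ nvP].
  have HC : icyc (s :: P ++ t :: rev (z :: p)).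
    rewrite icyc_split //; last by rewrite rev_cons; case: (rev p).
    rewrite sgP seg_rev // sgQ /= far_revr //.
    by apply/allP => u /sP uD; apply/allP => w /sQ wE; exact: DE.
  have notc u : e v u -> u \notin E -> u != s -> u != t -> u \notin s :: P ++ t :: rev (z :: p).
    move=> vu uE us ut; rewrite notin_mid us ut mem_rev !andTb; apply/andP; split.
      by apply/negP => /sP /vD /andP [_]; rewrite vu.
    by apply: contra uE => /sQ.
  have vc : v \notin s :: P ++ t :: rev (z :: p).
    rewrite notin_mid !(e_neq) // (nad_notin nvP) mem_rev.
    by apply: contra vE => /sQ.
  have bc : b \notin s :: P ++ t :: rev (z :: p) by apply: notc; rewrite // eq_sym.
  have := adjacent_hub HC vc bc vb.
  rewrite /= has_cat hb /= orbT => /(_ _)/negP; case=> //.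
  by rewrite /= count_cat /= vs vt [count _ P + _]addnCA.
have [i1 i2 i3] : [/\ y1 \in [:: y1; y2; y3], y2 \in [:: y1; y2; y3] & y3 \in [:: y1; y2; y3]].
  by rewrite !inE !eqxx !orbT.
have [[v1 _ a1 _] [v2 _ a2 _] [v3 _ a3 _]] := And3 (H _ i1) (H _ i2) (H _ i3).
have [] := triple vD cD v1 v2 v3 y12 y13 y23 a1 a2 a3.
- exact: key.
- by apply: key; rewrite // eq_sym.
- by apply: key; rewrite // eq_sym.
Qed.

(** The paths from [y1] to [y2] through [D] and through [E] each close with [v] to an odd hole, so
    they have equal parity and together form an even hole. *)
Lemma two_attachments v D E y1 y2 : (forall d, d \in D -> nn v d) ->
  (forall d, d \in E -> nn v d) ->
  (forall a b, a \in D -> b \in D -> conn D a b) ->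
  (forall a b, a \in E -> b \in E -> conn E a b) ->
  (forall a b, a \in D -> b \in E -> nn a b) -> y1 != y2 ->
  (forall y, y \in [:: y1; y2] -> [/\ e v y, exists2 d, d \in D & e y d &
     exists2 d, d \in E & e y d]) -> False.
Proof.
move=> vD vE cD cE DE y12 H.
have [v1 [d1 d1D a1] [d1' d1E a1']] := H y1 (mem_head _ _).
have [|v2 [d2 d2D a2] [d2' d2E a2']] := H y2; first by rewrite !inE eqxx orbT.
have [z [p [pp sP [hz hp] [hl hb]]]] := conn_link d1D (cD _ _ d1D d2D) a1 a2.
have [z' [p' [pp' sP' [hz' hp'] [hl' hb']]]] :=
  conn_link d1E (cE _ _ d1E d2E) a1' a2'.
have H1 := link_hole vD sP v1 v2 y12 pp hz hp hl hb.
have H2 := link_hole vE sP' v1 v2 y12 pp' hz' hp' hl' hb'.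
have [ev1 ev2] := (hodd H1, hodd H2).
move: H1 H2; rewrite !hole_seg // => /and5P [_ sg1 _ _ _] /and5P [_ sg2 _ _ _].
have : icyc (y1 :: (z :: p) ++ y2 :: rev (z' :: p')).
  rewrite icyc_split //; last by rewrite rev_cons; case: (rev p').
  rewrite sg1 seg_rev // sg2 far_revr //.
  by apply/allP => u /sP uD; apply/allP => w /sP' wE; exact: DE.
move/icyc_odd; move: ev1 ev2.
rewrite /= !size_cat /= size_rev /= !size_rcons /= !addnS !(oddS, oddD) !negbK.
by case: (odd (size p)); case: (odd (size p')).
Qed.

(** Of the three paths between [u] and [w], two have lengths of equal parity, and any two of the
    three form a hole. *)
Lemma theta c z P (u w : V) : icyc c -> u \in c -> w \in c -> nn u w -> ipath (z :: P) ->
  e u z -> e w (last z P) ->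
  (forall y h, y \in c -> h \in z :: P -> y != h /\
      (e y h -> y = u /\ h = z \/ y = w /\ h = last z P)) -> False.
Proof.
move=> H uc wc nuw pP uz wl cross.
have [uw nuw'] := andP nuw.
have [c' H' pe] := icyc_rot H uc.
have wc' : w \in c' by move: wc; rewrite (perm_mem pe) inE eq_sym (negbTE uw).
case/splitPr: wc' H' pe => C1 C2 H' pe.
have hl : last z P \in z :: P by exact: mem_last.
have hz : z \in z :: P by exact: mem_head.
have uPc : uniq (z :: P) by exact: (ipath_uniq (s := z :: P) pP).
have uc' := icyc_uniq H'.
have sgP : seg u (z :: P) w.
  apply: (seg_of_link) => //.
  - apply/negP => /hasP [h hP uh]; have hP' : h \in z :: P by rewrite inE hP orbT.
    have [_ /(_ uh)] := cross u h uc hP'.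
    by case=> [[_ E]|[E _]]; [subst h; move: uPc; rewrite /= hP|rewrite E eqxx in uw].
  - apply/negP => /hasP [h hP uh]; have [_ /(_ uh)] := cross w h wc (mem_belast hP).
    case=> [[E _]|[_ E]]; first by rewrite E eqxx in uw.
    by subst h; move: uPc; rewrite lastI rcons_uniq hP.
  - by apply/negP => h; have [/eqP] := cross _ _ uc h.
  - by apply/negP => h; have [/eqP] := cross _ _ wc h.
have fP C : {subset C <= c} -> u \notin C -> w \notin C -> far C (z :: P).
  move=> sC uC wC; apply/allP => y yC; apply/allP => h hP; rewrite /nn.
  have [-> yh] := cross _ _ (sC _ yC) hP.
  by apply/negP => /yh [[E _]|[E _]]; [rewrite -E yC in uC|rewrite -E yC in wC].
have C10 : C1 != [::].
  apply/eqP => E; subst C1; move: H'; rewrite /= /hole => /and5P [_ _ _ /= uw' _].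
  by rewrite uw' in nuw'.
have C20 : C2 != [::].
  apply/eqP => E; subst C2; move: H'; rewrite cats1 /= /hole last_rcons.
  by case/and5P => _ _ _ _ /andP [uw' _]; rewrite uw' in nuw'.
move: (H'); rewrite icyc_split // => /and3P [sg1 sg2 f12].
move: uc'; rewrite /= cat_uniq mem_cat inE !negb_or => /andP [/and3P [uC1 _ uC2] /and3P [_]].
move=> /andP [wC1 _] /andP [wC2 _].
have sC1 : {subset C1 <= c}.
  by move=> y yC; rewrite (perm_mem pe) inE mem_cat yC orbT.
have sC2 : {subset C2 <= c}.
  by move=> y yC; rewrite (perm_mem pe) inE mem_cat inE yC !orbT.
have H1 : icyc (u :: (z :: P) ++ w :: C2).
  by rewrite icyc_split // sgP sg2 /= -far_consl farC // fP.
have H2 : icyc (u :: C1 ++ w :: rev (z :: P)).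
  rewrite icyc_split //; last by rewrite rev_cons; case: (rev P).
  by rewrite sg1 seg_rev // sgP far_revr // fP.
move: (icyc_odd H1) (icyc_odd H2) (icyc_odd H').
rewrite /= !size_cat /= size_rev /= !addnS !(oddS, oddD).
by case: (odd (size P)); case: (odd (size C1)); case: (odd (size C2)).
Qed.

End Theta.

(** * A hub of a hole and a single vertex attached to two sectors *)

Section Configurations.
Implicit Types (m P Q S A U W K T : seq V) (p q h x y z u v w a b c d s t : V) (D E : {set V}).

Lemma seg_rconsE a U p : seg a U p = ipath (rcons (a :: U) p).
Proof. by []. Qed.

Lemma seg_last a U p : seg a U p -> e p (last a U).
Proof.
rewrite seg_rconsE lastI -cats1 cat_rcons ipath_cat ipath_cons2 sym.
by case/and3P => _ /and3P [].
Qed.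

Lemma seg_belast a U p : seg a U p -> nad p (belast a U).
Proof.
rewrite seg_rconsE lastI -cats1 cat_rcons ipath_cat.
by case/and3P => _ _; rewrite farC // far_consl => /andP [].
Qed.

Lemma nad_sub u A B : {subset A <= B} -> nad u B -> nad u A.
Proof. by move=> AB /allP H; apply/allP => y /AB /H. Qed.

Lemma far_sub A A' B B' : {subset A <= A'} -> {subset B <= B'} -> far A' B' -> far A B.
Proof. by move=> AA BB /allP H; apply/allP => y /AA /H; apply: nad_sub. Qed.

(** [U] and [W] lead from [a] and from [b] to the nearest neighbour of [p], which they include; so
    [U] is empty when [p] is adjacent to [a]. The tails share a vertex exactly when [p] has a single
    neighbour on the sector; otherwise triangle-freeness puts a non-empty [M] between them. The
    parity is that of [ends_parity]. *)
Lemma sector_tails x a S b p : hole x (a :: rcons S b) -> nn p x ->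
  p \notin a :: rcons S b -> has (e p) S -> exists U W,
  [/\ odd (size U + size W), seg a U p /\ seg b W p,
    exists S1, S = U ++ S1, exists S2, S = S2 ++ rev W &
    (exists S1 q S2, [/\ S = S1 ++ q :: S2, U = rcons S1 q & W = rcons (rev S2) q]) \/
    exists2 M, M != [::] & S = U ++ M ++ rev W].
Proof.
move=> H nx pL hS; have hL : has (e p) (a :: rcons S b) by rewrite /= has_rcons hS !orbT.
have [A [f [l [B [hA hB [pf pl] od HL]]]]] := ends_parity H nx pL hL.
have [R E1] : exists R, a :: rcons S b = A ++ f :: R.
  by case: HL => [[_ ->]|[M _ ->]]; eexists.
have [R' E2] : exists R', a :: rcons S b = R' ++ l :: B.
  case: HL => [[<- ->]|[M _ ->]]; first by eexists.
  by exists (A ++ f :: M); rewrite -catA.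
have [U EU] : exists U, rcons A f = a :: U.
  by case: A E1 {HL hA od} => [[-> _]|a' A [-> _]]; [exists [::]|exists (rcons A f)].
have [W EW] : exists W, l :: B = rcons W b.
  case: (lastP B) E2 {HL hB od} => [|B' b'] E2.
    exists [::]; have := congr1 (last a) E2; rewrite last_cat /= last_rcons => ->.
    by [].
  exists (l :: B'); have := congr1 (last a) E2.
  by rewrite last_cat /= !last_rcons => ->.
have pP : ipath (a :: rcons S b) by case/and5P: H.
have sU : size U = size A by have := congr1 size EU; rewrite size_rcons /= => [[]].
have sW : size W = size B by have := congr1 size EW; rewrite size_rcons /= => [[]].
have pn m : {subset m <= a :: rcons S b} -> ~~ has (e p) m -> nad p m.
  by move=> sm hm; apply/nadP; split=> //; apply: contra pL => /sm.
exists U, (rev W); rewrite size_rev revK; split.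
- by rewrite sU sW.
- split; rewrite seg_rconsE.
    rewrite -EU -cats1 cat_rcons ipath_cat ipath_cons2 ipath1 sym pf farC // far_consl.
    rewrite pn //; last by move=> u uA; rewrite E1 mem_cat uA.
    by move: pP; rewrite E1 -cat_rcons => /ipath_catl ->.
  rewrite -rev_rcons -EW -rev_cons ipath_rev // ipath_cons2 pl pn //.
    by move: pP; rewrite E2 => /(ipath_catr) ->.
  by move=> u uB; rewrite E2 mem_cat inE uB !orbT.
- move: E1; rewrite -cat_rcons EU => -[]; case: (lastP R) => [|R1 b'] E.
    rewrite cats0 in E; have := hasPn hA; rewrite -E in EU.
    have /hasP [y yS py] := hS; move: EU; rewrite -rcons_cons => /rcons_inj [EA _].
    by move=> /(_ y); rewrite EA inE yS orbT py => /(_ isT).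
  by exists R1; move: E; rewrite -rcons_cat => /rcons_inj [].
- move: E2; rewrite EW; case: R' => [|a' R1] E.
    rewrite -rcons_cons in E; move: E => /rcons_inj [E].
    have := hasPn hB; have /hasP [y yS py] := hS; move: EW; rewrite -E /= => -[_ ->].
    by move=> /(_ y); rewrite mem_rcons inE yS orbT py => /(_ isT).
  by exists R1; move: E => -[_]; rewrite -rcons_cat => /rcons_inj [].
- case: HL => [[Efl HL]|[M M0 HL]]; last first.
    right; exists M => //; move: HL; rewrite -cat_rcons EU EW => -[].
    by rewrite -!rcons_cat => /rcons_inj [].
  left; subst l; move: HL; case: A hA EU {E1 sU od} => [|a' A] hA EU.
    case=> _ E; case/negP: hB; by rewrite -E has_rcons hS orbT.
  case: (lastP B) hB EW {E2 sW} => [|B' b'] hB EW.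
    case=> _; rewrite cats1 => /rcons_inj [E _]; case/negP: hA; by rewrite -E /= hS orbT.
  case=> _; rewrite -rcons_cons -rcons_cat => /rcons_inj [E _].
  exists A, f, B'; split=> //; first by case: EU.
  by move: EW; rewrite -rcons_cons => /rcons_inj [<- _]; rewrite rev_cons.
Qed.

Lemma join_hole x a U p W d : seg a U p -> seg d W p -> far (a :: U) (d :: W) ->
  nn x p -> nad x U -> nad x W -> e x a -> e x d ->
  hole x (a :: rcons (U ++ p :: rev W) d).
Proof.
move=> s1 s2; rewrite far_consl => /andP [nadW fUdW] xp xU xW xa xd.
rewrite hole_seg // xa xd !farE // xU xW xp seg_cat // s1 seg_rev // s2.
rewrite nad_rcons nad_rev far_rconsr // far_revr // -nad_cons nadW -far_consr // fUdW.
by case: (U).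
Qed.

(** The hole consists of [x], [a], [p], [d] and the two tails. *)
Lemma join_odd x a U p W d : seg a U p -> seg d W p -> far (a :: U) (d :: W) ->
  nn x p -> nad x U -> nad x W -> e x a -> e x d -> odd (size U + size W).
Proof.
move=> s1 s2 f xp xU xW xa xd; have /hodd := join_hole s1 s2 f xp xU xW xa xd.
by rewrite /= size_rcons size_cat /= size_rev !addnS /= !negbK.
Qed.

(* The hole a S b A with hub x: S is the interior of a sector, and A contains a further
   neighbour of x. *)
Definition config x a S b A :=
  [&& icyc (a :: S ++ b :: A), S != [::], nad x S, x \notin A, has (e x) A, e x a & e x b].

Lemma configP x a S b A : config x a S b A ->
  [/\ [/\ icyc (a :: S ++ b :: A), seg a S b, seg b A a & far S A],
      [/\ S != [::], A != [::], nad x S, x \notin A & has (e x) A],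
      [/\ e x a, e x b & nn a b] & hole x (a :: rcons S b)].
Proof.
case/and5P => ic S0 nS xA /and3P [hA xa xb].
have A0 : A != [::] by case: (A) hA.
move: (ic); rewrite icyc_split // => /and3P [s1 s2 f].
have ab : nn a b.
  case: (S) S0 s1 => // y S1 _; rewrite seg_cons nad_rcons => /and3P [_ /andP [] //].
have hh : hole x (a :: rcons S b) by rewrite hole_seg // S0 s1 xa xb nS.
by split; [split; rewrite ?s1 ?s2|split|split|exact: hh].
Qed.

Lemma config_rev x a S b A : config x a S b A -> config x b (rev S) a (rev A).
Proof.
case/configP => [[ic s1 s2 f] [S0 A0 nS xA hA] [xa xb nab] _].
have r0 m : m != [::] -> rev m != [::] by rewrite -!size_eq0 size_rev.
rewrite /config icyc_split ?r0 // !seg_rev // s1 s2 far_revl // far_revr // f.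
by rewrite nad_rev nS mem_rev xA has_rev hA xa xb.
Qed.

Lemma config_mem_rev a S b A : b :: rev S ++ a :: rev A =i a :: S ++ b :: A.
Proof.
move=> u; rewrite !(inE, mem_cat, mem_rev).
by case: (u == a); case: (u == b); case: (u \in S); rewrite //= ?orbT.
Qed.

Lemma icyc_rot_seg a S K c T d A :
  icyc (a :: S ++ K ++ c :: T ++ d :: A) = icyc (c :: T ++ d :: (A ++ a :: S ++ K)).
Proof.
have E1 : a :: S ++ K ++ c :: T ++ d :: A = (a :: S ++ K) ++ (c :: T ++ d :: A) by rewrite /= catA.
have E2 : c :: T ++ d :: (A ++ a :: S ++ K) = (c :: T ++ d :: A) ++ (a :: S ++ K).
  by rewrite /= -catA.
by rewrite E1 E2; apply/idP/idP; apply: icyc_catC.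
Qed.

(** Two tails to [p] that do not touch each other close with [x] to a hole, so their sizes have odd
    sum, as have the sizes of the two tails of one sector. Three tails cannot have three odd
    pairwise sums. Tails from different sectors can touch only at a common end of the sectors. *)
Lemma no_link1_aux x a S b A p K c T d A2 : config x a S b A ->
  b :: A = K ++ c :: T ++ d :: A2 -> e x c -> e x d -> nad x T ->
  p \notin a :: S ++ b :: A -> nn p x -> has (e p) S -> has (e p) T -> False.
Proof.
move=> cf E xc xd xT pc npx hS hT.
have [[ic s1 s2 fSA] [S0 A0 nS xA hA] [xa xb nab] H1] := configP cf.
have uq := icyc_uniq ic.
have T0 : T != [::] by case: (T) hT.
have [dA [TA aA]] : d \in A /\ {subset T <= A} /\ a \notin b :: A.
  split; [|split]; last by move: uq => /= /andP []; rewrite mem_cat negb_or => /andP [].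
    by case: K E => [|b' K] [_ ->]; rewrite ?(mem_cat, inE) eqxx !orbT.
  by move=> u uT; case: K E => [|b' K] [_ ->]; rewrite ?(mem_cat, inE) uT ?orbT.
have ip : ipath (K ++ c :: T ++ d :: rcons A2 a).
  by move: s2; rewrite seg_rconsE E rcons_cat rcons_cons rcons_cat rcons_cons.
have s3 : seg c T d by move: ip => /(ipath_catr); rewrite ipath_seg => /and4P [].
have H2 : hole x (c :: rcons T d) by rewrite hole_seg // T0 s3 xc xd.
have pL1 : p \notin a :: rcons S b.
  apply: contra pc; rewrite !(inE, mem_rcons, mem_cat).
  by case: (_ == _) => //=; case/orP=> ->; rewrite ?orbT.
have pL2 : p \notin c :: rcons T d.
  apply: contra pc; rewrite E !(inE, mem_rcons, mem_cat).
  by case/or3P => ->; rewrite ?orbT.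
have [U [W [o1 [sU sW] [S1 ES1] [S2 ES2] _]]] := sector_tails H1 npx pL1 hS.
have [U' [W' [o2 [sU' sW'] [T1 ET1] [T2 ET2] _]]] := sector_tails H2 npx pL2 hT.
have nxp : nn x p by rewrite nnC.
have subU : {subset U <= S} by move=> u uU; rewrite ES1 mem_cat uU.
have subW : {subset W <= S} by move=> u uU; rewrite ES2 mem_cat mem_rev uU orbT.
have subU' : {subset U' <= T} by move=> u uU; rewrite ET1 mem_cat uU.
have subW' : {subset W' <= T} by move=> u uU; rewrite ET2 mem_cat mem_rev uU orbT.
have xU := nad_sub subU nS; have xW := nad_sub subW nS.
have xU' := nad_sub subU' xT; have xW' := nad_sub subW' xT.
have fST : far S (d :: T).
  by apply: far_sub fSA => // u; rewrite inE => /orP [/eqP ->|/TA].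
have ad : nn a d.
  by apply: nn_tri xa xd _ => //; apply: contraNneq aA => ->; rewrite inE dA orbT.
have aT : nad a T.
  move: ip; rewrite -cat_cons catA ipath_cat => /and3P [_ _ f].
  apply/allP => u uT; rewrite nnC //; move/allP: f => /(_ u); rewrite mem_cat inE uT !orbT.
  by move=> /(_ isT) /allP; apply; rewrite mem_rcons inE eqxx.
have o3 : odd (size U + size W').
  apply: (join_odd sU sW' _ nxp xU xW' xa xd).
  rewrite far_consl nad_cons ad (nad_sub subW' aT) /=; apply: far_sub fST => //.
  by move=> u; rewrite !inE => /orP [-> //|/subW' ->]; rewrite orbT.
have bd : b != d.
  by apply: contraTneq dA => <-; move: uq => /= /andP [_]; rewrite cat_uniq /= => /and4P [].
have o4 : nad b W' -> odd (size W + size W').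
  move=> bW'; apply: (join_odd sW sW' _ nxp xW xW' xb xd).
  rewrite far_consl nad_cons (nn_tri xb xd bd) bW' /=; apply: far_sub fST => //.
  by move=> u; rewrite !inE => /orP [-> //|/subW' ->]; rewrite orbT.
have par : odd (size W + size W') -> False.
  move: o1 o2 o3; rewrite !oddD.
  by case: (odd (size U)); case: (odd (size W)); case: (odd (size W')); case: (odd (size U')).
case: K E ip => [|b' K] [Eb EA] ip; last first.
  apply: par; apply: o4; move: ip; rewrite ipath_cat => /and3P [_ _].
  rewrite far_consl nad_cat -Eb => /andP [/andP [bT _] _]; exact: nad_sub bT.
(* Consecutive sectors, [c = b]. The only neighbour of [b] in [T] is its first vertex [t0], so the
   tail [W'] is far from [b] unless it reaches [t0]; likewise [U] is far from [b] unless it reaches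
   the last vertex [sl] of [S]. *)
subst c; case: T hT xT T0 EA TA pL2 s3 H2 ET1 ET2 subU' subW' fST aT ip
  => // t0 T hT xT T0 EA TA pL2 s3 H2 ET1 ET2 subU' subW' fST aT ip.
have bT : nad b T /\ e b t0.
  by move: ip; rewrite cat0s cat_cons ipath_cons2 nad_cat => /and3P [-> /andP [-> _] _].
have uT : t0 \notin T.
  move: (ipath_uniq s3); rewrite rcons_cons 2!cons_uniq => /and3P [_ + _].
  by rewrite mem_rcons inE negb_or => /andP [].
case: (boolP (t0 \in W')) => [tW|tW]; last first.
  apply: par; apply: o4; apply/allP => u uW'; move: (subW' _ uW'); rewrite inE.
  case/orP => [/eqP E|uT']; first by rewrite -E uW' in tW.
  by case: bT => /allP /(_ _ uT').
have lW : last d W' = t0.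
  case: T2 ET2 => [|t' T2] /=.
    by move/(congr1 rev); rewrite revK => <-; rewrite rev_cons last_rcons.
  by case=> _ ET2; move: uT; rewrite ET2 mem_cat mem_rev tW orbT.
case/lastP: S S0 nS s1 fSA H1 hS pc uq cf ic pL1 ES1 ES2 subU subW fST => // S sl S0 nS s1 fSA
  H1 hS pc uq cf ic pL1 ES1 ES2 subU subW fST.
have bS : nad b S /\ e b sl.
  have sb := seg_belast s1; have := seg_last s1; rewrite last_rcons => bsl.
  by split=> //; move: sb; rewrite belast_rcons => /andP [].
have uS : sl \notin S.
  move: (ipath_uniq s1); rewrite cons_uniq !rcons_uniq => /and4P [_ _ + _] //.
case: (boolP (sl \in U)) => [slU|slU]; last first.
  have : odd (size U + size U').
    apply: (join_odd sU sU' _ nxp xU xU' xa xb).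
    rewrite far_consl nad_cons nab (nad_sub subU' aT) far_consr //=; apply/andP; split.
      apply/allP => u uU; move: (subU _ uU); rewrite mem_rcons inE => /orP [/eqP E|uS'].
        by rewrite -E uU in slU.
      by case: bS => /allP /(_ _ uS').
    by apply: far_sub fST => // u /subU' uT'; rewrite inE uT' orbT.
  move: o1 o2 o3; rewrite !oddD.
  by case: (odd (size U)); case: (odd (size W)); case: (odd (size W')); case: (odd (size U')).
have lU : last a U = sl.
  case/lastP: S1 ES1 => [|S1 sl']; first by rewrite cats0 => <-; rewrite last_rcons.
  by rewrite -rcons_cat => /rcons_inj [ES1 _]; move: uS; rewrite ES1 mem_cat slU.
have := seg_last sU; have := seg_last sW'; rewrite lU lW => pt psl.
have sltd : sl != t0.
  apply: contraTneq fSA => ->; rewrite far_rconsl EA nad_cat nad_cons.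
  by rewrite /nn eqxx.
(* Both tails reach the neighbours of [b], so [p] is adjacent to [sl] and [t0], which [b] joins as
   well. *)
apply: (c4 (a := p) (b := sl) (c := b) (d := t0)) => //.
- by rewrite sym; case: bS.
- by case: bT.
- by rewrite sym.
- by apply: contraNneq pc => ->; rewrite inE mem_cat inE eqxx !orbT.
Qed.

End Configurations.

(** * How an end of a link attaches to the hole *)

Section Endpoints.
Implicit Types (m P Q S A U W K T Z : seq V) (p q h x y z u v w a b c d s t : V) (D E : {set V}).

Definition nonspoke x p := [pred h | e p h && ~~ e x h].

(** A neighbour of [p] in [A] that is not a spoke lies inside some sector between two consecutive
    neighbours of [x], and [no_link1_aux] applies to that sector and [S]. *)
Lemma no_link1 x a S b A p : config x a S b A -> p \notin a :: S ++ b :: A ->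
  nn p x -> has (e p) S -> has (nonspoke x p) A -> False.
Proof.
move=> cf pc npx hS /hasP [h hA' /andP [ph nxh]].
have [[ic s1 s2 fSA] [S0 A0 nS xA hA] [xa xb nab] H1] := configP cf.
case/splitPr: hA' cf pc s2 fSA xA hA {ic A0} => A1 A2 cf pc s2 fSA xA hA.
have : has (e x) (b :: A1) by rewrite /= xb.
case/split_last => K [c [T1 [E1 h1 xc]]].
have : has (e x) (rcons A2 a) by rewrite has_rcons xa.
case/split_first => T2 [d [R [E2 h2 xd]]].
have xT : nad x (T1 ++ h :: T2).
  have xb' : x \notin b :: A1 ++ h :: rcons A2 a.
    move: xA; rewrite !(inE, mem_cat, mem_rcons) !negb_or (e_neq xa) (e_neq xb) => /and3P [-> -> ->].
    by [].
  apply/nadP; rewrite has_cat /= (negbTE h1) (negbTE h2) (negbTE nxh); split=> //.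
  apply: contra xb'; rewrite -cat_cons E1 E2 !(inE, mem_cat).
  by case/or3P => ->; rewrite ?orbT.
have hT : has (e p) (T1 ++ h :: T2) by rewrite has_cat /= ph orbT.
(* When the sector of [h] ends at [a], the reversed configuration is used, where this sector
   directly follows [S] and [K] is empty. *)
case: (lastP R) E2 => [|R' a'] E2.
  move: E2; rewrite cats1 => /rcons_inj [E2 Ea]; subst d T2.
  case: K E1 => [|b' K] [Eb E1].
    move: hA xT; rewrite E1 => hA; case/nadP => _; by rewrite hA.
  have cf' := config_rev cf.
  apply: (no_link1_aux (p := p) (K := [::]) (c := a) (T := rev (T1 ++ h :: A2))
     (d := c) (A2 := rev K) cf') => //.
  - by rewrite E1 !(rev_cat, rev_cons) -!cats1 -!catA.
  - by rewrite nad_rev.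
  - by rewrite config_mem_rev.
  - by rewrite has_rev.
  - by rewrite has_rev.
move: E2; rewrite -rcons_cons -rcons_cat => /rcons_inj [E2 _].
apply: (no_link1_aux (p := p) (K := K) (c := c) (T := T1 ++ h :: T2)
     (d := d) (A2 := R') cf) => //.
by rewrite -[b :: A1 ++ _]cat_cons E1 E2 -!catA.
Qed.

(** If the two tails end at the same vertex, it is the only neighbour of [p] on the cycle. If not,
    joining the tails through [p] gives a new sector between [a] and [b], so [p] can be absorbed
    into the cycle. *)
Lemma endpoint x a S b A p : config x a S b A -> p \notin a :: S ++ b :: A ->
  nn p x -> has (e p) S -> ~~ has (nonspoke x p) A ->
  (exists2 q, q \in S & forall y, y \in a :: S ++ b :: A -> e p y = (y == q)) \/
  (exists2 S', config x a S' b A & p \in S' /\ {subset S' <= p :: S}).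
Proof.
move=> cf pc npx hS hns.
have [[ic s1 s2 fSA] [S0 A0 nS xA hA] [xa xb nab] H1] := configP cf.
have uq := icyc_uniq ic.
have pL1 : p \notin a :: rcons S b.
  apply: contra pc; rewrite !(inE, mem_rcons, mem_cat).
  by case: (_ == _) => //=; case/orP=> ->; rewrite ?orbT.
have [U [W [o1 [sU sW] [S1 ES1] [S2 ES2] alt]]] := sector_tails H1 npx pL1 hS.
have nxp : nn x p by rewrite nnC.
have subU : {subset U <= S} by move=> u uU; rewrite ES1 mem_cat uU.
have subW : {subset W <= S} by move=> u uU; rewrite ES2 mem_cat mem_rev uU orbT.
have xU := nad_sub subU nS; have xW := nad_sub subW nS.
(* A spoke [u] of [A] adjacent to [p] is itself an empty tail; joined with [U] and with [W] it makes
   both sizes odd, against [o1]. *)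
have pA : nad p A.
  apply/nadP; split; first by apply: contra pc => h; rewrite inE mem_cat inE h !orbT.
  apply/negP => /hasP [u uA pu].
  have xu : e x u by apply: contraR hns => xu; apply/hasP; exists u; rewrite //= pu.
  have s3 : seg u [::] p by rewrite seg0 sym.
  have au : a != u /\ b != u.
    move: uq; rewrite cons_uniq mem_cat inE cat_uniq cons_uniq !negb_or.
    case/andP => /and3P [_ _ aA] /and4P [_ _ bA _].
    by split; apply: contraTneq uA => <-.
  have fu C : {subset C <= S} -> far C [:: u].
    by move=> sC; apply: far_sub fSA => // u'; rewrite inE => /eqP ->.
  have o2 : odd (size U + @size V [::]).
    apply: (join_odd sU s3 _ nxp xU _ xa xu) => //.
    by rewrite far_consl nad_cons (nn_tri xa xu (proj1 au)) fu.
  have o3 : odd (size W + @size V [::]).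
    apply: (join_odd sW s3 _ nxp xW _ xb xu) => //.
    by rewrite far_consl nad_cons (nn_tri xb xu (proj2 au)) fu.
  by move: o1; rewrite oddD; move: o2 o3; rewrite !addn0 => -> ->.
case: alt => [[T1 [q [T2 [ES EU EW]]]]|[M M0 ES]].
  left; exists q; first by rewrite ES mem_cat inE eqxx orbT.
  have pq : e p q by have := seg_last sU; rewrite EU last_rcons.
  have na : nad p (a :: T1) by have := seg_belast sU; rewrite EU belast_rcons.
  have nb : nad p (b :: rev T2) by have := seg_belast sW; rewrite EW belast_rcons.
  move=> y yc; apply/idP/eqP => [py|-> //]; apply/eqP; apply: contraTT py => yq.
  have : y \in (a :: T1) ++ (b :: rev T2) ++ A.
    move: yc; rewrite ES !(inE, mem_cat, mem_rev) (negbTE yq).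
    by case: (y == a) => //=; case: (y \in T1) => //=; case: (y == b); rewrite ?orbT.
  by rewrite !mem_cat => /or3P [/(allP na)|/(allP nb)|/(allP pA)] /andP [].
right; exists (U ++ p :: rev W); last first.
  split; first by rewrite mem_cat inE eqxx orbT.
  by move=> u; rewrite !(mem_cat, inE, mem_rev) => /or3P [/subU ->|->|/subW ->]; rewrite ?orbT.
have fUW : far (a :: U) (b :: W).
  case: M M0 ES => // m M _ ES.
  have : ipath ((a :: U) ++ m :: M ++ rcons (rev W) b).
    by move: s1; rewrite seg_rconsE ES rcons_cons !rcons_cat.
  rewrite ipath_cat => /and3P [_ _]; rewrite far_catr // => /andP [_].
  by rewrite far_rconsr // far_revr // -far_consr.
have := join_hole sU sW fUW nxp xU xW xa xb; rewrite hole_seg // => /and5P [n0 sg _ _ nx'].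
rewrite /config icyc_split // sg s2 far_catl far_consl pA far_revl.
rewrite (far_sub subU _ fSA) // (far_sub subW _ fSA) // n0 nx' xA hA xa xb.
by [].
Qed.

(** This is [endpoint] for the rotated cycle in which [T] plays the sector and all else the far
    part; [no_link1] provides the condition on the far part. Rotating back turns a new [T] into a
    new [A]. *)
Lemma endpoint2_aux x a S b A p K c T d A2 : config x a S b A ->
  p \notin a :: S ++ b :: A -> nn p x ->
  b :: A = K ++ c :: T ++ d :: A2 -> e x c -> e x d -> nad x T -> has (e p) T ->
  (exists2 q, q \in T & forall y, y \in a :: S ++ b :: A -> e p y = (y == q)) \/
  (exists2 A', config x a S b A' & p \in A' /\ {subset A' <= p :: A}).
Proof.
move=> cf pc npx E xc xd xT hT.
have [[ic s1 s2 fSA] [S0 A0 nS xA hA] [xa xb nab] H1] := configP cf.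
have T0 : T != [::] by case: (T) hT.
have xc' : x \notin a :: S ++ b :: A.
  by rewrite notin_mid !(e_neq) // xA (nad_notin nS).
have Em : c :: T ++ d :: (A2 ++ a :: S ++ K) =i a :: S ++ b :: A.
  have E1 : a :: S ++ b :: A = (a :: S ++ K) ++ (c :: T ++ d :: A2) by rewrite E /= catA.
  have E2 : c :: T ++ d :: (A2 ++ a :: S ++ K) = (c :: T ++ d :: A2) ++ (a :: S ++ K).
    by rewrite /= -catA.
  by move=> u; rewrite E1 E2 mem_cat orbC -mem_cat.
have cf2 : config x c T d (A2 ++ a :: S ++ K).
  rewrite /config -icyc_rot_seg // -E ic T0 xT xc xd has_cat /= xa orbT !andbT /=.
  by apply: contra xc'; rewrite -Em => h; rewrite inE mem_cat inE h !orbT.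
have pc2 : p \notin c :: T ++ d :: (A2 ++ a :: S ++ K) by rewrite Em.
have hns : ~~ has (nonspoke x p) (A2 ++ a :: S ++ K).
  by apply/negP => /(no_link1 cf2 pc2 npx hT).
have [[q qT hq]|[T' cf3 [pT' sT']]] := endpoint cf2 pc2 npx hT hns.
  by left; exists q => // y yc; apply: hq; rewrite Em.
have [A' EA'] : exists A', b :: A' = K ++ c :: T' ++ d :: A2.
  by case: K E {Em cf2 pc2 hns cf3} => [|b' K] [<- _]; eexists.
have [[ic3 _ _ _] [T0' _ nT' _ _] _ _] := configP cf3.
have mA' u : u \in b :: A' -> u \in T' \/ u \in b :: A.
  rewrite EA' E !(mem_cat, inE) => /or4P [->|->|->|/orP [->|->]]; rewrite ?orbT; by auto.
have ic4 : icyc (a :: S ++ b :: A') by rewrite EA' icyc_rot_seg.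
have bA' : b \notin A'.
  by have := icyc_uniq ic4; rewrite /= cat_uniq /= => /and5P [].
have iA' u : (u \in T') || (u == d) -> u \in A'.
  move=> hu; have : u \in b :: A'.
    by rewrite EA' !(mem_cat, inE); case/orP: hu => ->; rewrite ?orbT.
  rewrite inE => /orP [/eqP ub|//]; subst u.
  move: bA' EA'; case: K {E Em cf2 pc2 hns cf3 ic3 mA'} => [|b' K] bA' [Eb EA'];
    move: bA'; rewrite EA' !(mem_cat, inE) !negb_or.
    by case/orP: hu => ->; rewrite ?andbF.
  by case/orP: hu => ->; rewrite ?andbF.
right; exists A'.
  rewrite /config ic4 S0 nS xa xb !andbT /=; apply/andP; split.
    apply/negP => xA'; have /mA' [] : x \in b :: A' by rewrite inE xA' orbT.
      by apply/negP; exact: nad_notin nT'.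
    by apply/negP; rewrite inE negb_or (e_neq).
  by apply/hasP; exists d; rewrite // iA' // eqxx orbT.
split; first by apply: iA'; rewrite pT'.
move=> u uA'; have /mA' [/sT'|] : u \in b :: A' by rewrite inE uA' orbT.
  rewrite !inE => /orP [->//|uT]; have : u \in b :: A by rewrite E !(mem_cat, inE) uT !orbT.
  by rewrite inE => /orP [/eqP ub|->]; [move: bA'; rewrite -ub uA'|rewrite orbT].
by rewrite !inE => /orP [/eqP ub|->]; [move: bA'; rewrite -ub uA'|rewrite orbT].
Qed.

Lemma endpoint2 x a S b A p : config x a S b A -> p \notin a :: S ++ b :: A ->
  nn p x -> has (nonspoke x p) A ->
  (exists2 q, q \in A /\ ~~ e x q & forall y, y \in a :: S ++ b :: A -> e p y = (y == q)) \/
  (exists2 A', config x a S b A' & p \in A' /\ {subset A' <= p :: A}).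
Proof.
move=> cf pc npx /hasP [h hA' /andP [ph nxh]].
have [[ic s1 s2 fSA] [S0 A0 nS xA hA] [xa xb nab] H1] := configP cf.
case/splitPr: hA' cf pc s2 fSA xA hA {ic A0} => A1 A2 cf pc s2 fSA xA hA.
have : has (e x) (b :: A1) by rewrite /= xb.
case/split_last => K [c [T1 [E1 h1 xc]]].
have : has (e x) (rcons A2 a) by rewrite has_rcons xa.
case/split_first => T2 [d [R [E2 h2 xd]]].
have xT : nad x (T1 ++ h :: T2).
  have xb' : x \notin b :: A1 ++ h :: rcons A2 a.
    move: xA; rewrite !(inE, mem_cat, mem_rcons) !negb_or (e_neq xa) (e_neq xb) => /and3P [-> -> ->].
    by [].
  apply/nadP; rewrite has_cat /= (negbTE h1) (negbTE h2) (negbTE nxh); split=> //.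
  apply: contra xb'; rewrite -cat_cons E1 E2 !(inE, mem_cat).
  by case/or3P => ->; rewrite ?orbT.
have hT : has (e p) (T1 ++ h :: T2) by rewrite has_cat /= ph orbT.
have nxT q : q \in T1 ++ h :: T2 -> ~~ e x q by move/(allP xT)/andP => [].
case: (lastP R) E2 => [|R' a'] E2.
  move: E2; rewrite cats1 => /rcons_inj [E2 Ea]; subst d T2.
  case: K E1 => [|b' K] [Eb E1].
    move: hA xT; rewrite E1 => hA; case/nadP => _; by rewrite hA.
  have cf' := config_rev cf.
  case: (endpoint2_aux (p := p) (K := [::]) (c := a) (T := rev (T1 ++ h :: A2))
     (d := c) (A2 := rev K) cf') => //.
  - by rewrite config_mem_rev.
  - by rewrite E1 !(rev_cat, rev_cons) -!cats1 -!catA.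
  - by rewrite nad_rev.
  - by rewrite has_rev.
  - case=> q; rewrite mem_rev => qT hq; left; exists q; last first.
      by move=> y yc; apply: hq; rewrite config_mem_rev.
    split; last exact: nxT.
    by move: qT; rewrite E1 !(mem_cat, inE) => /or3P [] ->; rewrite ?orbT.
  - case=> A' cf2 [pA' sA']; right; exists (rev A').
      by have := config_rev cf2; rewrite revK.
    by rewrite mem_rev; split=> // u; rewrite mem_rev => /sA'; rewrite !inE mem_rev.
move: E2; rewrite -rcons_cons -rcons_cat => /rcons_inj [E2 _].
case: (endpoint2_aux (p := p) (K := K) (c := c) (T := T1 ++ h :: T2)
     (d := d) (A2 := R') cf) => //.
  by rewrite -[b :: A1 ++ _]cat_cons E1 E2 -!catA.
2: by right.
case=> q qT hq; left; exists q => //; split; last exact: nxT.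
case: K E1 => [|b' K] [_ E1]; move: qT; rewrite E1 E2 !(mem_cat, inE);
  by case/or3P => ->; rewrite ?orbT.
Qed.

End Endpoints.

(** * Links touched by an end of the sector *)

Section LinkStep.
Implicit Types (m P Q S A U W K T Z : seq V) (p q h x y z u v w a b c d f g s t : V) (D E : {set V}).

(** The path [z :: Z] replaces the arc from [q] to [w] through [a], so [a] is off the new hole.
    There [x] sees [b] and one more spoke, while its neighbour [a] sees [q]; [adjacent_hub] forbids
    this. *)
Lemma hub_hole x a q S b A Q1 w Q2 z Z : config x a (q :: S) b A ->
  A = Q1 ++ w :: Q2 -> ipath (z :: Z) ->
  (forall h, h \in z :: Z -> nn x h /\ h \notin a :: (q :: S) ++ b :: A) ->
  (forall y h, y \in a :: (q :: S) ++ b :: A -> h \in z :: Z -> e y h ->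
     [\/ y = q /\ h = z, y = w /\ h = last z Z | y = a]) ->
  e q z -> e w (last z Z) -> has (e x) (rcons Q1 w) -> False.
Proof.
move=> cf EA pZ Zc cross qz wl hx; subst A.
have [[ic s1 s2 fSA] [_ _ nS xA _] [xa xb nab] _] := configP cf.
have := icyc_catC (s := [:: a]) ic.
have -> : (((q :: S) ++ b :: Q1 ++ w :: Q2) ++ [:: a])%SEQ =
   q :: (S ++ b :: Q1) ++ w :: rcons Q2 a by rewrite -cats1 /= -!catA /= -!catA.
move=> ic2; have := ic2; rewrite icyc_split //; [|by case: (S)|by case: (Q2)].
case/and3P => sg _ _; have uq := icyc_uniq ic2.
have Ec u : (u \in a :: (q :: S) ++ b :: Q1 ++ w :: Q2) =
    (u \in q :: (S ++ b :: Q1) ++ w :: rcons Q2 a).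
  rewrite !(inE, mem_cat, mem_rcons) -!orbA.
  case: (u == a); case: (u == q); case: (u \in S); case: (u == b); case: (u \in Q1);
   by rewrite //= ?orbT.
move: uq; rewrite cons_uniq => /andP [qn]; rewrite cat_uniq => /and3P [_ /hasPn dM un].
have qM : q \notin S ++ b :: Q1 by apply: contra qn => h; rewrite mem_cat h.
have qw : q != w by apply: contraNneq qn => ->; rewrite mem_cat inE eqxx orbT.
have qa : q != a by apply: contraNneq qn => ->; rewrite mem_cat inE mem_rcons inE eqxx !orbT.
have wM : w \notin S ++ b :: Q1 by apply: (dM w); rewrite inE eqxx.
have aM : a \notin S ++ b :: Q1 by apply: (dM a); rewrite inE mem_rcons inE eqxx !orbT.
have wa : w != a.
  by apply: contraTneq un => ->; rewrite cons_uniq mem_rcons inE eqxx.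
have notM u : u \in S ++ b :: Q1 -> [/\ u != q, u != w & u != a].
  by move=> uM'; split; [apply: contraNneq qM|apply: contraNneq wM|apply: contraNneq aM] => <-.
have cM u : u \in S ++ b :: Q1 -> u \in a :: (q :: S) ++ b :: Q1 ++ w :: Q2.
  by move=> uM'; rewrite Ec inE mem_cat uM' orbT.
have cq : q \in a :: (q :: S) ++ b :: Q1 ++ w :: Q2 by rewrite Ec inE eqxx.
have cw : w \in a :: (q :: S) ++ b :: Q1 ++ w :: Q2 by rewrite Ec inE mem_cat inE eqxx !orbT.
have uZ := ipath_uniq pZ.
have sZ : seg q (z :: Z) w.
  apply: (seg_of_link) => //.
  - apply/hasPn => h hZ; apply/negP => qh; have hZ' : h \in z :: Z by rewrite inE hZ orbT.
    case: (cross _ _ cq hZ' qh) => [[_ E]|[E _]|E]; last 2 first.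
    + by rewrite E eqxx in qw.
    + by rewrite E eqxx in qa.
    by move: uZ; rewrite /= -E hZ.
  - apply/hasPn => h hZ; apply/negP => wh; have hZ' : h \in z :: Z by exact: mem_belast.
    case: (cross _ _ cw hZ' wh) => [[E _]|[_ E]|E].
    + by rewrite E eqxx in qw.
    + by move: uZ; rewrite lastI rcons_uniq -E hZ.
    + by rewrite E eqxx in wa.
  - by apply/negP => /Zc []; rewrite cq.
  - by apply/negP => /Zc []; rewrite cw.
  - have [y [M EM]] : exists y M, S ++ b :: Q1 = y :: M by case: (S); do 2!eexists.
    by move: sg; rewrite EM seg_cons nad_rcons => /and3P [_ /andP []].
have HC : icyc (q :: (S ++ b :: Q1) ++ w :: rev (z :: Z)).
  rewrite icyc_split //; [|by case: (S)|by rewrite rev_cons; case: (rev Z)].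
  rewrite sg seg_rev // sZ far_revr //=; apply/allP => y yM; apply/allP => h hZ.
  have [yq yw ya] := notM _ yM; apply/andP; split.
    by apply/negP => /eqP yh; have [_] := Zc _ hZ; rewrite -yh cM.
  by apply/negP => /(cross _ _ (cM _ yM) hZ) [[E]|[E]|E]; rewrite E eqxx in yq yw ya.
have xc : x \notin q :: (S ++ b :: Q1) ++ w :: rev (z :: Z).
  rewrite notin_mid mem_rev; apply/and4P; split.
  - by move: nS; rewrite nad_cons => /andP [/andP []].
  - rewrite mem_cat inE !negb_or (e_neq xb); move: nS; rewrite nad_cons.
    by case/andP => _ /nad_notin ->; move: xA; rewrite mem_cat negb_or => /andP [->].
  - by move: xA; rewrite mem_cat inE !negb_or => /and3P [].
  - by apply/negP => /Zc [/andP []]; rewrite eqxx.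
have ac : a \notin q :: (S ++ b :: Q1) ++ w :: rev (z :: Z).
  rewrite notin_mid mem_rev aM; apply/and4P; split=> //; try by rewrite eq_sym.
  by apply/negP => /Zc []; rewrite inE eqxx.
have := adjacent_hub HC xc ac xa.
have qa' : e a q by have := s1; rewrite seg_cons => /and3P [].
rewrite /= qa' => /(_ _)/negP; case=> //.
have : 0 < count (e x) (rcons Q1 w) by rewrite -has_count.
rewrite -cats1 !count_cat /= xb; move: (nat_of_bool _) (nat_of_bool _) (count _ _) (count _ _) (count _ _).
by clear; move=> i j k l n; lia.
Qed.

(** The case in which the first spoke touching the link is [a], a neighbour of [q] on the cycle.
    Then [q] and [a] are not the ends of a theta, and the argument turns on whether a further spoke
    touches the link. *)
Lemma star_step x a S b A z P q q' P1 t P2 :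
  (forall S' z' P', size P' < size P -> config x a S' b A -> ipath (z' :: P') ->
     (forall h, h \in z' :: P' -> nn x h /\ h \notin a :: S' ++ b :: A) ->
     has (e z') S' -> has (nonspoke x (last z' P')) A -> False) ->
  config x a S b A -> ipath (z :: P) ->
  (forall h, h \in z :: P -> nn x h /\ h \notin a :: S ++ b :: A) ->
  q \in S -> q' \in A -> ~~ e x q' -> e q z -> e q' (last z P) ->
  (forall y h, y \in a :: S ++ b :: A -> h \in z :: P -> e y h ->
     [\/ y = q /\ h = z, y = q' /\ h = last z P | [/\ e x y, h != z & h != last z P]]) ->
  e q a -> z :: P = P1 ++ t :: P2 -> e a t ->
  (forall y h, y \in a :: S ++ b :: A -> h \in rcons P1 t -> e x y -> e y h -> y = a) ->
  False.
Proof.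
move=> IH cf pP Pc qS q'A xq' qz q'l cross qa EP ta hP1.
have [[ic s1 s2 fSA] [S0 A0 nS xA hA] [xa xb nab] H1] := configP cf.
have [S' ES] : exists S', S = q :: S'.
  case: S S0 s1 qS {IH cf Pc cross ic fSA nS H1 hP1} => // y S1 _.
  rewrite seg_cons nad_rcons inE => /and3P [_ /andP [_ naS] _] /orP [/eqP ->|qS1].
    by exists S1.
  by have /andP [_] := allP naS _ qS1; rewrite sym qa.
subst S; have uq := icyc_uniq ic.
have ac : a \in a :: (q :: S') ++ b :: A by rewrite inE eqxx.
have bc : b \in a :: (q :: S') ++ b :: A by rewrite !(inE, mem_cat) eqxx !orbT.
have aA : a \notin (q :: S') ++ b :: A by case/andP: uq.
have xnq : ~~ e x q by move: nS; rewrite nad_cons => /andP [/andP []].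
have uP := ipath_uniq pP.
have lastP2 : t \in z :: P by rewrite EP mem_cat inE eqxx orbT.
have tl : t != last z P /\ t != z.
  have := cross _ _ ac lastP2 ta; case=> [[E _]|[E _]|[_ -> ->]] //.
    by move: aA; rewrite E inE eqxx.
  by move: aA; rewrite E !(mem_cat, inE) q'A !orbT.
have az : ~~ e a z.
  apply/negP => /(cross _ _ ac (mem_head _ _)) [[E _]|[E _]|[_ /eqP //]].
    by move: aA; rewrite E inE eqxx.
  by move: aA; rewrite E !(mem_cat, inE) q'A !orbT.
have [[_ P10] P20] : (true /\ P1 != [::]) /\ P2 != [::].
  move: EP tl; case: P1 {hP1} => [|z' P1]; first by case=> -> _; rewrite eqxx => -[].
  case: P2 => // -[_ ->]; rewrite last_cat /=; by rewrite eqxx => -[].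
have lP2 : last z P = last t P2.
  by have := congr1 (last z) EP; rewrite last_cat.
pose f h := has (fun y => [&& e x y, e y h & y != a]) (a :: (q :: S') ++ b :: A).
case: (boolP (has f P2)) => hf; last first.
  have [Q1 [Q2 EA]] : exists Q1 Q2, A = Q1 ++ q' :: Q2.
    by case/splitPr: q'A => Q1 Q2; exists Q1, Q2.
  have only y h : y \in a :: (q :: S') ++ b :: A -> h \in z :: P -> e x y ->
      e y h -> y = a.
    move=> yc; rewrite EP mem_cat inE => hP xy yh; apply/eqP.
    have {hP} /orP [hP|hP] : (h \in rcons P1 t) || (h \in P2).
      by rewrite mem_rcons inE; case/or3P: hP => ->; rewrite ?orbT.
      by apply/eqP; apply: hP1 hP xy yh.
    apply: contraNT hf => ya; apply/hasP; exists h => //; apply/hasP; exists y => //.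
    by rewrite xy yh.
  (* Only [a] touches the link among the spokes. A spoke between [b] and [q'] lets [hub_hole] apply;
     otherwise the part of the link from the last neighbour of [a] onwards forms a theta with ends
     [a] and [q']. *)
  case: (boolP (has (e x) Q1)) => hQ1.
    apply: (hub_hole cf EA pP Pc _ qz q'l); last by rewrite has_rcons hQ1 orbT.
    move=> y h yc hP yh; have [[-> ->]|[-> ->]|[xy _ _]] := cross _ _ yc hP yh.
    - by constructor 1.
    - by constructor 2.
    - by constructor 3; apply: only yc hP xy yh.
  have hQ2 : has (e x) Q2 by move: hA; rewrite EA has_cat (negbTE hQ1) /= (negbTE xq').
  have Q20 : Q2 != [::] by case: (Q2) hQ2.
  have naq' : nn a q'.
    have := ic; rewrite EA.
    have -> : (q :: S') ++ b :: Q1 ++ q' :: Q2 = (q :: S' ++ b :: Q1) ++ q' :: Q2.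
      by rewrite /= -catA.
    rewrite icyc_split // => /and3P [+ _ _]; rewrite seg_cons nad_rcons.
    by case/and3P => _ /andP [].
  have : has (e a) (z :: P) by rewrite EP has_cat /= ta orbT.
  case/split_last => R1 [g [R2 [ER hR2 ag]]].
  have gP : g \in z :: P by rewrite ER mem_cat inE eqxx orbT.
  have lR : last g R2 = last z P by have := congr1 (last z) ER; rewrite last_cat.
  have subR h : h \in g :: R2 -> h \in z :: P by move=> hh; rewrite ER mem_cat hh orbT.
  have nz : z \notin g :: R2.
    case: R1 ER => [|z' R1] ER; first by case: ER => Ez _; move: ag; rewrite -Ez (negbTE az).
    move: uP; rewrite ER => /= /andP [+ _]; case: ER => -> _.
    by rewrite mem_cat negb_or => /andP [].
  have q'c : q' \in a :: (q :: S') ++ b :: A by rewrite !(inE, mem_cat) q'A !orbT.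
  apply: (theta ic ac q'c naq' (z := g) (P := R2)) => //.
  - by have := pP; rewrite ER => /(ipath_catr).
  - by rewrite lR.
  move=> y h yc hR; have [xh hc] := Pc _ (subR _ hR); split.
    by apply: contraNneq hc => <-.
  move=> yh; have [[Ey Eh]|[-> ->]|[xy _ _]] := cross _ _ yc (subR _ hR) yh.
  - by subst h; rewrite hR in nz.
  - by right; rewrite lR.
  - left; have ya := only _ _ yc (subR _ hR) xy yh; split=> //; subst y.
    move: hR; rewrite inE => /orP [/eqP //|hR]; case/negP: hR2; apply/hasP; exists h => //.
(* [s] is the first vertex touched by a spoke [f0] other than [a]. Two spokes at [s] would close a
   4-cycle with [x], so [f0] is the only one. If [f0] is in [A], the link up to [s] is again
   excluded by [hub_hole]. *)
case/split_first: hf => P2a [s [P2b [EP2 hP2a /hasP [f0 f0c /and3P [xf0 f0s f0a]]]]].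
have EP' : z :: P = (P1 ++ t :: P2a) ++ s :: P2b by rewrite EP EP2 -catA.
have sP : s \in z :: P by rewrite EP' mem_cat inE eqxx orbT.
have [sz sl] : s != z /\ s != last z P.
  case: (cross _ _ f0c sP f0s) => [[E _]|[E _]|[_ -> ->] //].
    by rewrite E (negbTE xnq) in xf0.
  by rewrite E (negbTE xq') in xf0.
have P2b0 : P2b != [::].
  apply: contraNneq sl => E; have := congr1 (last z) EP'; rewrite E last_cat /= => ->.
  by rewrite eqxx.
have only y h : y \in a :: (q :: S') ++ b :: A -> h \in P1 ++ t :: P2a -> e x y ->
    e y h -> y = a.
  move=> yc; rewrite mem_cat inE => hP xy yh.
  have {hP} /orP [hP|hP] : (h \in rcons P1 t) || (h \in P2a).
    by rewrite mem_rcons inE; case/or3P: hP => ->; rewrite ?orbT.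
    by apply: hP1 hP xy yh.
  apply/eqP; apply: contraNT hP2a => ya; apply/hasP; exists h => //; apply/hasP; exists y => //.
  by rewrite xy yh.
have onlys y : y \in a :: (q :: S') ++ b :: A -> e x y -> e y s -> y = f0.
  move=> yc xy ys; apply/eqP; apply/negPn/negP => yf0.
  have [/andP [xs _] _] := Pc _ sP.
  by apply: (c4 (a := x) (b := y) (c := s) (d := f0)) => //; rewrite sym.
move: uP; rewrite EP' cat_uniq => /and3P [uP1 /hasPn dP uP2].
have sub1 h : h \in P1 ++ t :: P2a -> h \in z :: P by move=> hh; rewrite EP' mem_cat hh.
have sub2 h : h \in P2b -> h \in z :: P by rewrite EP' mem_cat inE => ->; rewrite !orbT.
have lP2b : last z P = last s P2b by have := congr1 (last z) EP'; rewrite last_cat.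
have lP2b' : last z P \in P2b.
  by rewrite lP2b; case: (P2b) P2b0 => // r R _; rewrite /= mem_last.
have f0A : f0 = b \/ f0 \in A.
  have : f0 \in (q :: S') ++ b :: A by move: f0c; rewrite in_cons (negbTE f0a).
  rewrite mem_cat => /orP [h|].
    by have /andP [_] := allP nS _ h; rewrite xf0.
  by rewrite inE => /orP [/eqP|]; [left|right].
case: f0A => [f0b|f0A]; last first.
  have [Q1 [Q2 EA]] : exists Q1 Q2, A = Q1 ++ f0 :: Q2.
    by case/splitPr: f0A => Q1 Q2; exists Q1, Q2.
  have [P1' EP1] : exists P1', P1 = z :: P1'.
    by case: P1 P10 EP {EP' uP1 dP hP1 only sub1} => // z' P1' _ [-> _]; exists P1'.
  have EZ : z :: (P1' ++ t :: rcons P2a s) = rcons (P1 ++ t :: P2a) s.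
    by rewrite EP1 rcons_cat rcons_cons.
  have lZ : last z (P1' ++ t :: rcons P2a s) = s.
    by rewrite last_cat /= last_rcons.
  apply: (hub_hole cf EA (z := z) (Z := P1' ++ t :: rcons P2a s)) => //.
  - rewrite EZ; have := pP; rewrite EP' -[(_ ++ s :: _)%SEQ]cat_rcons; exact: ipath_catl.
  - move=> h; rewrite EZ mem_rcons inE => /orP [/eqP ->|/sub1]; exact: Pc.
  - move=> y h yc; rewrite lZ EZ mem_rcons inE => hZ yh.
    have hP : h \in z :: P by case/orP: hZ => [/eqP ->|/sub1].
    case: (cross _ _ yc hP yh) => [[-> ->]|[_ Eh]|[xy _ _]].
    + by constructor 1.
    + case/orP: hZ => [/eqP hs|hZ]; first by rewrite -hs Eh eqxx in sl.
      by have := dP _ (_ : last z P \in s :: P2b); rewrite inE lP2b' orbT -Eh => /(_ isT) /negP.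
    case/orP: hZ => [/eqP hs|hZ]; last by constructor 3; apply: only yc hZ xy yh.
    by constructor 2; subst h; split=> //; apply: onlys.
  - by rewrite lZ.
  - by rewrite has_rcons xf0.
(* Here [f0] is [b]: the piece of the link from the last neighbour of [a] to [s] becomes the
   interior of a sector in place of [S], and what follows [s] is a shorter link for it. *)
subst f0; have : has (e a) (P1 ++ t :: P2a) by rewrite has_cat /= ta orbT.
case/split_last => R1 [g [R2 [ER hR2 ag]]].
have sub3 h : h \in g :: R2 -> h \in P1 ++ t :: P2a by move=> hh; rewrite ER mem_cat hh orbT.
case: P2b P2b0 EP' EP2 uP2 dP sub2 lP2b lP2b' => // z' P' _ EP' EP2 uP2 dP sub2 lP2b lP2b'.
have pS : ipath (g :: rcons R2 s).
  have := pP; rewrite EP' ER -catA => /(ipath_catr); rewrite cat_cons -cat_rcons -cat_cons.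
  exact: ipath_catl.
have subS h : h \in g :: rcons R2 s -> h \in z :: P.
  by rewrite -rcons_cons mem_rcons inE => /orP [/eqP -> //|/sub3 /sub1].
have sgS : seg a (g :: rcons R2 s) b.
  apply: (seg_of_link) => //.
  - rewrite has_rcons negb_or hR2 andbT; apply/negP => as_.
    by move: f0a; rewrite (onlys _ ac xa as_) eqxx.
  - by rewrite last_rcons.
  - rewrite belast_rcons; apply/hasPn => h hR; apply/negP => bh.
    by move: f0a; rewrite (only _ _ bc (sub3 _ hR) xb bh) eqxx.
  - by apply/negP => /subS /Pc []; rewrite ac.
  - by apply/negP => /subS /Pc []; rewrite bc.
have z's : e s z'.
  have := pP; rewrite EP' => /(ipath_catr); by rewrite ipath_cons2 => /and3P [].
apply: (IH (g :: rcons R2 s) z' P').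
- have := congr1 size EP'; rewrite /= !size_cat /=.
  by move: (size P) (size P1) (size P2a) (size P'); clear=> i j k l; lia.
- rewrite /config icyc_split // sgS s2 /= xA hA xa xb !andbT.
  rewrite -far_consl -nad_cons; apply/andP; split; last by apply/allP => h /subS /Pc [].
  rewrite -rcons_cons; apply/allP => h hS; apply/allP => y yA.
  have yc : y \in a :: (q :: S') ++ b :: A.
    by rewrite in_cons mem_cat [y \in b :: A]in_cons yA !orbT.
  have hP := subS _ hS; have [_ hc] := Pc _ hP.
  rewrite /nn; apply/andP; split; first by apply: contraNneq hc => ->.
  rewrite sym; apply/negP => yh; have ya : y != a.
    by apply: contraNneq aA => <-; rewrite mem_cat [y \in b :: A]in_cons yA !orbT.
  have yb : y != b.
    apply: contraTneq yA => ->; have := uq; rewrite cons_uniq cat_uniq cons_uniq.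
    by case/andP => _ /and4P [].
  have yq : y != q.
    apply: contraTneq fSA => <-; apply/negP => /andP [/allP /(_ _ yA)].
    by rewrite /nn eqxx.
  move: hS; rewrite mem_rcons inE => hS.
  case: (cross _ _ yc hP yh) => [[E _]|[_ E]|[xy _ _]].
  + by rewrite E eqxx in yq.
  + case/orP: hS => [/eqP hs|/sub3 hS]; first by rewrite -hs E eqxx in sl.
    by have := dP _ (_ : last z P \in s :: z' :: P'); rewrite inE lP2b' orbT -E => /(_ isT) /negP.
  case/orP: hS => [/eqP hs|/sub3 hS].
    by subst h; rewrite (onlys _ yc xy yh) eqxx in yb.
  by rewrite (only _ _ yc hS xy yh) eqxx in ya.
- by have := pP; rewrite EP' => /(ipath_catr) /(ipath_behead).
- move=> h hP'; have [xh hc] := Pc _ (sub2 _ hP'); split=> //.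
  have hS : h \notin g :: rcons R2 s.
    rewrite -rcons_cons mem_rcons inE negb_or; apply/andP; split.
      by apply: contraTneq hP' => ->; have /andP [] := uP2.
    by apply/negP => /sub3 h1; have := dP h; rewrite inE hP' orbT => /(_ isT) /negP.
  move: hc hS; rewrite !notin_mid => /and4P [-> _ -> ->] ->.
  by [].
- by apply/hasP; exists s; rewrite ?(sym z') // -rcons_cons mem_rcons inE eqxx.
- have -> : last z' P' = last z P by rewrite lP2b.
  by apply/hasP; exists q'; rewrite //= sym q'l.
Qed.

End LinkStep.

Section NoLink.
Implicit Types (m P Q S A U W K T Z : seq V) (p q h x y z u v w a b c d f g s t : V) (D E : {set V}).

(* Induction on the length of the link. An end of the link with several neighbours on the
   hole can be made part of S or of A, which shortens the link; otherwise the link closes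
   a hole that [theta] or [adjacent_hub] excludes. *)
Lemma no_link x a S b A z P : config x a S b A -> ipath (z :: P) ->
  (forall h, h \in z :: P -> nn x h /\ h \notin a :: S ++ b :: A) ->
  has (e z) S -> has (nonspoke x (last z P)) A -> False.
Proof.
have [n] := ubnP (size P); elim: n x a S b A z P => // n IH x a S b A z P ltn cf pP Pc zS lA.
have [[ic s1 s2 fSA] [S0 A0 nS xA hA] [xa xb nab] H1] := configP cf.
have IH1 S' A' z' P' : size P' < size P -> config x a S' b A' -> ipath (z' :: P') ->
     (forall h, h \in z' :: P' -> nn x h /\ h \notin a :: S' ++ b :: A') ->
     has (e z') S' -> has (nonspoke x (last z' P')) A' -> False.
  by move=> ltP; apply: IH; apply: leq_trans ltP _; rewrite -ltnS.
have uP := ipath_uniq pP.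
case: (boolP (has (fun h => has (e h) S) P)) => [|nSP].
  case/split_first => P1 [h [P2 [E _ hS]]]; subst P.
  apply: (IH1 S A h P2 _ cf) => //.
  - by rewrite size_cat /=; move: (size P1) (size P2) => i j; clear; lia.
  - by have := pP; rewrite -cat_cons => /(ipath_catr).
  - move=> h' h'P; apply: Pc; by rewrite -cat_cons mem_cat h'P orbT.
  - by move: lA; rewrite last_cat.
case: (boolP (has (fun h => has (nonspoke x h) A) (belast z P))) => [|nAP].
  case/split_first => P1 [h [P2 [E _ hS]]].
  have EP : z :: P = rcons P1 h ++ rcons P2 (last z P).
    by rewrite lastI E rcons_cat rcons_cons cat_rcons.
  have [P' EP'] : exists P', rcons P1 h = z :: P'.
    by case: P1 E EP => [|z' P1] E [-> _]; eexists.
  apply: (IH1 S A z P' _ cf) => //.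
  - have := congr1 size EP; rewrite EP' size_cat /= size_rcons.
    by move: (size P) (size P') (size P2); clear => i j k; lia.
  - by have := pP; rewrite EP EP'; apply: ipath_catl.
  - by move=> h' h'P; apply: Pc; rewrite EP EP' mem_cat h'P.
  - by have <- : h = last z P' by have := congr1 (last z) EP'; rewrite last_rcons.
have zP : z \in z :: P by exact: mem_head.
have lP : last z P \in z :: P by exact: mem_last.
have [xz zc] := Pc _ zP; have [xl lc] := Pc _ lP.
have [EP|[P' [l EP]]] : P = [::] \/ exists P' l, P = rcons P' l.
  by case: (lastP P) => [|P' l]; [left|right; exists P', l].
  subst P; rewrite nnC // in xz; exact: (no_link1 cf zc xz zS lA).
have zb : z \in belast z P by rewrite EP belast_rcons inE eqxx.
have nz : ~~ has (nonspoke x z) A by apply: (hasPn nAP).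
have zx : nn z x by rewrite nnC.
have lx : nn (last z P) x by rewrite nnC.
have ll : last z P = l by rewrite EP last_rcons.
(* By now only [z] touches [S] and only the last vertex touches non-spokes of [A]. If [z] can be
   absorbed into the sector, the rest of the path is a shorter link; the other end is treated in the
   same way. *)
case: (endpoint cf zc zx zS nz) => [[q qS hq]|[S' cf' [zS' sS']]]; last first.
  case: P EP uP pP Pc ltn lA IH1 {IH nSP nAP zP lP xl lc zb lx ll} => [|z1 P1] EP uP pP Pc ltn lA IH1.
    by case: P' EP.
  apply: (IH1 S' A z1 P1 _ cf') => //.
  - exact: ipath_behead pP.
  - move=> h hP; have hP' : h \in z :: z1 :: P1 by rewrite in_cons hP orbT.
    have [xh hc] := Pc _ hP'; split=> //.
    have hS' : h \notin S'.
      apply/negP => /sS'; rewrite in_cons => /orP [/eqP hz|hS].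
        by move: uP; rewrite cons_uniq -hz hP.
      by move: hc; rewrite notin_mid hS andbF.
    by move: hc; rewrite !notin_mid hS' => /and4P [-> _ -> ->].
  - apply/hasP; exists z => //; rewrite sym.
    by move: pP; rewrite ipath_cons2 => /and3P [].
case: (endpoint2 cf lc lx lA) => [[q' [q'A xq'] hq']|[A' cf' [lA' sA']]]; last first.
  have pP1 : ipath (rcons (z :: P') l) by move: pP; rewrite EP.
  have lastl : e (last z P') l.
    by move: pP1; rewrite lastI -cats1 cat_rcons ipath_cat ipath_cons2 => /and3P [_ /and3P []].
  apply: (IH1 S A' z P' _ cf') => //.
  - by rewrite EP size_rcons.
  - by move: pP1; rewrite -cats1; apply: ipath_catl.
  - move=> h hP; have hP' : h \in z :: P by rewrite EP -rcons_cons mem_rcons in_cons hP orbT.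
    have [xh hc] := Pc _ hP'; split=> //.
    have hA' : h \notin A'.
      apply/negP => /sA'; rewrite in_cons => /orP [/eqP hz|hA'].
        by move: uP; rewrite EP -rcons_cons rcons_uniq -ll -hz hP.
      by move: hc; rewrite notin_mid hA' !andbF.
    by move: hc; rewrite !notin_mid hA' => /and4P [-> -> -> _].
  - by apply/hasP; exists l; rewrite -?ll //= ll lastl -ll; case/andP: xl.
pose c := a :: S ++ b :: A.
have qc : q \in c by rewrite /c in_cons mem_cat qS orbT.
have q'c : q' \in c by rewrite /c in_cons mem_cat [q' \in b :: A]in_cons q'A !orbT.
have zq : e q z by rewrite sym hq.
have lq' : e q' (last z P) by rewrite sym hq'.
have cross y h : y \in c -> h \in z :: P -> e y h ->
     [\/ y = q /\ h = z, y = q' /\ h = last z P | [/\ e x y, h != z & h != last z P]].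
  move=> yc hP yh; case: (eqVneq h z) => [hz|hz].
    by constructor 1; split=> //; apply/eqP; rewrite -hq // -hz sym.
  case: (eqVneq h (last z P)) => [hl|hl].
    by constructor 2; split=> //; apply/eqP; rewrite -hq' // -hl sym.
  constructor 3; split=> //; apply/negPn/negP => xy.
  have hP1 : h \in P by move: hP; rewrite in_cons (negbTE hz).
  have hb : h \in belast z P by move: hP; rewrite lastI mem_rcons in_cons (negbTE hl).
  move: yc; rewrite /c in_cons mem_cat in_cons => /or4P [/eqP ya|yS|/eqP yb|yA].
  - by rewrite ya xa in xy.
  - by case/negP: nSP; apply/hasP; exists h => //; apply/hasP; exists y; rewrite // sym.
  - by rewrite yb xb in xy.
  - case/negP: nAP; apply/hasP; exists h => //; apply/hasP; exists y; rewrite //= xy andbT.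
    by rewrite sym.
have nqq' : nn q q' by have /allP /(_ _ q'A) := allP fSA _ qS.
have hc y h : y \in c -> h \in z :: P -> y != h.
  by move=> yc /Pc [_]; apply: contraNneq => <-.
(* If no spoke touches the link, cycle and link form a theta with ends [q] and [q']. *)
case: (boolP (has (fun h => has (fun y => e x y && e y h) c) (z :: P))) => [|hn]; last first.
  apply: (theta ic qc q'c nqq' pP) => // y h yc hP; split; first exact: hc.
  move=> yh; case: (cross _ _ yc hP yh) => [|| [xy _ _]]; [by left|by right|].
  by case/negP: hn; apply/hasP; exists h => //; apply/hasP; exists y; rewrite // xy.
case/split_first => P1 [t [P2 [EP2 hP1 /hasP [f fc /andP [xf ft]]]]].
have tP : t \in z :: P by rewrite EP2 mem_cat in_cons eqxx orbT.
have nq : ~~ e x q by have /andP [] := allP nS _ qS.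
have [tz tl] : t != z /\ t != last z P.
  by case: (cross _ _ fc tP ft) => [[E _]|[E _]|[]] //; rewrite E ?(negbTE nq) ?(negbTE xq') in xf.
have only y : y \in c -> e x y -> e y t -> y = f.
  move=> yc xy yt; apply/eqP/negPn/negP => yf; have [/andP [xt _] _] := Pc _ tP.
  by apply: (c4 (a := x) (b := y) (c := t) (d := f)) => //; rewrite sym.
have hP1' y h : y \in c -> h \in rcons P1 t -> e x y -> e y h -> y = f.
  move=> yc; rewrite mem_rcons in_cons => /orP [/eqP -> xy yh|hP xy yh]; first exact: only.
  by case/negP: hP1; apply/hasP; exists h => //; apply/hasP; exists y; rewrite // xy.
(* Up to [t] the link is touched by no spoke but [f], which gives a theta with ends [q] and [f]
   unless these are adjacent. *)
case: (boolP (e q f)) => [qf|qf]; last first.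
  have nqf : nn q f by rewrite /nn qf andbT; apply: contraNneq nq => ->.
  have [P1' EP1] : exists P1', P1 = z :: P1'.
    case: P1 EP2 {hP1 hP1'} => [|z' P1] [Ez _]; last by exists P1; rewrite Ez.
    by rewrite Ez eqxx in tz.
  have EZ : z :: rcons P1' t = rcons P1 t by rewrite EP1.
  have subZ h : h \in z :: rcons P1' t -> h \in z :: P.
    by rewrite EZ EP2 -cat_rcons mem_cat => ->.
  apply: (theta ic qc fc nqf (z := z) (P := rcons P1' t)) => //.
  - by rewrite EZ; move: pP; rewrite EP2 -cat_rcons; apply: ipath_catl.
  - by rewrite last_rcons.
  move=> y h yc hZ; split; first by apply: hc => //; apply: subZ.
  move=> yh; rewrite last_rcons; case: (cross _ _ yc (subZ _ hZ) yh) => [|[_ hl]|[xy _ _]].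
  - by left.
  - have : last z P \in P2.
      have := congr1 (last z) EP2; rewrite last_cat /= => ->.
      case: (P2) EP2 => [|r R] EP2; last by rewrite /= mem_last.
      by have := congr1 (last z) EP2; rewrite last_cat /= => E; rewrite E eqxx in tl.
    move=> hP2; move: uP; rewrite EP2 -cat_rcons cat_uniq -EZ => /and3P [_ /hasPn H _].
    by have := H _ hP2; rewrite /= -hl hZ.
  - right; rewrite EZ in hZ; split; first exact: hP1' hZ xy yh.
    move: hZ; rewrite mem_rcons in_cons => /orP [/eqP //|hP].
    by case/negP: hP1; apply/hasP; exists h => //; apply/hasP; exists y; rewrite // xy.
(* Within the cycle a vertex of [S] is adjacent to no spoke except the two ends of its sector. The
   case of [b] is that of [a] for the reversed configuration. *)
have : (f == a) || (f == b).
  move: fc; rewrite /c in_cons mem_cat in_cons => /or4P [->|fS|->|fA]; rewrite ?orbT //.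
    by have /andP [] := allP nS _ fS; rewrite xf.
  by have /andP [] := allP (allP fSA _ qS) _ fA; rewrite qf.
case/orP => /eqP fab; subst f.
  apply: (star_step _ cf pP Pc qS q'A xq' zq lq' cross qf EP2 ft hP1').
  by move=> S' z' P''; apply: IH1.
have cf' := config_rev cf.
apply: (star_step _ cf' pP _ _ _ xq' zq lq' _ qf EP2 ft _) => //.
- move=> S' z' P'' ltP cf2 pP'' Pc'' zS'' lA''.
  have := config_rev cf2; rewrite revK => cf3.
  apply: (IH1 (rev S') A z' P'') => //.
  + by move=> h hP; have [xh h'] := Pc'' _ hP; split=> //; rewrite -config_mem_rev !revK.
  + by rewrite has_rev.
  + by move: lA''; rewrite has_rev.
- by move=> h hP; rewrite config_mem_rev; exact: Pc.
- by rewrite mem_rev.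
- by rewrite mem_rev.
- by move=> y h; rewrite config_mem_rev; exact: cross.
- by move=> y h; rewrite config_mem_rev; exact: hP1'.
Qed.

End NoLink.

(** * Components and clique separations *)

Section Components.
Implicit Types (x y z a b c : V) (C D E K : {set V}).

Definition comp D x := [set y | conn D x y].

Lemma conn_refl D x : conn D x x. Proof. exact: connect0. Qed.

Lemma conn_edge D x y : x \in D -> y \in D -> e x y -> conn D x y.
Proof. by move=> xD yD xy; apply: connect1; rewrite /= xD yD. Qed.

Lemma conn_trans D y x z : conn D x y -> conn D y z -> conn D x z.
Proof. exact: connect_trans. Qed.

Lemma comp_refl D x : x \in comp D x. Proof. by rewrite inE conn_refl. Qed.

Lemma comp_sub D x : x \in D -> {subset comp D x <= D}.
Proof.
move=> xD y; rewrite inE => /connectP [p + ->].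
by elim/last_ind: p => // p z _; rewrite rcons_path last_rcons => /andP [_ /and3P []].
Qed.

Lemma comp_closed D x y z : y \in comp D x -> y \in D -> z \in D -> e y z -> z \in comp D x.
Proof.
rewrite !inE => xy yD zD yz; apply: conn_trans xy _; exact: conn_edge.
Qed.

Lemma comp_conn D x a b : x \in D -> a \in comp D x -> b \in comp D x -> conn (comp D x) a b.
Proof.
move=> xD aC; have aD := comp_sub xD aC; move: (aC); rewrite !inE => xa xb.
have /connectP [p + ->] : conn D a b.
  by apply: conn_trans xb; rewrite conn_sym.
elim: p a aC aD {xa} => [|c p IH] a aC aD /=; first by move=> _; apply: conn_refl.
case/andP => /and3P [_ cD ac] pp; have cC := comp_closed aC aD cD ac.
by apply: conn_trans (IH _ cC cD pp); apply: conn_edge.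
Qed.

Lemma conn_sub D D' a b : {subset D <= D'} -> conn D a b -> conn D' a b.
Proof.
move=> sD; apply: connect_sub => x y /and3P [xD yD xy]; apply: conn_edge => //; exact: sD.
Qed.

(* No clique cutset; the empty K yields connectedness. *)
Definition ncc := forall K, cliqueb e K -> forall a b, a \notin K -> b \notin K -> conn (~: K) a b.

Lemma ncc_sep C K c w : ncc -> cliqueb e K -> c \in C -> c \notin K -> w \notin C ->
  w \notin K -> (forall a b, a \in C -> e a b -> b \in C \/ b \in K) -> False.
Proof.
move=> H cK cC cK' wC wK cl; have /connectP [p + E] := H K cK c w cK' wK.
elim: p c cC {cK'} E => [|d p IH] c cC /= E; first by rewrite E cC in wC.
case/andP => /and3P [_ dK cd]; apply: IH => //; have [//|dK'] := cl _ _ cC cd.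
by move: dK; rewrite inE dK'.
Qed.

Lemma clique0 : cliqueb e set0.
Proof. by apply/forall_inP => x; rewrite inE. Qed.

Lemma clique1 x : cliqueb e [set x].
Proof.
by apply/'forall_implyP => a /set1P ->; apply/'forall_implyP => b /set1P ->; rewrite eqxx.
Qed.

Lemma clique2 x y : e x y -> cliqueb e [set x; y].
Proof.
move=> xy; apply/'forall_implyP => a /set2P [] ->; apply/'forall_implyP => b /set2P [] ->;
  by rewrite ?eqxx ?xy ?implybT // sym xy implybT.
Qed.

End Components.

Hypothesis Hncc : ncc.

(** * Star cutsets and the pieces hanging on them *)

Section FatSets.
Implicit Types (m P Q S A U W K T Z : seq V) (p q h x y z u v w a b c d f g s t : V) (B C D E : {set V}).

Definition away v := [set y | nn v y].

Lemma awayP v y : (y \in away v) = nn v y. Proof. by rewrite inE. Qed.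

(** Among the non-neighbours of [x], a shortest way from [S] to the non-spokes of [A] would be,
    without its two ends, a link forbidden by [no_link]. *)
Lemma star_cut x a S b A g h : config x a S b A -> g \in S -> h \in A -> ~~ e x h ->
  ~~ conn (away x) g h.
Proof.
move=> cf gS hA xh; apply/negP => gh.
have [[ic s1 s2 fSA] [S0 A0 nS xA hA'] [xa xb nab] H1] := configP cf.
have gD : g \in away x by rewrite awayP; apply: (allP nS).
have Yh : (h \in A) && ~~ e x h by rewrite hA xh.
have [z [p [pp sP [zS pS] [/andP [lA xl] pA]]]] := conn_link (X := mem S)
  (Y := fun y => (y \in A) && ~~ e x y) gD gh gS Yh.
have nSA y w : y \in S -> w \in A -> nn y w by move=> yS; apply: (allP (allP fSA _ yS)).
case: (lastP p) pp sP pS lA xl pA => [|p' l] pp sP pS lA xl pA.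
  by have := nSA z z zS lA; rewrite /nn eqxx.
rewrite last_rcons in lA xl; rewrite belast_rcons in pA.
case: p' pp sP pS pA => [|z1 P] pp sP pS pA.
  by move: pp; rewrite /= ipath_cons2 => /andP [zl _]; have /andP [_] := nSA z l zS lA; rewrite zl.
have pp1 : ipath (rcons (z1 :: P) l) by exact: ipath_behead pp.
apply: (no_link (z := z1) (P := P) cf).
- by move: pp1; rewrite -cats1; apply: ipath_catl.
- move=> d dP; have dP' : d \in z :: rcons (z1 :: P) l.
    by rewrite in_cons mem_rcons in_cons dP !orbT.
  have xd : nn x d by rewrite -awayP; apply: sP.
  have xd' : ~~ e x d by case/andP: xd.
  split=> //; rewrite notin_mid; apply/and4P; split.
  + by apply: contraNneq xd' => ->.
  + by apply: (hasPn pS); rewrite mem_rcons in_cons dP orbT.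
  + by apply: contraNneq xd' => ->.
  + have := hasPn pA d; rewrite in_cons dP orbT => /(_ isT); by rewrite xd' andbT.
- apply/hasP; exists z => //; rewrite sym; move: pp; rewrite /= ipath_cons2.
  by case/andP.
- apply/hasP; exists l => //=; rewrite xl andbT.
  move: pp1; rewrite lastI -cats1 cat_rcons ipath_cat.
  by rewrite ipath_cons2 => /and3P [_ /andP []].
Qed.

Definition attached C y := [exists d in C, e y d].

Lemma attachedP C y : reflect (exists2 d, d \in C & e y d) (attached C y).
Proof. exact: exists_inP. Qed.

(* Modelled on the vertices that one component of the non-neighbours of a star centre x
   has behind it, seen from another component. *)
Definition fat x y z B :=
  [/\ [/\ e x y, e x z & y != z], [/\ x \notin B, y \notin B & z \notin B],
   (forall b w, b \in B -> e b w -> [|| w \in B, w == x, w == y | w == z]),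
   (exists2 u, u \in B & e x u) & exists o, [/\ o \notin B, o != x, o != y & o != z]].

Definition comps_attach v a := [set y | e v y & attached (comp (away v) a) y].

(** A single attachment, or the empty set if there is none, would be a clique separating the
    component from [v]. *)
Lemma two_attached v a : nn v a -> exists s t,
  [/\ s != t, s \in comps_attach v a & t \in comps_attach v a].
Proof.
move=> va; have aD : a \in away v by rewrite awayP.
case: (boolP (1 < #|comps_attach v a|)) => [/card_gt1P [s [t [sA tA st]]]|].
  by exists s, t.
rewrite -leqNgt => /card_le1_eqP H; exfalso.
(* If there is no attachment, [s] is set to [a], a vertex of the component; the case [s = a] below
   then shows that nothing leaves the component. *)
have [s Hs] : exists s, forall y, y \in comps_attach v a -> y = s.
  case: (set_0Vmem (comps_attach v a)) => [E|[s sA]].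
    by exists a => y; rewrite E inE.
  by exists s => y yA; apply: H.
have cl c b : c \in comp (away v) a -> e c b -> b \notin comp (away v) a -> b = s.
  move=> cC cb bC; apply: Hs; rewrite inE; apply/andP; split; last first.
    by apply/attachedP; exists c; rewrite // sym.
  have cD := comp_sub aD cC; have : b \notin away v.
    by apply: contra bC => bD; apply: comp_closed cC cD bD cb.
  rewrite awayP /nn negb_and !negbK => /orP [/eqP vb|//].
  by move: cD; rewrite awayP vb => /andP [_]; rewrite sym cb.
have vC : v \notin comp (away v) a.
  by apply/negP => /(comp_sub aD); rewrite awayP /nn eqxx.
case: (eqVneq s a) => [sa|sa].
  apply: (ncc_sep Hncc (C := comp (away v) a) (K := set0) (c := a) (w := v)) => //.
  - exact: clique0.
  - exact: comp_refl.
  - by rewrite inE.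
  - by rewrite inE.
  - move=> c b cC cb; case: (boolP (b \in comp (away v) a)) => [|bC]; first by left.
    by have E := cl _ _ cC cb bC; move: bC; rewrite E sa comp_refl.
case: (eqVneq s v) => [sv|sv].
  apply: (ncc_sep Hncc (C := comp (away v) a) (K := set0) (c := a) (w := v)) => //.
  - exact: clique0.
  - exact: comp_refl.
  - by rewrite inE.
  - by rewrite inE.
  - move=> c b cC cb; case: (boolP (b \in comp (away v) a)) => [|bC]; first by left.
    have E := cl _ _ cC cb bC; move: cb; rewrite E sv; have := comp_sub aD cC; rewrite awayP => /andP [_].
    by rewrite sym => /negbTE ->.
apply: (ncc_sep Hncc (C := comp (away v) a) (K := [set s]) (c := a) (w := v)) => //.
- exact: clique1.
- exact: comp_refl.
- by rewrite inE eq_sym.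
- by rewrite inE eq_sym.
- move=> c b cC cb; case: (boolP (b \in comp (away v) a)) => [|bC]; first by left.
  by right; rewrite (cl _ _ cC cb bC) inE.
Qed.

(** [E] is the component of [b] once [v], the component [D0] of [a] and all attachments of [D0] are
    removed. Its boundary consists of [v] and the attachments [Y] common to both sides: at most two
    by [three_attachments], and at least two, since [v] with a single one would be a clique
    cutset. *)
Lemma fat_of_star v a b (D0 := comp (away v) a) : nn v a -> nn v b ->
  ~~ conn (away v) a b -> exists y z E,
  [/\ fat v y z E, b \in E, (forall c d, c \in E -> d \in E -> conn E c d) &
      forall w, w \in E -> w != v /\ w \notin D0 /\ w \notin comps_attach v a].
Proof.
move=> va vb ab; have aD : a \in away v by rewrite awayP.
have bD : b \in away v by rewrite awayP.
set N0 := comps_attach v a; pose W := ~: (v |: (D0 :|: N0)).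
have WE w : (w \in W) = [&& w != v, w \notin D0 & w \notin N0] by rewrite !inE !negb_or.
have bW : b \in W.
  rewrite WE; apply/and3P; split.
  - by move: vb; rewrite /nn eq_sym => /andP [].
  - by rewrite inE.
  - by rewrite inE negb_and; case/andP: vb => _ ->.
pose E := comp W b.
have EW := comp_sub bW : {subset E <= W}.
have vE : v \notin E by apply/negP => /EW; rewrite WE eqxx.
have bE : b \in E by exact: comp_refl.
have cE : forall c d, c \in E -> d \in E -> conn E c d by move=> c d; exact: comp_conn.
have bdE w z : w \in E -> e w z -> z \notin E -> z = v \/ z \in N0.
  move=> wE wz zE; have wW := EW _ wE; have : z \notin W.
    by apply: contra zE => zW; apply: comp_closed wE wW zW wz.
  rewrite WE !negb_and !negbK => /or3P [/eqP|zD|]; [by left| |by right].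
  exfalso; move: wW; rewrite WE => /and3P [wv wD wN].
  have zA := comp_sub aD zD; case: (boolP (e v w)) => vw.
    by move: wN; rewrite inE vw /=; apply/negP/negPn/attachedP; exists z.
  case/negP: wD; apply: comp_closed zD zA _ _; last by rewrite sym.
  by rewrite awayP /nn eq_sym wv.
pose D1 := comp (away v) b.
have D01 c d : c \in D0 -> d \in D1 -> nn c d.
  move=> cD dD; have cA := comp_sub aD cD; have dA := comp_sub bD dD.
  have nd : d \notin D0.
    apply: contra ab; rewrite inE => ad; apply: conn_trans ad _; rewrite conn_sym //.
    by move: dD; rewrite inE.
  rewrite /nn; apply/andP; split; first by apply: contraNneq nd => <-.
  by apply: contra nd => cd; apply: comp_closed cD cA dA cd.
have D0v d : d \in D0 -> nn v d by move=> /(comp_sub aD); rewrite awayP.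
have D1v d : d \in D1 -> nn v d by move=> /(comp_sub bD); rewrite awayP.
have D1W u : u \in D1 -> u \in W.
  move=> uD; rewrite WE; have /andP [vu nvu] := D1v _ uD; apply/and3P; split.
  - by rewrite eq_sym.
  - by apply/negP => /D01 /(_ uD); rewrite /nn eqxx.
  - by rewrite inE (negbTE nvu).
have D1E d : d \in D1 -> d \in E.
  move=> dD; rewrite inE; apply: (conn_sub D1W); apply: comp_conn => //; exact: comp_refl.
have c0 c d : c \in D0 -> d \in D0 -> conn D0 c d by apply: comp_conn.
have c1 c d : c \in D1 -> d \in D1 -> conn D1 c d by apply: comp_conn.
have N0P y : y \in N0 -> e v y /\ exists2 d, d \in D0 & e y d.
  by rewrite inE => /andP [vy /attachedP].
(* The component [D1] of [b] has two attachments. By [two_attachments] they are not both attached to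
   [D0], and one that is not lies in [E]. *)
have [u uE vu] : exists2 u, u \in E & e v u.
  have [s [t [st]]] := two_attached vb; rewrite !inE => /andP [vs /attachedP as_].
  case/andP => vt /attachedP at_.
  have [y [vy [d dD yd] yN]] : exists y, [/\ e v y, exists2 d, d \in D1 & e y d & y \notin N0].
    case: (boolP (s \in N0)) => sN; last by exists s.
    case: (boolP (t \in N0)) => tN; last by exists t.
    exfalso; apply: (two_attachments D0v D1v c0 c1 D01 st) => y.
    rewrite !inE => /orP [] /eqP ->; split=> //; first by case: (N0P _ sN).
    by case: (N0P _ tN).
  exists y => //; apply: (comp_closed (y := d)) => //; [exact: D1E|exact: D1W| |by rewrite sym].
  rewrite WE yN andbT; apply/andP; split; first by apply: contraTneq vy => ->; rewrite irr.
  by apply/negP => /D0v /andP [_]; rewrite vy.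
have DE c d : c \in D0 -> d \in E -> nn c d.
  move=> cD dE; have := EW _ dE; rewrite WE => /and3P [dv dD dN]; rewrite /nn.
  apply/andP; split; first by apply: contraNneq dD => <-.
  apply/negP => cd; have nE : c \notin E by apply/negP => /EW; rewrite WE cD andbF.
  have dc : e d c by rewrite sym.
  have [E1|E1] := bdE _ _ dE dc nE.
    by move: cD; rewrite E1 => /D0v; rewrite /nn eqxx.
  by have [vc _] := N0P _ E1; have /andP [_] := D0v _ cD; rewrite vc.
pose Y := [set y in N0 | attached E y].
have YP y : y \in Y -> [/\ e v y, y \notin E, exists2 d, d \in D0 & e y d &
     exists2 d, d \in E & e y d].
  rewrite inE => /andP [yN /attachedP aE]; have [vy aD0] := N0P _ yN; split=> //.
  by apply/negP => /EW; rewrite WE yN !andbF.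
have bdY w z : w \in E -> e w z -> z \notin E -> z = v \/ z \in Y.
  move=> wE wz zE; case: (bdE _ _ wE wz zE) => [|zN]; [by left|right].
  by rewrite inE zN; apply/attachedP; exists w; rewrite // sym.
have aE : a \notin E by apply/negP => /EW; rewrite WE comp_refl andbF.
have aN : a \notin N0 by rewrite inE negb_and; case/andP: va => _ ->.
have Y2 : #|Y| <= 2.
  rewrite leqNgt; apply/negP => /card_gt2P [y1 [y2 [y3 [[yY1 yY2 yY3] [d12 d23 d31]]]]].
  apply: (three_attachments D0v vE c0 cE DE d12 _ d23).
    by rewrite eq_sym d31.
  by move=> y; rewrite 2!in_cons mem_seq1 => /or3P [] /eqP ->; apply: YP.
have Y1 : 1 < #|Y|.
  rewrite ltnNge; apply/negP => /card_le1_eqP H.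
  have [s [vs Hs]] : exists s, (e v s \/ s = v) /\ (forall y, y \in Y -> y = s) /\ s \notin E /\ s != a.
    case: (set_0Vmem Y) => [E0|[s sY]].
      by exists v; split; [right|split; [by move=> y; rewrite E0 inE|split=> //; case/andP: va]].
    exists s; have [vs sE _ _] := YP _ sY; split; [by left|split; [by move=> y yY; apply: H|split=> //]].
    by apply: contraTneq vs => ->; case/andP: va.
  case: Hs => Hs [sE sa].
  apply: (ncc_sep Hncc (C := E) (K := [set v; s]) (c := b) (w := a)) => //.
  - by case: vs => [vs|->]; [apply: clique2|rewrite setUid; exact: clique1].
  - by rewrite !inE negb_or; apply/andP; split; [apply: contraTneq bE|apply: contraTneq bE] => ->.
  - by rewrite !inE negb_or eq_sym [a == s]eq_sym sa andbT; case/andP: va.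
  - move=> w z wE wz; case: (boolP (z \in E)) => [|zE]; [by left|right].
    by case: (bdY _ _ wE wz zE) => [->|/Hs ->]; rewrite !inE eqxx ?orbT.
have /card_gt1P [y [z [yY zY yz]]] := Y1.
have [vy yE _ _] := YP _ yY; have [vz zE _ _] := YP _ zY.
have yzY w : w \in Y -> w = y \/ w = z.
  move=> wY; case: (eqVneq w y) => [|wy]; [by left|right].
  apply/eqP; apply: contraTT Y2 => wz; rewrite -ltnNge; apply/card_gt2P.
  by exists y, z, w; split; [|rewrite yz [z == w]eq_sym wz wy].
exists y, z, E; split=> //; last first.
  by move=> w /EW; rewrite WE => /and3P [].
split=> //; last 2 first.
- by exists u.
- exists a; split=> //; first by case/andP: va; rewrite eq_sym.
  + by apply: contraNneq aN => ->; move: yY; rewrite inE => /andP [].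
  + by apply: contraNneq aN => ->; move: zY; rewrite inE => /andP [].
move=> c w cE' cw; case: (boolP (w \in E)) => //= wE.
case: (bdY _ _ cE' cw wE) => [->|/yzY [] ->]; by rewrite eqxx ?orbT.
Qed.

End FatSets.

(** * Runs of degree-two vertices and forks *)

Section ReducibleConfigurations.
Implicit Types (p : seq V) (a c d u w x y z : V).

(** The vertices of [p] have no neighbours off the path, whereas the ends [a] and [d] are
    unrestricted and may coincide. *)
Fixpoint run a p d : Prop :=
  if p is c :: p' then [/\ e a c, forall w, e c w -> w = a \/ w = head d p' & run c p' d] else e a d.

Definition long_run k := exists a p d,
  [/\ size p = k, run a p d, uniq p, a \notin p & d \notin p].

Definition fork k := exists u x y z R1 R2,
  [/\ e u x /\ [/\ size R1 = k, size R2 = k, run u R1 y & run u R2 z], uniq (u :: R1 ++ R2),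
      [/\ x \notin u :: R1 ++ R2, y \notin u :: R1 ++ R2 & z \notin u :: R1 ++ R2] &
      forall w, e u w -> [\/ w = x, w = head x R1 | w = head x R2]].

End ReducibleConfigurations.

(** * Hubs as star centres, and smaller fat sets *)

Section Shrinking.
Implicit Types (m P Q S A U W K T Z : seq V) (p q h x y z u v w a b c d f g s t : V) (B C D E : {set V}).

(** The closed neighbourhood of [v] is a cutset. *)
Definition starc v := [exists a, exists b, [&& nn v a, nn v b & ~~ conn (away v) a b]].

Definition nbs v := [set w | e v w].

(** As [b] is adjacent to [v], it has an even, hence at least two, number of neighbours in [P]. So
    [s] lies in the sector of [b] between [v] and the first of them, [t] lies beyond the second, and
    [star_cut] separates the two. *)
Lemma between_star v s t b : between v (away v) s t b -> e v b -> s != b -> t != b ->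
  ~~ conn (away b) s t /\ starc b.
Proof.
case=> P [H sP hb] vb sb tb.
move: (H); rewrite hole_seg // => /and5P [P0 sg vs vt nvP].
have bP : b \notin P by apply/negP => /sP; rewrite awayP /nn vb andbF.
have bL : b \notin s :: rcons P t.
  by rewrite in_cons mem_rcons in_cons !negb_or bP andbT ![b == _]eq_sym sb.
have bv : e b v by rewrite sym.
have nbs' : nn b s by apply: nn_tri vb vs _; rewrite // eq_sym.
have nbt : nn b t by apply: nn_tri vb vt _; rewrite // eq_sym.
have ev := count_adj H bv bL.
have [P1 [q1 [R [EP hP1 bq1]]]] := split_first hb.
have : has (e b) R.
  rewrite has_count; move: ev; rewrite EP count_cat /= bq1 (count0 hP1).
  by case: (count _ R).
case/split_first => P2 [q2 [P3 [ER hP2 bq2]]]; subst R.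
have ic : icyc (v :: (s :: P1) ++ q1 :: P2 ++ q2 :: rcons P3 t).
  by move: (H : icyc (v :: s :: rcons P t)); rewrite EP rcons_cat !rcons_cons rcons_cat rcons_cons.
have bn u : u \in P -> nn b u -> ~~ e b u by move=> _ /andP [].
have nbP1 : nad b P1.
  by apply/nadP; split=> //; apply: contra bP => h; rewrite EP mem_cat h.
have nbP2 : nad b P2.
  by apply/nadP; split=> //; apply: contra bP => h; rewrite EP mem_cat in_cons mem_cat h !orbT.
have bP3 : b \notin P3.
  by apply: contra bP => h; rewrite EP mem_cat in_cons mem_cat in_cons h !orbT.
have bv' : b != v := e_neq bv.
have bq2' : b != q2 := e_neq bq2.
have cf1 : config b v (s :: P1) q1 (P2 ++ q2 :: rcons P3 t).
  rewrite /config ic bv bq1 nad_cons nbs' nbP1 has_cat /= bq2 orbT !andbT /=.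
  rewrite mem_cat in_cons mem_rcons in_cons !negb_or bP3 bq2' (nad_notin nbP2) andbT /=.
  by rewrite eq_sym.
have P20 : P2 != [::].
  apply: contraTneq sg => E; apply/negP; rewrite EP E /= seg_cat // => /and4P [_ + _ _].
  by rewrite seg_cons => /andP [q12 _]; have := tri bq1 q12; rewrite bq2.
have cf2 : config b q1 P2 q2 (rcons P3 t ++ v :: s :: P1).
  rewrite /config P20 nbP2 bq1 bq2 has_cat /= bv orbT !andbT; apply/andP; split.
    have := icyc_catC (s := v :: s :: P1) (t := q1 :: P2 ++ q2 :: rcons P3 t) ic.
    by rewrite -!cat_cons -!catA.
  rewrite mem_cat mem_rcons !in_cons !negb_or bP3 bv' (nad_notin nbP1) ![b == _]eq_sym sb tb.
  by [].
have st : ~~ conn (away b) s t.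
  apply: (star_cut cf1); first by rewrite mem_head.
    by rewrite mem_cat in_cons mem_rcons mem_head !orbT.
  by case/andP: nbt.
by split=> //; apply/existsP; exists s; apply/existsP; exists t; rewrite nbs' nbt st.
Qed.

Lemma fat_sym x y z B : fat x y z B -> fat x z y B.
Proof.
case=> [[xy xz yz] [xB yB zB] bd hu [o [o1 o2 o3 o4]]]; split=> //.
- by rewrite eq_sym.
- move=> b w bB bw; have := bd b w bB bw; by rewrite [(w == y) || _]orbC.
- by exists o.
Qed.

Lemma conn_in B E (K : {set V}) a b : (forall c d, c \in E -> d \in E -> conn E c d) ->
  (forall w, w \in E -> w \notin K) ->
  (forall c d, c \in B -> e c d -> d \in B \/ d \in K) ->
  a \in E -> a \in B -> b \in E -> b \in B.
Proof.
move=> cE EK cl aE aB bE; have /connectP [p + ->] := cE _ _ aE bE.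
elim: p a aB {aE} => //= c p IH a aB /andP [/and3P [_ cE' ac]]; apply: IH.
by have [//|] := cl _ _ aB ac; rewrite (negbTE (EK _ cE')).
Qed.

Lemma fat_bd x y z B b w : fat x y z B -> b \in B -> e b w -> w \in B \/ w \in [set x; y; z].
Proof.
case=> _ _ bd _ _ bB bw; have := bd _ _ bB bw; rewrite !inE.
by case/or4P => ->; [left|right|right|right]; rewrite ?orbT.
Qed.

(** The piece [E] behind the star of [v] on the side of [b] avoids [x], [y], [z], which are the only
    exits of [B]. It meets [B] and is connected, so it stays inside. *)
Lemma fat_shrink x y z B v a b : fat x y z B -> nn v a -> nn v b -> ~~ conn (away v) a b ->
  [&& x \in v |: (comp (away v) a :|: comps_attach v a),
      y \in v |: (comp (away v) a :|: comps_attach v a) &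
      z \in v |: (comp (away v) a :|: comps_attach v a)] ->
  v \in B \/ b \in B ->
  exists y' z' E, [/\ fat v y' z' E, b \in E & {subset E <= B}].
Proof.
move=> F va vb ab /and3P [hx hy hz] hB.
have [y' [z' [E [FE bE cE hE]]]] := fat_of_star va vb ab.
have nE w : w \in E -> w \notin v |: (comp (away v) a :|: comps_attach v a).
  by move=> /hE [h1 [h2 h3]]; rewrite !in_setU in_set1 !negb_or h1 h2.
have EK w : w \in E -> w \notin [set x; y; z].
  by move=> /nE wn; rewrite !inE !negb_or; apply/andP; split; first (apply/andP; split);
     apply: contraNneq wn => ->.
have [w wE wB] : exists2 w, w \in E & w \in B.
  case: hB => [vB|bB]; last by exists b.
  have [_ _ _ [u uE vu] _] := FE; exists u => //.
  by have [//|] := fat_bd F vB vu; rewrite (negbTE (EK _ uE)).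
exists y', z', E; split=> // c cE'.
apply: conn_in cE EK _ wE wB cE' => c' d; exact: fat_bd F.
Qed.

(** If [y] had no neighbour in the outer component, the edge [x], [z] would be a clique cutset
    between it and [B]; the same holds with [y] and [z] exchanged. *)
Lemma fat_outside x y z B : fat x y z B -> exists O : {set V},
  [/\ forall c d, c \in O -> d \in O -> conn O c d,
     forall c, c \in O -> c \notin B /\ c \notin [set x; y; z],
     exists2 d, d \in O & e y d & exists2 d, d \in O & e z d].
Proof.
move=> F; have [[xy xz yz] [xB yB zB] bd [u uB xu] [o [oB ox oy oz]]] := F.
pose W := ~: (B :|: [set x; y; z]).
have WE w : (w \in W) = (w \notin B) && (w \notin [set x; y; z]).
  by rewrite in_setC in_setU negb_or.
have oW : o \in W by rewrite WE oB !inE !negb_or ox oy oz.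
pose O := comp W o.
have OW := comp_sub oW : {subset O <= W}.
have uO : u \notin O by apply/negP => /OW; rewrite WE uB.
have bO c d : c \in O -> e c d -> d \in O \/ d \in [set x; y; z].
  move=> cO cd; case: (boolP (d \in W)) => [dW|].
    by left; apply: comp_closed cO (OW _ cO) dW cd.
  rewrite WE negb_and !negbK => /orP [dB|]; last by right.
  have := OW _ cO; rewrite WE => /andP [cB cK].
  have dc : e d c by rewrite sym.
  by have [cB'|cK'] := fat_bd F dB dc; [rewrite cB' in cB|rewrite cK' in cK].
have att s t : t \in [set x; y; z] -> e x s -> s != t -> [set x; y; z] = [set x; s; t] ->
    t != x -> u != s -> (exists2 d, d \in O & e t d).
  move=> tK xs st EK tx us; case: (boolP (attached O t)) => [/attachedP //|nt]; exfalso.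
  apply: (ncc_sep Hncc (C := O) (K := [set x; s]) (c := o) (w := u)).
  - exact: clique2.
  - exact: comp_refl.
  - have := oW; rewrite WE EK => /andP [_]; rewrite !inE !negb_or => /andP [/andP [-> ->] _].
    by [].
  - exact: uO.
  - rewrite !inE negb_or us andbT; apply: contraTneq xu => ->; by rewrite irr.
  - move=> c d cO cd; case: (bO _ _ cO cd) => [|]; [by left|].
    rewrite EK !inE => /orP [->|/eqP dt]; first by right.
    by case/negP: nt; apply/attachedP; exists c; rewrite // -dt sym.
exists O; split.
- by move=> c d; apply: comp_conn.
- by move=> c /OW; rewrite WE => /andP.
- apply: (att z y) => //.
  + by rewrite !inE eqxx orbT.
  + by rewrite eq_sym.
  + by apply/setP => w; rewrite !inE -!orbA [(w == y) || _]orbC.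
  + by rewrite eq_sym (e_neq).
  + by apply: contraNneq zB => <-.
- apply: (att y z) => //.
  + by rewrite !inE eqxx orbT.
  + by rewrite eq_sym (e_neq).
  + by apply: contraNneq yB => <-.
Qed.

End Shrinking.

Hypothesis nonuniv : forall v, exists w, nn v w.
Variable r : nat.
Hypothesis r_gt0 : 0 < r.
Hypothesis hlong : forall x p, hole x p -> r.*2.+2 <= size p.

Section Runs.
Implicit Types (m P Q S A U W K T Z : seq V) (p q h x y z u v w a b c d f g s t : V) (B C D E : {set V}).

Lemma near_component v a w w0 : nn v a -> w0 \in comp (away v) a -> e w w0 ->
  w \in v |: (comp (away v) a :|: comps_attach v a).
Proof.
move=> va wC ww; rewrite !in_setU in_set1; case: (eqVneq w v) => //= wv.
have aD : a \in away v by rewrite awayP.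
case: (boolP (e v w)) => vw.
  by apply/orP; right; rewrite inE vw; apply/attachedP; exists w0.
apply/orP; left; apply: comp_closed wC (comp_sub aD wC) _ _; last by rewrite sym.
by rewrite awayP /nn eq_sym wv.
Qed.

(** All three exits lie on one side of the star of [v]: that of [x] if [v] is not adjacent to [x],
    and otherwise that of [y], from which [z] is reached through the outside of [B]. *)
Lemma fat_root x y z B v : fat x y z B -> v \in B -> exists2 a, nn v a &
  [&& x \in v |: (comp (away v) a :|: comps_attach v a),
      y \in v |: (comp (away v) a :|: comps_attach v a) &
      z \in v |: (comp (away v) a :|: comps_attach v a)].
Proof.
move=> F vB; have [[xy xz yz] [xB yB zB] _ _ _] := F.
have ne w : w \notin B -> v != w by move=> wB; apply: contraTneq vB => ->.
have refl a : a \in v |: (comp (away v) a :|: comps_attach v a).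
  by rewrite !in_setU comp_refl orbT.
case: (boolP (e v x)) => vx; last first.
  have nvx : nn v x by rewrite /nn ne.
  exists x; rewrite // refl /=.
  by rewrite !(@near_component v x _ x) ?comp_refl // sym.
have nvy : nn v y by rewrite /nn ne // (tri vx xy).
exists y; rewrite // refl (@near_component v y x y) ?comp_refl //=.
have [O [cO OB [d1 d1O yd1] [d2 d2O zd2]]] := fat_outside F.
have OA c : c \in O -> c \in away v.
  move=> /OB [cB cK]; rewrite awayP /nn ne //=; apply/negP => vc.
  by have [h|h] := fat_bd F vB vc; [rewrite h in cB|rewrite h in cK].
apply: (near_component (w0 := d2)) => //; rewrite inE.
apply: (conn_trans (y := d1)); first by apply: conn_edge; [rewrite awayP|exact: OA|].
exact: conn_sub OA (cO _ _ d1O d2O).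
Qed.

(** The piece obtained lies in [B] and misses its own centre [v]. *)
Lemma fat_shrink_in x y z B v : fat x y z B -> v \in B -> starc v ->
  exists y' z' E, fat v y' z' E /\ #|E| < #|B|.
Proof.
move=> F vB /existsP [a0 /existsP [b0 /and3P [va0 vb0 ab0]]].
have [a va hm] := fat_root F vB.
have [b vb ab] : exists2 b, nn v b & ~~ conn (away v) a b.
  case: (boolP (conn (away v) a a0)) => h1; last by exists a0.
  case: (boolP (conn (away v) a b0)) => h2; last by exists b0.
  by case/negP: ab0; apply: conn_trans h2; rewrite conn_sym.
have [|y' [z' [E [FE _ sE]]]] := fat_shrink F va vb ab hm; first by left.
exists y', z', E; split=> //; apply/proper_card/properP; split; first by apply/subsetP.
by exists v => //; have [_ [] ] := FE.
Qed.

(** The centre [y] is itself an exit of [B], so strictness needs an argument: if the new piece were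
    all of [B], then [z], which is not adjacent to [y], would not be on its boundary, and the edge
    [x], [y] would be a clique cutset. *)
Lemma fat_shrink_at x y z B v s t : fat x y z B -> v \in B -> e v s -> e v t ->
  e v y -> nn y s -> nn y t -> ~~ conn (away y) s t ->
  exists y' z' E, fat y y' z' E /\ #|E| < #|B|.
Proof.
move=> F vB vs vt vy ys yt st; have [[xy xz yz] [xB yB zB] bd [u uB xu] [o [oB ox oy oz]]] := F.
have nyz : nn y z by rewrite /nn yz /=; apply: tri xz; rewrite sym.
have inB w : e v w -> nn y w -> w != z -> w \in B.
  move=> vw yw wz; have [//|] := fat_bd F vB vw; rewrite !inE (negbTE wz) orbF.
  case/orP => /eqP E; subst w; first by case/andP: yw; rewrite sym xy.
  by move: yw; rewrite /nn eqxx.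
have [s' [ys' zs' s'B]] : exists s', [/\ nn y s', ~~ conn (away y) z s' & s' \in B].
  case: (boolP (conn (away y) z s)) => h1; last first.
    by exists s; split=> //; apply: inB => //; apply: contraNneq h1 => ->; exact: conn_refl.
  case: (boolP (conn (away y) z t)) => h2; last first.
    by exists t; split=> //; apply: inB => //; apply: contraNneq h2 => ->; exact: conn_refl.
  by case/negP: st; apply: conn_trans h2; rewrite conn_sym.
have hm : [&& x \in y |: (comp (away y) z :|: comps_attach y z),
      y \in y |: (comp (away y) z :|: comps_attach y z) &
      z \in y |: (comp (away y) z :|: comps_attach y z)].
  rewrite (@near_component y z x z) ?comp_refl //= !in_setU comp_refl in_set1 eqxx orbT.
  by [].
have [|y' [z' [E [FE _ sE]]]] := fat_shrink F nyz ys' zs' hm; first by right.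
exists y', z', E; split=> //; apply/proper_card; rewrite properE; apply/andP; split.
  by apply/subsetP.
apply/negP => /subsetP BE; have EB : E = B.
  by apply/eqP; rewrite eqEsubset; apply/andP; split; apply/subsetP.
subst E; have [[yy' yz' _] _ bd' _ _] := FE.
apply: (ncc_sep Hncc (C := B) (K := [set x; y]) (c := u) (w := o)) => //.
- exact: clique2.
- by rewrite !inE negb_or; apply/andP; split; [apply: contraNneq xB|apply: contraNneq yB] => <-.
- by rewrite !inE negb_or ox oy.
- move=> c d cB cd; case: (boolP (d \in B)) => dB; [by left|right].
  have := fat_bd F cB cd; rewrite (negbTE dB) !inE => -[//|] /orP [-> //|/eqP dz].
  have := bd' _ _ cB cd; rewrite (negbTE dB) dz /= => /or3P [] /eqP E.
  + by rewrite E eqxx in yz.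
  + by move: nyz; rewrite E /nn yy' andbF.
  + by move: nyz; rewrite E /nn yz' andbF.
Qed.

(** Otherwise [v] alone would separate [y1] from [y2]. *)
Lemma other_nbr v y1 y2 : e v y1 -> y2 != v -> y1 != y2 -> exists2 d, d \in away v & e y1 d.
Proof.
move=> vy1 y2v y12.
have [d dv yd] : exists2 d, d != v & e y1 d.
  case: (boolP [exists d, (d != v) && e y1 d]) => [/existsP [d /andP [dv yd]]|nd].
    by exists d.
  exfalso; apply: (ncc_sep Hncc (C := [set y1]) (K := [set v]) (c := y1) (w := y2)) => //.
  - exact: clique1.
  - by rewrite inE.
  - by rewrite inE eq_sym (e_neq).
  - by rewrite inE eq_sym.
  - by rewrite inE.
  - move=> a b; rewrite inE => /eqP -> yb; right; rewrite inE; apply: contraNT nd => bv.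
    by apply/existsP; exists b; rewrite bv.
by exists d; rewrite // awayP /nn eq_sym dv (tri vy1 yd).
Qed.

(** The non-neighbours of [v] are connected because [v] is no star centre, so [triple] applies to
    all of them at once. *)
Lemma triple_star v y1 y2 y3 : ~~ starc v -> e v y1 -> e v y2 -> e v y3 ->
  y1 != y2 -> y1 != y3 -> y2 != y3 -> exists s t b,
  [/\ s \in [:: y1; y2; y3], t \in [:: y1; y2; y3], b \in [:: y1; y2; y3],
      [/\ s != t, s != b & t != b] & between v (away v) s t b].
Proof.
move=> ns v1 v2 v3 d12 d13 d23.
have vD d : d \in away v -> nn v d by rewrite awayP.
have cD a b : a \in away v -> b \in away v -> conn (away v) a b.
  rewrite !awayP => va vb; apply: contraNT ns => ab.
  by apply/existsP; exists a; apply/existsP; exists b; rewrite va vb ab.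
have ev w : e v w -> w != v by move=> vw; rewrite eq_sym (e_neq).
have d21 : y2 != y1 by rewrite eq_sym.
have d31 : y3 != y1 by rewrite eq_sym.
have d32 : y3 != y2 by rewrite eq_sym.
have [i1 i2 i3] : [/\ y1 \in [:: y1; y2; y3], y2 \in [:: y1; y2; y3] & y3 \in [:: y1; y2; y3]].
  by rewrite !inE !eqxx !orbT.
have [] := triple vD cD v1 v2 v3 d12 d13 d23 (other_nbr v1 (ev _ v2) d12)
  (other_nbr v2 (ev _ v1) d21) (other_nbr v3 (ev _ v1) d31).
- by exists y1, y2, y3.
- by exists y1, y3, y2.
- by exists y2, y3, y1.
Qed.

Lemma run_take a (s : seq V) n : path e a s -> uniq (a :: s) -> n < size s ->
  (forall c, c \in take n s -> #|nbs c| <= 2) -> run a (take n s) (nth a s n).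
Proof.
have [k] := ubnP (size s); elim: k a s n => // k IH a [|c s] [|n] //= ltk /andP [ac ps]
  /and3P [aU cU us] ltn H.
  exact: ac.
split=> //; last first.
  have -> : nth a s n = nth c s n by apply: set_nth_default.
  apply: IH => //; first by rewrite /= cU.
  by move=> d ds; apply: H; rewrite in_cons ds orbT.
case: s ps aU cU us ltn H {ltk} => // c' s /= /andP [cc' _] aU _ _ _ H w cw.
have -> : head (nth a (c' :: s) n) (if n is n'.+1 then c' :: take n' s else [::]) = c'.
  by case: (n).
have := H c; rewrite in_cons eqxx => /(_ isT).
case: (eqVneq w a) => [|wa]; first by left.
case: (eqVneq w c') => [|wc]; first by right.
rewrite leqNgt => /negP; case; apply/card_gt2P; exists a, c', w.
rewrite !inE sym ac cc' cw; split=> //; split=> //; last by rewrite eq_sym.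
by move: aU; rewrite !inE !negb_or => /and3P [].
Qed.

Lemma ipath_path a (s : seq V) : ipath (a :: s) -> path e a s.
Proof.
elim: s a => //= b s IH a; rewrite ipath_cons2 => /and3P [-> _ /IH ->].
by [].
Qed.

End Runs.

(** * A reducible configuration inside a smallest fat set *)

Section FatReducible.
Implicit Types (m P Q S A U W K T Z : seq V) (p q h x y z u v w a b c d f g s t : V) (B C D E : {set V}).

(** The exits of [B] are [x] and two of its neighbours, and [P] contains none of these. *)
Lemma chain_in x y z B c P : fat x y z B -> ipath (c :: P) -> c \in B -> nad x P ->
  {subset P <= B}.
Proof.
move=> F; have [[xy xz yz] _ _ _ _] := F.
elim: P c => // d P IH c; rewrite ipath_cons2 nad_cons => /and3P [cd _ pP] cB /andP [xd xP].
have dB : d \in B.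
  have [//|] := fat_bd F cB cd; rewrite !inE -orbA; case/andP: xd => xd nxd.
  by case/or3P => /eqP E; subst d; rewrite ?xy ?xz ?eqxx in xd nxd.
by move=> w; rewrite inE => /orP [/eqP -> //|]; apply: IH pP dB xP w.
Qed.

(** A hole has at least [2r + 3] vertices, so [2r] are left besides [x], [u] and [q1]. *)
Lemma sector_run u x s P1 q1 : (forall c, c \in s :: P1 -> #|nbs c| <= 2) ->
  hole x (u :: rcons (s :: P1) q1) -> exists R y',
  [/\ size R = r.*2, run u R y', head u R = s, exists R', s :: P1 = R ++ R' &
      y' \in s :: rcons P1 q1 /\ y' \notin R].
Proof.
move=> dg H; have lr := hlong H; have pP : ipath (u :: rcons (s :: P1) q1) by case/and5P: H.
have lt : r.*2 < size (rcons (s :: P1) q1).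
  by move: lr; rewrite /= !size_rcons /= ltnS.
have uq := ipath_uniq pP.
have le : r.*2 <= size (s :: P1) by move: lt; rewrite size_rcons ltnS.
have tE : take r.*2 (rcons (s :: P1) q1) = take r.*2 (s :: P1).
  by rewrite -cats1 take_cat; case: ltngtP le => // ->; rewrite subnn take0 cats0 take_size.
exists (take r.*2 (s :: P1)), (nth u (rcons (s :: P1) q1) r.*2); split.
- by rewrite size_takel.
- rewrite -tE; apply: (run_take (ipath_path pP)) => //.
  by move=> c; rewrite tE => /mem_take; apply: dg.
- by case: r r_gt0.
- by exists (drop r.*2 (s :: P1)); rewrite cat_take_drop.
- split; first by rewrite -rcons_cons mem_nth.
  move: uq; rewrite cons_uniq => /andP [_].
  rewrite -{1}(cat_take_drop r.*2 (rcons (s :: P1) q1)) cat_uniq => /and3P [_ /hasPn hd _].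
  rewrite -tE; apply: (hd (nth u (rcons (s :: P1) q1) r.*2)).
  rewrite -[X in nth _ _ X]addn0 -nth_drop mem_nth //; by rewrite size_drop subn_gt0.
Qed.

(** In a smallest fat set no vertex is a star centre, and [fat_shrink_at] excludes [y] and [z] as
    hubs. So among any three neighbours of a vertex of [B] the hub is [x], and the vertices of [B]
    not adjacent to [x] have degree at most two. The degree of a neighbour [u] of [x] in [B] decides
    between the two outcomes. *)
Lemma fat_reducible x y z B : fat x y z B -> long_run r.*2.+1 \/ fork r.*2.
Proof.
have [n] := ubnP #|B|; elim: n x y z B => // n IH x y z B ltn F.
have [[xy xz yz] [xB yB zB] bd [u uB xu] _] := F.
have IH' x' y' z' E : fat x' y' z' E -> #|E| < #|B| -> long_run r.*2.+1 \/ fork r.*2.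
  by move=> FE ltE; apply: IH FE; apply: leq_trans ltE _; rewrite -ltnS.
case: (boolP [exists v in B, starc v]) => [/exists_inP [v vB sv]|ns].
  have [y' [z' [E [FE ltE]]]] := fat_shrink_in F vB sv; exact: IH' FE ltE.
have {}ns v : v \in B -> ~~ starc v by move=> vB; apply: contra ns => sv; apply/exists_inP; exists v.
have [//|H3] : (long_run r.*2.+1 \/ fork r.*2) \/
  forall v y1 y2 y3, v \in B -> e v y1 -> e v y2 -> e v y3 -> y1 != y2 -> y1 != y3 -> y2 != y3 ->
  exists s t, [/\ s \in [:: y1; y2; y3], t \in [:: y1; y2; y3], x \in [:: y1; y2; y3],
      [/\ s != t, s != x & t != x] & between v (away v) s t x].
  pose good := [exists v in B, exists b, exists s, exists t,
     [&& e v b, e v s, e v t, nn b s, nn b t, ~~ conn (away b) s t & (b == y) || (b == z)]].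
  case: (boolP good) => [gd|ng]; [left|right].
    case/exists_inP: gd => v vB /existsP [b /existsP [s /existsP [t]]].
    case/and5P => vb vs vt bs /and3P [bt st /orP [] /eqP E]; subst b.
      have [y' [z' [E [FE ltE]]]] := fat_shrink_at F vB vs vt vb bs bt st.
      exact: IH' FE ltE.
    have [y' [z' [E [FE ltE]]]] :=
      fat_shrink_at (fat_sym F) vB vs vt vb bs bt st.
    exact: IH' FE ltE.
  move=> v y1 y2 y3 vB v1 v2 v3 d12 d13 d23.
  have vv w : w \in [:: y1; y2; y3] -> e v w by rewrite !inE => /or3P [] /eqP ->.
  have [s [t [b [sY tY bY [st sb tb] bt]]]] :=
    triple_star (ns _ vB) v1 v2 v3 d12 d13 d23.
  have [nst cb] := between_star bt (vv _ bY) sb tb.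
  have bx : b = x.
    have [bB|] := fat_bd F vB (vv _ bY); first by have := ns _ bB; rewrite cb.
    rewrite !inE -orbA => /or3P [/eqP //|hb|hb].
      case/negP: ng; apply/exists_inP; exists v => //; apply/existsP; exists b.
      apply/existsP; exists s; apply/existsP; exists t; rewrite !vv // nst hb !andbT.
      by rewrite !(nn_tri (vv _ bY)) ?vv // eq_sym.
    case/negP: ng; apply/exists_inP; exists v => //; apply/existsP; exists b.
    apply/existsP; exists s; apply/existsP; exists t; rewrite !vv // nst hb orbT !andbT.
    by rewrite !(nn_tri (vv _ bY)) ?vv // eq_sym.
  by subst b; exists s, t.
have deg2 v : v \in B -> ~~ e x v -> #|nbs v| <= 2.
  move=> vB nxv; rewrite leqNgt; apply/negP => /card_gt2P.
  case=> y1 [y2 [y3 [[+ + +] [d12 d23 d31]]]]; rewrite !inE => v1 v2 v3.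
  have d13 : y1 != y3 by rewrite eq_sym.
  have [s [t [_ _ xY _ _]]] := H3 v y1 y2 y3 vB v1 v2 v3 d12 d13 d23.
  by move: xY nxv; rewrite !inE sym => /or3P [] /eqP ->; rewrite ?v1 ?v2 ?v3.
have ux : e u x by rewrite sym.
have xu' : x != u := e_neq xu.
have inB v w : v \in B -> e v w -> nn x w -> w \in B.
  move=> vB vw /andP [xw nxw]; have [//|] := fat_bd F vB vw; rewrite !inE -orbA.
  by case/or3P => /eqP E; subst w; rewrite ?xy ?xz ?eqxx in xw nxw.
(* If [u] has degree at most two, a hole through the edge [x], [u], which is no clique cutset,
   supplies the run: [u] followed by [2r] vertices of [B] not adjacent to [x]. *)
case: (leqP #|nbs u| 2) => du.
  left; have yu : y != u by apply: contraNneq yB => ->.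
  have [c cD uc] : exists2 c, c \in away x & e u c.
    apply: (other_nbr (y2 := y) xu); first by rewrite eq_sym (e_neq).
    by rewrite eq_sym.
  have yx : y != x by rewrite eq_sym (e_neq).
  have cxu : c \notin [set x; u].
    rewrite !inE negb_or [c == u]eq_sym (e_neq uc) andbT.
    by move: cD; rewrite awayP eq_sym => /andP [].
  have yxu : y \notin [set x; u] by rewrite !inE negb_or yx.
  have cy := Hncc (clique2 xu) cxu yxu.
  have cD' : c \in ~: [set x; u] by rewrite in_setC.
  have [z0 [p [pp sP [uz hu] [xl hx]]]] := conn_link (X := e u) (Y := e x) cD' cy uc xy.
  have nu w : w \in z0 :: p -> (w != x) && (w != u).
    by move/sP; rewrite !inE negb_or.
  have Em : z0 :: p = rcons (belast z0 p) (last z0 p) by rewrite lastI.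
  set m := belast z0 p in Em hx; set l := last z0 p in Em xl.
  have m0 : m != [::].
    apply/eqP => m0; move: Em; rewrite m0 => -[Ez _].
    by have := tri xu uz; rewrite Ez xl.
  have nup : nad u p.
    apply/nadP; split=> //; apply/negP => up.
    have : u \in z0 :: p by rewrite in_cons up orbT.
    by case/nu/andP; rewrite eqxx.
  have Hh : hole x (u :: rcons m l).
    rewrite hole_seg // m0 xu xl /=; apply/andP; split.
      by rewrite /seg -Em ipath_cons2 uz nup pp.
    apply/nadP; split=> //; apply/negP => xm.
    have := nu x; rewrite eqxx Em mem_rcons in_cons xm orbT => /(_ isT).
    by [].
  have nxm : nad x m by move: Hh; rewrite hole_seg // => /and5P [].
  have lr := hlong Hh; have pU : ipath (u :: rcons m l) by case/and5P: Hh.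
  have Ez0 : exists m', m = z0 :: m'.
    case: (m) m0 Em => // z' m' _; rewrite rcons_cons => -[-> _]; by exists m'.
  have mB : {subset m <= B}.
    case: Ez0 => m' Em'; rewrite Em' in nxm pU *.
    move: nxm; rewrite nad_cons => /andP [nz nm].
    have z0B := inB _ _ uB uz nz.
    move=> w; rewrite in_cons => /orP [/eqP -> //|].
    apply: (chain_in F _ z0B nm); move: pU; rewrite rcons_cons => /ipath_behead.
    by rewrite -rcons_cons -cats1; apply: ipath_catl.
  have sm : r.*2 <= size m by move: lr; rewrite /= size_rcons !ltnS.
  have tE : take r.*2.+1 (u :: rcons m l) = u :: take r.*2 m.
    by rewrite /= -cats1 take_cat; case: ltngtP sm => // ->; rewrite subnn take0 cats0 take_size.
  have uq : uniq (x :: u :: rcons m l).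
    by rewrite cons_uniq (ipath_uniq pU) andbT; case/and4P: Hh.
  exists x, (take r.*2.+1 (u :: rcons m l)), (nth x (u :: rcons m l) r.*2.+1); split.
  - by rewrite size_takel // ltnW.
  - apply: (run_take) => //; first by rewrite /= xu; apply: (ipath_path pU).
    move=> c0; rewrite tE in_cons => /orP [/eqP -> //|/mem_take c0m].
    apply: deg2; first exact: mB.
    by have /andP [] := allP nxm _ c0m.
  - by apply: take_uniq; case/andP: uq.
  - by apply/negP => /mem_take; apply/negP; case/andP: uq.
  - move: uq; rewrite cons_uniq => /andP [_].
    rewrite -{1}(cat_take_drop r.*2.+1 (u :: rcons m l)) cat_uniq => /and3P [_ /hasPn hd _].
    apply: (hd (nth x (u :: rcons m l) r.*2.+1)).
    rewrite -[X in nth _ _ X]addn0 -nth_drop mem_nth //.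
    by rewrite size_drop subn_gt0.
right; case/card_gt2P: du => y1 [y2 [y3 [[+ + +] [d12 d23 d31]]]]; rewrite !inE => v1 v2 v3.
have d13 : y1 != y3 by rewrite eq_sym.
have [s [t [sY tY _ [st sx tx] [P [H sP hx]]]]] := H3 u y1 y2 y3 uB v1 v2 v3 d12 d13 d23.
have vv w : w \in [:: y1; y2; y3] -> e u w by rewrite !inE => /or3P [] /eqP ->.
have us := vv _ sY; have ut := vv _ tY.
have nxs : nn x s by apply: nn_tri ux us _; rewrite // eq_sym.
have nxt : nn x t by apply: nn_tri ux ut _; rewrite // eq_sym.
(* A fourth neighbour [w] would form with [s] and [t] a triple without [x], against [H3]. *)
have nbu w : e u w -> [\/ w = x, w = s | w = t].
  move=> uw; case: (eqVneq w x) => [|wx]; first by constructor 1.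
  case: (eqVneq w s) => [|ws]; first by constructor 2.
  case: (eqVneq w t) => [|wt]; first by constructor 3.
  have sw : s != w by rewrite eq_sym.
  have tw : t != w by rewrite eq_sym.
  have [s' [t' [_ _ xY _ _]]] := H3 u s t w uB us ut uw st sw tw.
  by move: xY; rewrite !inE [x == s]eq_sym [x == t]eq_sym [x == w]eq_sym (negbTE sx) (negbTE tx) (negbTE wx).
(* Each direction of the hole is followed from [u] to the nearest neighbour of [x]; with [x] this
   sector is a hole and yields one run of the fork. *)
have half s' t' P1 q1 R : hole u (s' :: rcons (P1 ++ q1 :: R) t') ->
   {subset P1 ++ q1 :: R <= away u} -> nn x s' -> e u s' -> ~~ has (e x) P1 -> e x q1 ->
   exists R1 y', [/\ size R1 = r.*2, run u R1 y', head u R1 = s',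
     exists R', s' :: P1 = R1 ++ R' & y' \in s' :: rcons P1 q1 /\ y' \notin R1].
  move=> {H sP hx} H sP xs' us' hP1 xq1.
  have xP : x \notin P1 ++ q1 :: R by apply/negP => /sP; rewrite awayP /nn ux andbF.
  have ic : icyc (u :: (s' :: P1) ++ q1 :: rcons R t').
    by move: (H : icyc (u :: s' :: rcons (P1 ++ q1 :: R) t')); rewrite rcons_cat rcons_cons.
  have R0 : rcons R t' != [::] by case: (R).
  move: ic; rewrite icyc_split // => /and3P [sg _ _].
  have nxP1 : nad x P1.
    by apply/nadP; split=> //; apply: contra xP => h; rewrite mem_cat h.
  have Hh : hole x (u :: rcons (s' :: P1) q1).
    by rewrite hole_seg // sg xu xq1 nad_cons xs' nxP1.
  apply: sector_run Hh => c cP.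
  have s'B : s' \in B by apply: inB uB us' xs'.
  have nxc : nad x (s' :: P1) by rewrite nad_cons xs'.
  apply: deg2; last by have /andP [] := allP nxc _ cP.
  move: cP; rewrite in_cons => /orP [/eqP -> //|].
  apply: (chain_in F _ s'B nxP1); move: sg => /ipath_behead.
  by rewrite -/(rcons (s' :: P1) q1) -cats1; apply: ipath_catl.
have xP : x \notin P by apply/negP => /sP; rewrite awayP /nn ux andbF.
have xL : x \notin s :: rcons P t.
  rewrite in_cons mem_rcons in_cons !negb_or xP andbT; case/andP: nxs => ->.
  by case/andP: nxt => ->.
have ev := count_adj H xu xL.
have [P1 [q1 [R [EP hP1 xq1]]]] := split_first hx.
have : has (e x) R.
  rewrite has_count; move: ev; rewrite EP count_cat /= xq1 (count0 hP1).
  by case: (count _ R).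
case/split_last => M [q2 [P3 [ER hP3 xq2]]]; subst R.
have H' : hole u (t :: rcons (rev P) s).
  by have := hole_rev H; rewrite rev_cons rev_rcons.
have sP' : {subset rev P <= away u} by move=> w; rewrite mem_rev; apply: sP.
have ErP : rev P = rev P3 ++ q2 :: rev M ++ q1 :: rev P1.
  by rewrite EP !(rev_cat, rev_cons) -!cats1 -!catA.
rewrite ErP in H' sP'; rewrite EP in H sP.
have [R1 [y' [sz1 rn1 hd1 [R1' E1] [y'P y'R]]]] := half _ _ _ _ _ H sP nxs us hP1 xq1.
have hP3' : ~~ has (e x) (rev P3) by rewrite has_rev.
have [R2 [z' [sz2 rn2 hd2 [R2' E2] [z'P z'R]]]] := half _ _ _ _ _ H' sP' nxt ut hP3' xq2.
(* The vertices of the hole, rearranged: centre and runs first, then the rest, in which the far ends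
   [y'] and [z'] lie. *)
have : uniq ((u :: R1 ++ R2) ++ (R1' ++ q1 :: M ++ q2 :: R2')).
  rewrite -(@perm_uniq _ (u :: s :: rcons (P1 ++ q1 :: M ++ q2 :: P3) t)).
    exact: (icyc_uniq (c := u :: s :: rcons (P1 ++ q1 :: M ++ q2 :: P3) t)) H.
  apply/permP => a; have := congr1 (count a) E1; have := congr1 (count a) E2.
  have cc w W : count a (w :: W) = a w + count a W by [].
  rewrite -!cats1 !(cc, count_cat, count_rev) /=; move: (count a); clear => k; lia.
rewrite cat_uniq => /and3P [uR /hasPn hX _].
have inX w : w \in R1' ++ q1 :: M ++ q2 :: R2' -> w \notin u :: R1 ++ R2 by exact: hX.
have y'X : y' \in R1' ++ q1 :: M ++ q2 :: R2'.
  move: y'P; rewrite -rcons_cons E1 mem_rcons in_cons mem_cat (negbTE y'R) /=.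
  by rewrite mem_cat in_cons => /orP [|] ->; rewrite ?orbT.
have z'X : z' \in R1' ++ q1 :: M ++ q2 :: R2'.
  move: z'P; rewrite -rcons_cons E2 mem_rcons in_cons mem_cat (negbTE z'R) /=.
  by rewrite mem_cat in_cons mem_cat in_cons => /orP [|] ->; rewrite ?orbT.
have xR : x \notin u :: R1 ++ R2.
  have i1 w : w \in R1 -> w \in s :: P1 by move=> h; rewrite E1 mem_cat h.
  have i2 w : w \in R2 -> w \in t :: rev P3 by move=> h; rewrite E2 mem_cat h.
  rewrite in_cons mem_cat (negbTE xu') /=; apply/negP => /orP [/i1|/i2].
    rewrite in_cons => h; move: xL; rewrite EP in_cons mem_rcons in_cons mem_cat !negb_or.
    by case/and4P => xs _ xP1 _; move: h; rewrite (negbTE xs) (negbTE xP1).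
  rewrite in_cons mem_rev => h; move: xL.
  rewrite EP in_cons mem_rcons in_cons mem_cat in_cons mem_cat in_cons !negb_or.
  by case/and5P => _ xt _ _ /and3P [_ _ xP3]; move: h; rewrite (negbTE xt) (negbTE xP3).
have sz0 : 0 < r.*2 by rewrite double_gt0.
exists u, x, y', z', R1, R2; split.
- by [].
- exact: uR.
- by rewrite xR !inX.
- move=> w /nbu []; [by constructor 1|constructor 2|constructor 3].
    by case: (R1) sz1 hd1 => [E|c l _ /= -> //]; rewrite -E in sz0.
  by case: (R2) sz2 hd2 => [E|c l _ /= -> //]; rewrite -E in sz0.
Qed.

End FatReducible.

Section Structure.

Lemma run_notin v (L : seq V) n : uniq (v :: L) -> n < size L ->
  [/\ uniq (take n L), v \notin take n L & nth v L n \notin take n L].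
Proof.
rewrite cons_uniq => /andP [vL uL] lt; split.
- exact: take_uniq.
- by apply: contra vL; apply: mem_take.
- move: uL; rewrite -{1}(cat_take_drop n L) cat_uniq => /and3P [_ /hasPn hd _].
  apply: (hd (nth v L n)); rewrite -[X in nth _ _ X]addn0 -nth_drop mem_nth //.
  by rewrite size_drop subn_gt0.
Qed.

(** If there is no star cutset, [triple_star] followed by [between_star] bounds every degree by two,
    and any hole contains a long run. *)
Theorem reducible (v : V) : long_run r.*2.+1 \/ fork r.*2.
Proof.
case: (boolP [exists v, starc v]) => [/existsP [x /existsP [a /existsP [b /and3P [xa xb ab]]]]|ns].
  have [y [z [E [F _ _ _]]]] := fat_of_star xa xb ab.
  exact: (fat_reducible F).
case: (boolP [exists v, 2 < #|nbs v|]) => [/existsP [x /card_gt2P]|nd].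
  case=> y1 [y2 [y3 [[+ + +] [d12 d23 d31]]]]; rewrite !inE => v1 v2 v3.
  have d13 : y1 != y3 by rewrite eq_sym.
  have nx : ~~ starc x by apply: contra ns => sx; apply/existsP; exists x.
  have [s [t [b [_ _ bY [_ sb tb] bt]]]] := triple_star nx v1 v2 v3 d12 d13 d23.
  have xb : e x b by move: bY; rewrite !inE => /or3P [] /eqP ->.
  have [_ sB] := between_star bt xb sb tb.
  by case/negP: ns; apply/existsP; exists b.
left; have dg c : #|nbs c| <= 2.
  by rewrite leqNgt; apply: contra nd => h; apply/existsP; exists c.
have [a va] := nonuniv v; have aD : a \in away v by rewrite awayP.
have [s [t [st]]] := two_attached va.
rewrite !inE => /andP [vs /attachedP [c cC sc]] /andP [vt /attachedP [d dC td]].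
have cd := comp_conn aD cC dC.
have [z [p [pp sP [sz hs] [tl ht]]]] := conn_link (X := e s) (Y := e t) cC cd sc td.
have H : hole v (s :: rcons (z :: p) t).
  apply: (link_hole (D := comp (away v) a)) => //.
  by move=> w /(comp_sub aD); rewrite awayP.
have lr := hlong H; set L := s :: _ in H lr.
have pL : ipath L by case/and5P: H.
have uq : uniq (v :: L) by apply: (icyc_uniq (c := v :: L)).
have [u1 u2 u3] := run_notin uq lr.
exists v, (take r.*2.+1 L), (nth v L r.*2.+1); split=> //; first by rewrite size_takel // ltnW.
by apply: (run_take) => //; rewrite /L /= vs; apply: (ipath_path pL).
Qed.

End Structure.

End Holes.

Arguments ipath : simpl never.

(** * Extending a colouring of a blow-up *)

Section Sets.
Variables (C : finType) (N : nat).
Hypothesis cardC : #|{: C}| = N.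
Implicit Types (A B D X Y Z : {set C}) (n b : nat).

Lemma set_between X Y n : X \subset Y -> #|X| <= n <= #|Y| ->
  exists Z, [/\ X \subset Z, Z \subset Y & #|Z| = n].
Proof.
elim: n => [|n IH] XY /andP [lX lY].
  by exists X; split=> //; apply/eqP; rewrite -leqn0.
case: (eqVneq #|X| n.+1) => [E|nE]; first by exists X.
have lX' : #|X| <= n by move: lX nE; clear; lia.
have [|Z [XZ ZY cZ]] := IH XY; first by rewrite lX' ltnW.
have [y yY yZ] : exists2 y, y \in Y & y \notin Z.
  by apply/subsetPn; apply: contraTN lY => /subset_leq_card; rewrite cZ -ltnNge ltnS.
exists (y |: Z); split; last by rewrite cardsU1 yZ cZ.
  by apply: subset_trans XZ _; apply: subsetUr.
by rewrite subUset sub1set yY.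
Qed.

Lemma cardsCN A : #|A| + #|~: A| = N.
Proof. by rewrite cardsC. Qed.

Lemma disjointCr A B : [disjoint A & B] = (B \subset ~: A).
Proof. by rewrite disjoint_sym disjoints_subset. Qed.

(** [B1] takes as many colours as possible from [D] outside [A]. These cost [B2] nothing, since it
    has to avoid [D] anyway. *)
Lemma run2 A D b1 b2 : b1 + #|A| <= N -> b2 + #|D| <= N ->
  b1 + b2 + #|A :&: D| <= N -> exists B1 B2,
  [/\ #|B1| = b1, #|B2| = b2, [disjoint A & B1], [disjoint B1 & B2] & [disjoint B2 & D]].
Proof.
move=> h1 h2 h3; have cA := cardsCN A; have cD := cardsCN D.
have nA : #|~: A :&: D| + #|A :&: D| = #|D|.
  by rewrite -(cardsID A D) addnC setIC [D :&: A]setIC setIC setDE [~: A :&: D]setIC.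
have nA' : #|~: A :\: D| + #|~: A :&: D| = #|~: A| by rewrite -(cardsID D (~: A)) addnC.
case: (leqP b1 #|~: A :&: D|) => hb.
  have [||B1 [_ B1s cB1]] := @set_between set0 (~: A :&: D) b1.
  - by rewrite sub0set.
  - by rewrite cards0.
  have [||B2 [_ B2s cB2]] := @set_between set0 (~: D) b2.
  - by rewrite sub0set.
  - by rewrite cards0 /=; move: cD h2; clear; lia.
  move: B1s; rewrite subsetI => /andP [B1A B1D].
  exists B1, B2; split=> //; first by rewrite disjointCr.
    rewrite disjoints_subset; apply: subset_trans B1D _.
    by rewrite -disjoints_subset disjointCr.
  by rewrite disjoints_subset.
have [||B1 [B1l B1A cB1]] := @set_between (~: A :&: D) (~: A) b1.
- exact: subsetIl.
- by rewrite ltnW //=; move: cA h1; clear; lia.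
have [||B2 [_ B2s cB2]] := @set_between set0 (~: (B1 :|: D)) b2.
- by rewrite sub0set.
- rewrite cards0 /=; have := cardsCN (B1 :|: D); rewrite cardsU.
  have -> : B1 :&: D = ~: A :&: D.
    by apply/eqP; rewrite eqEsubset setSI //= subsetI B1l subsetIr.
  by move: h3 hb cB1 nA; clear; lia.
move: B2s; rewrite setCU subsetI => /andP [B2B B2D].
by exists B1, B2; split; rewrite // ?disjointCr // -disjointCr disjoint_sym disjointCr.
Qed.

Lemma run1 A D b : b + #|A :|: D| <= N -> exists B,
  [/\ #|B| = b, [disjoint A & B] & [disjoint B & D]].
Proof.
move=> h; have [||B [_ Bs cB]] := @set_between set0 (~: (A :|: D)) b.
- by rewrite sub0set.
- by rewrite cards0 /=; have := cardsCN (A :|: D); move: h; clear; lia.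
exists B; move: Bs; rewrite setCU subsetI => /andP [BA BD].
by rewrite disjointCr disjoints_subset.
Qed.

(** [B2] is fixed first, so that [run1] finds [B1] and [run2] finds [B3], [B4]. The exclusion is
    genuine: with [A = D] and all sizes 3 the sets would colour a 5-cycle, where each colour appears
    at most twice and 15 places need 8 colours. *)
Lemma run4 A D b1 b2 b3 b4 : b1 + #|A| < N -> b1 + b2 < N -> b2 + b3 < N ->
  b3 + b4 < N -> b4 + #|D| < N -> N <= 7 -> ~~ ((A == D) && (#|A| == 3)) ->
  exists B1 B2 B3 B4, [/\ #|B1| = b1, #|B2| = b2, #|B3| = b3, #|B4| = b4 &
    [/\ [disjoint A & B1], [disjoint B1 & B2], [disjoint B2 & B3], [disjoint B3 & B4] &
        [disjoint B4 & D]]].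
Proof.
move=> h1 h12 h23 h34 h4 hC hAD.
have cA := cardsID D A; have cD := cardsID A D; rewrite [D :&: A]setIC in cD.
have exc : ~ (#|A :\: D| = 0 /\ #|D :\: A| = 0 /\ #|A :&: D| = 3).
  case=> /eqP; rewrite cards_eq0 setD_eq0 => hA [/eqP].
  rewrite cards_eq0 setD_eq0 => hD hI; case/negP: hAD.
  have E : A = D by apply/eqP; rewrite eqEsubset hA.
  by rewrite E eqxx /=; rewrite E setIid in hI; rewrite hI.
(* B2 must meet A in at least [al] points to leave room for B1; among such sets it is
   chosen to meet D as little as possible, which leaves room for B3 and B4. *)
pose al := #|A| + b1 + b2 - N.
have [||X1 [_ X1s cX1]] := @set_between set0 (A :\: D) (minn al #|A :\: D|).
- by rewrite sub0set.
- by rewrite cards0 geq_minr.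
have [||X0 [_ X0s cX0]] := @set_between set0 (A :&: D) (al - #|A :\: D|).
- by rewrite sub0set.
- by rewrite cards0 /= /al; move: cA cD h1 h12; clear; lia.
have dX : [disjoint X1 & X0].
  rewrite disjoints_subset; apply: subset_trans X1s _; apply/subsetP => w; rewrite !inE.
  by case/andP => wD _; apply: contra wD => /(subsetP X0s); rewrite inE => /andP [].
have XA : X1 :|: X0 \subset A.
  by rewrite subUset (subset_trans X1s (subsetDl _ _)) (subset_trans X0s (subsetIl _ _)).
have cX : #|X1 :|: X0| = al.
  move: dX; rewrite -leq_card_setU => /eqP ->; rewrite cX1 cX0 /al; move: cA h1 h12; clear; lia.
have X0D : X0 \subset D by apply: subset_trans X0s (subsetIr _ _).
have X1D : X1 \subset ~: D.
  apply/subsetP => w /(subsetP X1s); rewrite !inE; by case/andP.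
have dW : [disjoint X0 & ~: D] by rewrite disjoints_subset setCK.
have cW : #|X0 :|: ~: D| + #|D| = #|X0| + N.
  move: dW; rewrite -leq_card_setU => /eqP ->; have := cardsCN D; clear; lia.
have [B2 [cB2 B2A B2D]] : exists B2,
  [/\ #|B2| = b2, #|A| + b1 + b2 <= N + #|A :&: B2| & b3 + b4 + #|B2 :&: D| <= N].
  have XB B2 : X1 :|: X0 \subset B2 -> al <= #|A :&: B2|.
    by move=> h; rewrite -cX subset_leq_card // subsetI XA.
  case: (leqP b2 #|X0 :|: ~: D|) => hb.
    have [||B2 [B2l B2u cB2]] := @set_between (X1 :|: X0) (X0 :|: ~: D) b2.
    - by rewrite setUC setUS.
    - by rewrite cX hb andbT /al; move: h1 h12; clear; lia.
    exists B2; split=> //; first by have := XB _ B2l; rewrite /al; clear; lia.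
    have : #|B2 :&: D| <= #|X0|.
      apply: subset_leq_card; apply/subsetP => w; rewrite inE => /andP [/(subsetP B2u)].
      by rewrite !inE => /orP [//|/negbTE ->].
    (* With [N <= 7], failure of the count is possible only in the excluded case. *)
    move=> hl; rewrite leqNgt; apply/negP => hbad; apply: exc.
    move: hl hbad; rewrite cX0 /al; move: cA cD h1 h12 h23 h34 h4 hC.
    move: #|A :&: D| #|A :\: D| #|D :\: A| #|A| #|D| N #|B2 :&: D| => i a' d' a d k n.
    by clear; move=> *; lia.
  have [||B2 [B2l _ cB2]] := @set_between (X0 :|: ~: D) setT b2.
  - exact: subsetT.
  - by rewrite (ltnW hb) cardsT cardC; move: h12; clear; lia.
  exists B2; split=> //.
    have /XB : X1 :|: X0 \subset B2 by apply: subset_trans B2l; rewrite setUC setUS.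
    by rewrite /al; clear; lia.
  have := cardsID D B2; have : #|~: D| <= #|B2 :\: D|.
    apply: subset_leq_card; rewrite setDE subsetI subxx andbT; apply: subset_trans B2l.
    exact: subsetUr.
  by have := cardsCN D; move: h23 h4 h34 cB2; clear; lia.
have [|B1 [cB1 AB1 B12]] := @run1 A B2 b1.
  have := cardsUI A B2; move: cB2 B2A; clear; lia.
have [|||B3 [B4 [cB3 cB4 d1 d2 d3]]] := @run2 B2 D b3 b4.
- move: h23 cB2; clear; lia.
- by move: h4; clear; lia.
- by [].
by exists B1, B2, B3, B4; split=> //; split.
Qed.

End Sets.

(** * Extension to long runs and forks *)

Section Fits.
Variables (C : finType) (N : nat).
Hypothesis cardC : #|{: C}| = N.
Implicit Types (A B D X Y Z : {set C}) (n b : nat).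

Definition disj A B := [disjoint A & B].

(** [run2] serves [r = 1] with 5 colours and [run4] serves [r = 2] with 7. The strict inequalities
    express that two adjacent classes leave at least one colour free. *)
Lemma run_fits (r : nat) A D (bs : seq nat) : (r == 1) || (r == 2) -> N <= r.*2 + 3 ->
  size bs = r.*2 -> path (fun x y => x + y < N) #|A| (rcons bs #|D|) ->
  ~~ ((A == D) && (#|A| == r.+1)) ->
  exists2 Bs, map (fun B : {set C} => #|B|) Bs = bs & path disj A (rcons Bs D).
Proof.
case/orP => /eqP ->.
  have -> : 1.*2 + 3 = 5 by [].
  case: bs => [|b1 [|b2 [|]]] //= hC _ /and4P [h1 h12 h2 _] hAD.
  have cA := cardsID D A; have cD := cardsID A D; rewrite [D :&: A]setIC in cD.
  have exc : ~ (#|A :\: D| = 0 /\ #|D :\: A| = 0 /\ #|A :&: D| = 2).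
    case=> /eqP; rewrite cards_eq0 setD_eq0 => hA [/eqP].
    rewrite cards_eq0 setD_eq0 => hD hI; case/negP: hAD.
    have E : A = D by apply/eqP; rewrite eqEsubset hA.
    by rewrite E eqxx /=; rewrite E setIid in hI; rewrite hI.
  have [|||B1 [B2 [c1 c2 d1 d2 d3]]] := @run2 _ _ cardC A D b1 b2.
  - by move: h1; clear; lia.
  - by move: h2; clear; lia.
  - rewrite leqNgt; apply/negP => hbad; apply: exc.
    move: cA cD h1 h12 h2 hC hbad.
    move: #|A :&: D| #|A :\: D| #|D :\: A| #|A| #|D| N => i a' d' a d n.
    by clear; move=> *; lia.
  by exists [:: B1; B2]; rewrite /= ?c1 ?c2 // /disj d1 d2 d3.
have -> : 2.*2 + 3 = 7 by [].
case: bs => [|b1 [|b2 [|b3 [|b4 [|]]]]] //= hC _ /and5P [h1 h12 h23 h34 /andP [h4 _]] hAD.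
have [|B1 [B2 [B3 [B4 [c1 c2 c3 c4 [d1 d2 d3 d4 d5]]]]]] :=
  @run4 _ _ cardC A D b1 b2 b3 b4 _ h12 h23 h34 h4 hC hAD.
- by rewrite addnC.
by exists [:: B1; B2; B3; B4]; rewrite /= ?c1 ?c2 ?c3 ?c4 // /disj d1 d2 d3 d4 d5.
Qed.

(** At least [n + 1] colours are free. Omitting any one of [n + 1] gives a set of size [n], and for
    [n > 1] these are at least three sets, so that two can be avoided. *)
Lemma choose_set A Y Z n : n + #|A| < N ->
  exists U : {set C}, [/\ #|U| = n, [disjoint A & U] & 1 < n -> U != Y /\ U != Z].
Proof.
move=> h; have [||M [_ MA cM]] := @set_between _ set0 (~: A) n.+1.
- by rewrite sub0set.
- by rewrite cards0 /=; have := cardsCN cardC A; move: h; clear; lia.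
have [x xM hx] : exists2 x, x \in M & 1 < n -> M :\ x != Y /\ M :\ x != Z.
  case: (leqP n 1) => hn.
    have /card_gt0P [x xM] : 0 < #|M| by rewrite cM.
    by exists x => //; rewrite ltnNge hn.
  have /card_gt2P [x1 [x2 [x3 [[h1 h2 h3] [d12 d23 d31]]]]] : 2 < #|M| by rewrite cM ltnS.
  have inj x y : x \in M -> M :\ x = M :\ y -> x = y.
    move=> xM E; apply/eqP; apply: contraT => xy.
    by have := setD11 x M; rewrite E !inE xM xy.
  case: (boolP ((M :\ x1 != Y) && (M :\ x1 != Z))) => [/andP [? ?]|]; first by exists x1.
  case: (boolP ((M :\ x2 != Y) && (M :\ x2 != Z))) => [/andP [? ?]|]; first by exists x2.
  case: (boolP ((M :\ x3 != Y) && (M :\ x3 != Z))) => [/andP [? ?]|]; first by exists x3.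
  rewrite !negb_and !negbK => /orP [] /eqP E3 /orP [] /eqP E2 /orP [] /eqP E1; exfalso;
    first [ by move: d12; rewrite (inj x1 x2) ?eqxx // E1 E2
          | by move: d23; rewrite (inj x2 x3) ?eqxx // E2 E3
          | by move: d31; rewrite (inj x3 x1) ?eqxx // E1 E3].
exists (M :\ x); split=> //; first by have := cardsD1 x M; rewrite xM cM; case.
by rewrite disjointCr; apply: subset_trans MA; apply: subsetDl.
Qed.

Variables (V : finType) (e : rel V) (w : V -> nat).
Hypotheses (sym : symmetric e) (irr : irreflexive e).
Implicit Type (S : V -> {set C}).

(** A proper colouring of the blow-up of [W] by cliques of sizes [w], recorded through the set of
    colours on each clique. *)
Definition setcol (W : {set V}) S := (forall x, x \in W -> #|S x| = w x) /\
  forall x y, x \in W -> y \in W -> e x y -> disj (S x) (S y).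

Definition upd S c B := fun x => if x == c then B else S x.

Lemma setcol1 W S c B : setcol W S -> #|B| = w c ->
  (forall y, y \in W -> e c y -> disj (S y) B) -> c \notin W -> setcol (c |: W) (upd S c B).
Proof.
move=> [h1 h2] cB hB cW; split=> [x|x y]; rewrite !inE /upd.
  by case: eqP => [->|_] //=; apply: h1.
case: (eqVneq x c) => [->|xc] /=; case: (eqVneq y c) => [->|yc] /= xW yW exy.
- by rewrite irr in exy.
- by rewrite /disj disjoint_sym; apply: hB.
- by apply: hB; rewrite // sym.
- exact: h2.
Qed.

Lemma setcol_run W S a p d Bs : setcol W S -> run e a p d -> uniq p -> a \in W -> d \in W ->
  {in p, forall c, c \notin W} -> map (fun B => #|B|) Bs = map w p ->
  path disj (S a) (rcons Bs (S d)) -> exists S', setcol (W :|: [set c in p]) S' /\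
  (forall c, c \in W -> S' c = S c).
Proof.
elim: p a W S Bs => [|c p IH] a W S Bs hS /=.
  move=> _ _ _ _ _ _ _; exists S; split=> //.
  suff -> : W :|: [set c in [::]] = W by [].
  by apply/setP => x; rewrite !inE orbF.
case=> ac nc rp /andP [cp up] aW dW pW; case: Bs => [|B Bs] //= -[cB cBs] /andP [aB pB].
have cW : c \notin W by apply: pW; rewrite mem_head.
have ca : c != a by apply: contraNneq cW => ->.
have cd : c != d by apply: contraNneq cW => ->.
have ne y : y \in W -> (y == c) = false.
  by move=> yW; apply/eqP => E; rewrite -E yW in cW.
have hS' : setcol (c |: W) (upd S c B).
  apply: setcol1 => // y yW /nc [->|] //; case: p cp {IH nc rp up} pW cBs pB => /= [_ _|c' p _ pW _ _].
    by case: Bs => //= _; rewrite andbT => hd ->; rewrite /disj disjoint_sym.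
  by move=> Ey; move: (pW y); rewrite Ey !inE eqxx orbT -Ey yW => /(_ isT).
have [|||||S' [hS2 hS3]] := IH c (c |: W) (upd S c B) Bs hS' rp up.
- by rewrite setU11.
- by rewrite setU1r.
- move=> x xp; rewrite !inE negb_or pW ?andbT; first by apply: contraNneq cp => <-.
  by rewrite in_cons xp orbT.
- by [].
- by rewrite /upd eqxx ne.
exists S'; split; last by move=> x xW; rewrite hS3 ?setU1r // /upd ne.
suff -> : W :|: [set x in c :: p] = (c |: W) :|: [set c in p] by [].
by apply/setP => x; rewrite !inE orbCA orbA.
Qed.

Hypothesis hw : forall x y, e x y -> w x + w y < N.

Lemma run_path a p d : run e a p d ->
  path (fun x y => x + y < N) (w a) (rcons (map w p) (w d)).
Proof.
elim: p a => [|c p IH] a /=; first by move=> /hw ->.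
by case=> /hw -> _ /IH.
Qed.

Lemma extend_run r W S a p d : (r == 1) || (r == 2) -> N <= r.*2 + 3 -> setcol W S ->
  run e a p d -> uniq p -> a \in W -> d \in W -> {in p, forall c, c \notin W} ->
  size p = r.*2 -> ~~ ((S a == S d) && (#|S a| == r.+1)) ->
  exists S', setcol (W :|: [set c in p]) S' /\ (forall c, c \in W -> S' c = S c).
Proof.
move=> hr hN hS rp up aW dW pW sp hne; have [h1 _] := hS.
have [||Bs cBs pB] := @run_fits r (S a) (S d) (map w p) hr hN _ _ hne.
- by rewrite size_map.
- by rewrite !h1 //; apply: run_path.
exact: (setcol_run hS rp up aW dW pW cBs pB).
Qed.

(** The first vertex of the run takes a set different from that of [d], which removes the
    obstruction for the other [2r]. *)
Lemma extend_long r a p d S : (r == 1) || (r == 2) -> N <= r.*2 + 3 ->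
  size p = r.*2.+1 -> run e a p d -> uniq p -> a \notin p -> d \notin p ->
  setcol (~: [set c in p]) S -> exists S', setcol setT S'.
Proof.
move=> hr hN; case: p => // c p [sp] rp /= /andP [cp up] ap dp hS.
have hd R : size R = r.*2 -> head d R \in R.
  by case: R => [|? ?] /=; [case: (r) hr|rewrite mem_head].
have [ac nc rp'] := rp; set W := ~: _ in hS.
have WE x : (x \in W) = (x \notin c :: p) by rewrite !inE.
have aW : a \in W by rewrite WE.
have dW : d \in W by rewrite WE.
have cW : c \notin W by rewrite WE mem_head.
have [h1 _] := hS.
have [|U [cU aU hU]] := @choose_set (S a) (S d) (S d) (w c).
  by rewrite h1 // addnC hw.
have ne y : y \in W -> (y == c) = false by move=> yW; apply/eqP => E; rewrite -E yW in cW.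
have hS' : setcol (c |: W) (upd S c U).
  apply: setcol1 => // y yW /nc [->|E] //.
  by move: yW; rewrite WE in_cons E hd ?orbT.
have [||||S' [hS2 _]] := extend_run hr hN hS' rp' up _ _ _ sp.
- by rewrite setU11.
- by rewrite setU1r.
- move=> x xp; rewrite in_setU1 WE in_cons negb_or xp orbT andbT.
  by apply: contraNneq cp => <-.
- rewrite /upd eqxx ne //; apply/negP => /andP [/eqP E /eqP E2].
  have [|] := hU; last by rewrite E eqxx.
  by rewrite -cU E2; case: (r) hr.
exists S'; suff <- : (c |: W) :|: [set c in p] = setT by [].
by apply/setP => x; rewrite in_setU in_setU1 WE !inE negb_or; case: (x == c); case: (x \in p).
Qed.

(** The only coloured neighbour of [u] is [x], so the set of [u] can be kept different from those of
    both [y] and [z]. The runs then extend one after the other. *)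
Lemma extend_fork r u x y z R1 R2 S : (r == 1) || (r == 2) -> N <= r.*2 + 3 ->
  [/\ e u x /\ [/\ size R1 = r.*2, size R2 = r.*2, run e u R1 y & run e u R2 z],
      uniq (u :: R1 ++ R2),
      [/\ x \notin u :: R1 ++ R2, y \notin u :: R1 ++ R2 & z \notin u :: R1 ++ R2] &
      forall v, e u v -> [\/ v = x, v = head x R1 | v = head x R2]] ->
  setcol (~: [set c in u :: R1 ++ R2]) S -> exists S', setcol setT S'.
Proof.
move=> hr hN [[ux [s1 s2 r1 r2]] uq [xU yU zU] nu] hS; set W := ~: _ in hS.
have WE v : (v \in W) = (v \notin u :: R1 ++ R2) by rewrite !inE.
have [xW yW zW] : [/\ x \in W, y \in W & z \in W] by rewrite !WE.
have [h1 _] := hS.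
have [|U [cU xUd hU]] := @choose_set (S x) (S y) (S z) (w u).
  by rewrite h1 // addnC hw // sym.
have hd R : size R = r.*2 -> head x R \in R.
  by case: R => [|? ?] /=; [case: (r) hr|rewrite mem_head].
have r0 : 1 < r.+1 by case: (r) hr.
have uW : u \notin W by rewrite WE mem_head.
have neu v : v \in W -> (v == u) = false by move=> vW; apply/eqP => E; rewrite -E vW in uW.
have hS1 : setcol (u |: W) (upd S u U).
  apply: setcol1 => // v vW /nu [->|E|E] //.
    by move: vW; rewrite WE in_cons mem_cat E hd ?orbT.
  by move: vW; rewrite WE in_cons mem_cat E (hd R2) ?orbT.
move: uq; rewrite cons_uniq mem_cat negb_or cat_uniq => /and3P [/andP [u1 u2] uR1 /andP [/hasPn dR uR2]].
have hne : [/\ ~~ ((U == S y) && (#|U| == r.+1)) & ~~ ((U == S z) && (#|U| == r.+1))].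
  split; apply/negP => /andP [/eqP E /eqP E2]; have [] := hU; rewrite -?cU ?E2 //;
   by rewrite E eqxx.
have [||||S2 [hS2 eS2]] := extend_run hr hN hS1 r1 uR1 _ _ _ s1.
- by rewrite setU11.
- by rewrite setU1r.
- move=> c cR; rewrite in_setU1 WE in_cons mem_cat cR orbT orbF.
  by apply: contraNneq u1 => <-.
- by rewrite /upd eqxx neu //; case: hne.
have [||||S3 [hS3 _]] := extend_run hr hN hS2 r2 uR2 _ _ _ s2.
- by rewrite in_setU setU11.
- by rewrite in_setU setU1r.
- move=> c cR; rewrite in_setU in_setU1 WE in_cons mem_cat cR !orbT orbF inE (negbTE (dR _ cR)) orbF.
  by apply: contraNneq u2 => <-.
- by rewrite !eS2 ?setU11 ?setU1r // /upd eqxx neu //; case: hne.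
exists S3; suff <- : (u |: W) :|: [set c in R1] :|: [set c in R2] = setT by [].
apply/setP => v; rewrite !in_setU in_set1 WE !inE mem_cat !negb_or.
by case: (v == u); case: (v \in R1); case: (v \in R2).
Qed.

Theorem extend_reducible r : (r == 1) || (r == 2) -> N <= r.*2 + 3 ->
  long_run e r.*2.+1 \/ fork e r.*2 ->
  exists X : {set V}, X != set0 /\ forall S, setcol (~: X) S -> exists S', setcol setT S'.
Proof.
move=> hr hN [[a [p [d [sp rp up ap dp]]]]|[u [x [y [z [R1 [R2 H]]]]]]].
  exists [set c in p]; split; last by move=> S; apply: extend_long sp rp up ap dp.
  by case: p sp {rp up ap dp} => // c p _; apply/set0Pn; exists c; rewrite inE mem_head.
exists [set c in u :: R1 ++ R2]; split; last by move=> S; apply: extend_fork H.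
by apply/set0Pn; exists u; rewrite inE mem_head.
Qed.

End Fits.

(** * True twins in triangles *)

Section Twins.
Variables (V : finType) (e : rel V).
Hypotheses (sym : symmetric e) (irr : irreflexive e).
Hypothesis capf : forall v x a s, hole e x (a :: s) -> e v x -> e v a -> ~~ nad e v s.
Hypothesis c4f : forall x p, hole e x p -> size p != 3.

Local Notation ipath := (ipath e).
Local Notation seg := (seg e).
Local Notation nad := (nad e).
Local Notation far := (far e).
Local Notation nn := (nn e).
Local Notation hole := (hole e).
Local Notation icyc := (icyc e).
Local Notation conn := (conn e).
Local Notation comp := (comp e).
Local Notation away := (away e).

(** * Vertices seeing exactly three consecutive vertices of a hole *)

Section Attached.
Implicit Types (m P Q A R p q r s : seq V) (a b c d h k l t u v w x y z : V) (B D K : {set V}).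

Lemma cap_last v x s b : hole x (rcons s b) -> e v x -> e v b -> ~~ nad v s.
Proof.
move=> H vx vb; rewrite -nad_rev; apply: capf vx vb.
by rewrite -rev_rcons; apply: hole_rev.
Qed.

Lemma ipath_link z q a : ipath (z :: q) -> e (last z q) a -> nad a (belast z q) ->
  ipath (rcons (z :: q) a).
Proof.
move=> pq la na; rewrite -(ipath_rev sym) rev_rcons; move: pq; rewrite -(ipath_rev sym) lastI rev_rcons.
by rewrite ipath_cons2 sym la nad_rev na.
Qed.

(** Otherwise [h], the link and the arc of the hole from the first neighbour of its end back to [a]
    form a hole. On it [u] sees only [h] and one neighbour of [h], which is a cap. *)
Lemma closing_side h a m b z q u : hole h (a :: rcons m b) -> ipath (z :: q) -> e h z -> nad h q ->
  far (belast z q) (a :: m) -> last z q \notin a :: m -> has (e (last z q)) (a :: m) ->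
  e u h -> (e u z /\ nad u (q ++ a :: m)) \/ (e u a /\ nad u (z :: q ++ m)) ->
  q = [::] /\ e z a.
Proof.
move=> H pq hz nq fp lp hl uh comp.
have [P1 [x [P2 [EP hP1 lx]]]] := split_first hl.
have [A' EA] : exists A', rcons P1 x = a :: A'.
  case: P1 EP {hP1} => [|a' P1] /= [<- _]; first by exists [::].
  by exists (rcons P1 x).
have sA : {subset A' <= m}.
  have : a :: m = a :: A' ++ P2 by rewrite EP -cat_rcons EA.
  by case=> -> w wA; rewrite mem_cat wA.
have hS : hole h ((z :: q) ++ rev (a :: A')) -> False.
  rewrite rev_cons -rcons_cat => Hc; case: comp => [[uz nu]|[ua nu]].
    have := capf (s := rcons (q ++ rev A') a) Hc uh uz; rewrite -cats1 !(nad_cat, nad_rev) /= andbT.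
    move: nu; rewrite nad_cat nad_cons => /and3P [-> -> nm] /=.
    rewrite andbT; case/negP; apply/allP => w /sA; exact: (allP nm).
  have := cap_last Hc uh ua; rewrite !nad_cat nad_rev.
  move: nu; rewrite -cat_cons nad_cat => /andP [-> nm] /=.
  case/negP; apply/allP => w /sA; exact: (allP nm).
have hzq : h \notin z :: q.
  by rewrite in_cons negb_or (nad_notin nq) andbT; apply: contraTneq hz => ->; rewrite irr.
case: P1 EP EA hP1 => [|a' P1] EP EA hP1.
  case: EP EA => Ex _ [_ EA]; subst x A'.
  have [q0|[q' [l Eq]]] : q = [::] \/ exists q' l, q = rcons q' l.
    by case: (lastP q) => [|q' l]; [left|right; exists q', l].
    by split=> //; move: lx; rewrite q0.
  exfalso; apply: hS; rewrite /= cats1 hole_seg //; apply/and5P; split=> //.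
  - by rewrite Eq; case: (q').
  - rewrite /seg -rcons_cons; apply: ipath_link => //; apply/allP => w wb.
    by have := allP fp _ wb; rewrite nad_cons (nnC sym) => /andP [].
  - by case/and5P: H.
exfalso; apply: hS; case: EP => Ea EP; subst a'.
have ic : icyc (h :: (a :: P1) ++ x :: rcons P2 b).
  by move: (H : icyc (h :: a :: rcons m b)); rewrite EP rcons_cat rcons_cons.
have P20 : rcons P2 b != [::] by case: (P2).
move: ic; rewrite icyc_split // => /and3P [sP sP2 fP].
have -> : rev (a :: A') = x :: rev (a :: P1) by rewrite -EA rev_rcons.
have rP0 : rev (a :: P1) != [::] by rewrite rev_cons; case: (rev P1).
change (icyc (h :: (z :: q) ++ x :: rev (a :: P1))); rewrite icyc_split // seg_rev //.
have xm : x \in a :: m by rewrite EP in_cons mem_cat mem_head !orbT.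
have nhx : nn h x.
  have xm' : x \in m by rewrite EP mem_cat mem_head orbT.
  by have := H; rewrite hole_seg // => /and5P [_ _ _ _ /allP]; apply.
have fpx w : w \in a :: m -> nad w (belast z q).
  move=> wm; apply/allP => y yb; rewrite (nnC sym); exact: (allP (allP fp _ yb)).
have sub w : w \in a :: P1 -> w \in a :: m.
  by rewrite !in_cons EP mem_cat => /orP [->//|->]; rewrite orbT.
apply/and3P; split=> //.
- apply: seg_of_link => //.
  + by case/nadP: nq.
  + by rewrite sym.
  + by case/nadP: (fpx _ xm).
  + rewrite lastI mem_rcons in_cons negb_or (nad_notin (fpx _ xm)) andbT.
    by apply: contraNneq lp => <-.
- rewrite (farC sym) far_revl; apply/allP => w wP; rewrite lastI nad_rcons (fpx _ (sub _ wP)) andbT.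
  rewrite /nn; apply/andP; split; first by apply: contraNneq lp => <-; apply: sub.
  by rewrite sym; apply: (hasPn hP1).
Qed.

(** [closing_side] from both ends of the hole reduces the link to the vertex [z]. On the given hole
    [z] sees only [h] and one of [a], [b], so it is a cap. *)
Lemma no_closing h a m b z q u : hole h (a :: rcons m b) -> ipath (z :: q) -> e h z -> nad h q ->
  far (belast z q) (a :: rcons m b) -> last z q \notin a :: rcons m b ->
  has (e (last z q)) (a :: rcons m b) -> ~~ (e (last z q) a && e (last z q) b) -> e u h ->
  (e u z /\ nad u (q ++ a :: rcons m b)) \/ [/\ e u a, e u b & nad u (z :: q ++ m)] ->
  False.
Proof.
move=> H pq hz nq fp lp hl nab uh comp.
have sub w : w \in a :: m -> w \in a :: rcons m b.
  by rewrite !in_cons mem_rcons in_cons => /orP [->|->]; rewrite ?orbT.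
have sub' w : w \in b :: rev m -> w \in a :: rcons m b.
  by rewrite !in_cons mem_rcons in_cons mem_rev => /orP [->|->]; rewrite ?orbT.
have fsub s : {subset s <= a :: rcons m b} -> far (belast z q) s.
  by move=> hs; apply/allP => w wb; apply/allP => y /hs; apply: (allP (allP fp _ wb)).
have H' : hole h (b :: rcons (rev m) a).
  by have := hole_rev sym irr H; rewrite rev_cons rev_rcons.
have nsub s : {subset s <= a :: rcons m b} -> nad u (q ++ a :: rcons m b) -> nad u (q ++ s).
  rewrite !nad_cat => hs /andP [-> nu] /=; apply/allP => y /hs; exact: (allP nu).
have side1 : has (e (last z q)) (a :: m) -> q = [::] /\ e z a.
  move=> hs; apply: (closing_side H pq hz nq _ _ hs uh).
  - exact: fsub.
  - by apply: contra lp; apply: sub.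
  - by case: comp => [[uz nu]|[ua ub nu]]; [left; split=> //; apply: nsub|right].
have side2 : has (e (last z q)) (b :: rev m) -> q = [::] /\ e z b.
  move=> hs; apply: (closing_side H' pq hz nq _ _ hs uh).
  - exact: fsub.
  - by apply: contra lp; apply: sub'.
  - case: comp => [[uz nu]|[ua ub nu]]; [left; split=> //; exact: nsub|right; split=> //].
    by move: nu; rewrite -!cat_cons !nad_cat nad_rev.
have zp : q = [::] -> z \notin a :: rcons m b by move=> E; move: lp; rewrite E.
case: (boolP (has (e (last z q)) (a :: m))) => [h1|h1].
  have [q0 za] := side1 h1; have nz := zp q0; subst q; rewrite /= in lp hl nab side2.
  have hz' : e z h by rewrite sym.
  have := capf H hz' za; case/negP; apply/nadP; split.
    by apply: contra nz => zm; rewrite in_cons zm orbT.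
  have nzb : ~~ e z b by move: nab; rewrite za.
  rewrite has_rcons negb_or nzb /=; apply/negP => hm; case/negP: nzb.
  by case: side2; rewrite ?has_rev ?hm ?orbT.
have [q0 zb] : q = [::] /\ e z b.
  by apply: side2; move: h1 hl; rewrite /= has_rcons has_rev => /norP [/negbTE -> /negbTE ->]; rewrite orbF.
have nz := zp q0; subst q; rewrite /= in h1.
have hz' : e z h by rewrite sym.
have := capf H' hz' zb; case/negP; apply/nadP; split.
  apply: contra nz; rewrite mem_rcons in_cons mem_rev => /orP [/eqP ->|zm]; first exact: mem_head.
  by apply: sub; rewrite in_cons zm orbT.
by rewrite has_rcons has_rev.
Qed.

(* If [h] skipped a vertex between two of its neighbours on the path, the hole
   closed by the first such gap would have a cap. *)
Lemma first_gap h v z q1 y q2 : ipath (z :: q1 ++ y :: q2) -> e h z -> ~~ e v z -> e h v ->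
  e h y -> {in q1 ++ y :: q2, forall w, e v w = e h w} -> h \notin z :: q1 ++ y :: q2 ->
  v \notin z :: q1 ++ y :: q2 -> e h (last z q1).
Proof.
move=> pq hz nvz hv hy hq hP vP; apply: contraT => nh.
have /split_first [r1 [x [r2 [E h1 hx]]]] : has (predC (e h)) (z :: q1).
  by apply/hasP; exists (last z q1); rewrite ?mem_last.
have /split_first [r3 [y' [r4 [E' h3 hy']]]] : has (e h) (r2 ++ y :: q2).
  by apply/hasP; exists y; rewrite ?mem_cat ?mem_head ?orbT.
have EP : z :: q1 ++ y :: q2 = r1 ++ x :: r3 ++ y' :: r4.
  by rewrite -cat_cons E -catA cat_cons E'.
have [r10|[r1' [l Er]]] : r1 = [::] \/ exists r1' l, r1 = rcons r1' l.
  by case: (lastP r1) => [|r1' l]; [left|right; exists r1', l].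
  by move: E hx; rewrite r10 => -[<- _] /=; rewrite hz.
subst r1; rewrite cat_rcons in EP; rewrite EP in pq hP vP.
have pl : ipath (l :: (x :: r3) ++ y' :: r4) := ipath_catr sym pq.
have sg : seg l (x :: r3) y' by move: pl; rewrite ipath_seg => /and4P [].
have hl : e h l.
  by have := hasPn h1 l; rewrite mem_rcons mem_head => /(_ isT) /=; rewrite negbK.
have H : hole h (l :: rcons (x :: r3) y').
  rewrite hole_seg // sg hl hy' nad_cons /nn (hx : ~~ e h x) /= andbT.
  have hn w : w \in x :: r3 -> h != w.
    move=> wx; apply: contraNneq hP => ->; rewrite mem_cat in_cons.
    by rewrite -cat_cons mem_cat wx !orbT.
  rewrite hn ?mem_head //=; apply/nadP; split=> //.
  by apply/negP => hr; have := hn h; rewrite in_cons hr orbT eqxx => /(_ isT).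
have [r10|[r [k Er]]] : r1' = [::] \/ exists r k, r1' = rcons r k.
  by case: (lastP r1') => [|r k]; [left|right; exists r, k].
  subst r1'; case: EP => Ez EP; subst l.
  have vy : e v y' by rewrite hq // EP -cat_cons mem_cat mem_head orbT.
  have vh : e v h by rewrite sym.
  have := cap_last (x := h) (s := z :: x :: r3) (b := y') H vh vy.
  case/negP; apply/nadP; split.
    by apply: contra vP; rewrite [[::] ++ _]/= -cat_cons -cat_cons mem_cat => ->.
  rewrite /= (negbTE nvz) /=; apply/negP => hs.
  have hs' : has (e v) (x :: r3) := hs.
  case/hasP: hs' => w wx; rewrite hq; last by rewrite EP -cat_cons mem_cat wx.
  move=> hw; move: wx; rewrite in_cons => /orP [/eqP E1|wr]; first by rewrite E1 in hw; rewrite /= hw in hx.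
  by have := hasPn h3 _ wr; rewrite hw.
subst r1'; have hk : e h k.
  have := hasPn h1 k; rewrite mem_rcons in_cons mem_rcons mem_head orbT => /(_ isT) /=.
  by rewrite negbK.
rewrite cat_rcons in pq; have := ipath_catr sym pq; rewrite ipath_cons2 => /and3P [kl nk _].
have kh : e k h by rewrite sym.
have := capf H kh kl; case/negP; apply/allP => w; rewrite rcons_cons in_cons mem_rcons in_cons => hw.
apply: (allP nk); rewrite in_cons mem_cat in_cons.
by case/or3P: hw => ->; rewrite ?orbT.
Qed.

(** From the last neighbour [y] of [h] on the link onwards, [no_closing] applies with [u] the vertex
    before [y], adjacent to [h] by [first_gap]. If [z] is the only neighbour of [h] there, [v]
    serves as [u]. *)
Lemma twins_aux h v a m b z q : hole h (a :: rcons m b) -> hole v (a :: rcons m b) -> e h v ->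
  ipath (z :: q) -> e h z -> ~~ e v z -> {in q, forall w, e v w = e h w} ->
  h \notin z :: q -> v \notin z :: q -> far (belast z q) (a :: rcons m b) ->
  last z q \notin a :: rcons m b -> has (e (last z q)) (a :: rcons m b) ->
  ~~ (e (last z q) a && e (last z q) b) -> False.
Proof.
move=> H Hv hv pq hz nvz hq hP vP fp lp hl nab.
have vh : e v h by rewrite sym.
have hq' : h \notin q by apply: contra hP => h1; rewrite in_cons h1 orbT.
case: (boolP (has (e h) q)) => [|nq].
  case/split_last => q1 [y [q2 [Eq hq2 hy]]]; subst q.
  have hu := first_gap pq hz nvz hv hy hq hP vP.
  have uz : last z q1 \in belast z (q1 ++ y :: q2) by rewrite belast_cat mem_cat mem_head orbT.
  have Eb : belast z (q1 ++ y :: q2) = belast z q1 ++ last z q1 :: belast y q2 by rewrite belast_cat.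
  rewrite last_cat_cons in lp hl nab; rewrite Eb far_catl far_consl in fp.
  case/and3P: fp => _ fu fy; rewrite -cat_cons lastI cat_rcons in pq.
  have := ipath_catr sym pq; rewrite ipath_cons2 => /and3P [uy nu py].
  have nhq2 : nad h q2.
    apply/nadP; split=> //; apply: contra hq' => h1; by rewrite mem_cat in_cons h1 !orbT.
  apply: (no_closing (u := last z q1) H py hy nhq2 fy lp hl nab); first by rewrite sym.
  by left; rewrite nad_cat nu fu.
have nhq : nad h q by apply/nadP.
apply: (no_closing (u := v) H pq hz nhq fp lp hl nab vh); right.
move: Hv; rewrite hole_seg // => /and5P [_ _ va vb nvm]; split=> //.
rewrite nad_cons nad_cat nvm andbT /nn nvz andbT; apply/andP; split.
  by apply: contraNneq vP => ->; rewrite mem_head.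
apply/nadP; split; first by apply: contra vP => h1; rewrite in_cons h1 orbT.
by apply/hasPn => w wq; rewrite hq //; apply: (hasPn nq).
Qed.

Lemma hole_ends h a m b : hole h (a :: rcons m b) -> nn a b.
Proof.
rewrite hole_seg // => /and5P [m0 sg _ _ _]; case: m m0 sg => // c m _.
by rewrite seg_cons nad_rcons => /and3P [_ /andP [] ].
Qed.

Lemma no_c4 k1 k2 a b : nn a b -> e k1 a -> e k1 b -> e k2 a -> e k2 b -> k1 != k2 -> e k1 k2.
Proof.
move=> nab a1 b1 a2 b2 k12; apply: contraT => nk.
have H : hole k1 (a :: rcons [:: k2] b).
  rewrite hole_seg //; apply/and5P; split=> //; last by rewrite nad_cons /nn k12 nk.
  by rewrite seg_cons seg0 b2 sym a2 /= nab.
by have := c4f H.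
Qed.

(** The true twins are the distinct vertices with equal closed neighbourhoods. *)
Definition cn x := [set w | (w == x) || e x w].

Lemma cnP x y : reflect (cn x = cn y) [forall w, ((w == x) || e x w) == ((w == y) || e y w)].
Proof.
apply: (iffP forallP) => [H|E w]; first by apply/setP => w; rewrite !inE; apply/eqP.
by have /setP/(_ w) := E; rewrite !inE => ->.
Qed.

Lemma cn_adj x y : cn x = cn y -> x != y -> e x y.
Proof. by move=> /setP/(_ x); rewrite !inE eqxx /= => /esym; case: eqP => //=; rewrite sym. Qed.

Lemma cn_edge x y w : cn x = cn y -> w != x -> w != y -> e x w = e y w.
Proof. by move=> /setP/(_ w) + wx wy; rewrite !inE (negbTE wx) (negbTE wy). Qed.

Lemma cn_neq x y w : e y w -> nn x w -> cn x != cn y.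
Proof.
move=> yw /andP [xw nxw]; apply/eqP => /setP /(_ w).
by rewrite !inE yw eq_sym (negbTE xw) (negbTE nxw) orbT.
Qed.

Hypothesis Hncc : ncc e.

(** The common neighbours of [a] and [b] form a clique, as there is no hole of length four. A vertex
    that tells [v] and [h] apart lies outside this clique, which is no cutset, so a link leads from
    such a vertex to the hole; [twins_aux] excludes it. *)
Lemma attached_twins h a m b v : hole h (a :: rcons m b) -> e v h -> e v a -> e v b -> nad v m ->
  cn v = cn h.
Proof.
move=> H vh va vb nvm; set p := a :: rcons m b in H.
have hv : e h v by rewrite sym.
move: (H); rewrite hole_seg // => /and5P [m0 sg ha hb nhm].
have Hv : hole v p by rewrite hole_seg //; apply/and5P; split.
have nab := hole_ends H.
apply/eqP; apply: contraT => /eqP neq.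
have [w0 w0X [w0h w0v]] : exists2 w0, e h w0 != e v w0 & w0 != h /\ w0 != v.
  case: (boolP [forall w, ((w == v) || e v w) == ((w == h) || e h w)]) => [/cnP //|].
  case/forallPn => w; case: (eqVneq w v) => [->|wv]; first by rewrite hv orbT.
  case: (eqVneq w h) => [->|wh]; first by rewrite vh orbT.
  by rewrite /= eq_sym => hw; exists w.
pose K := [set w | e w a && e w b].
have KP w : (w \in K) = e w a && e w b by rewrite inE.
have hK : h \in K by rewrite KP ha.
have vK : v \in K by rewrite KP va.
have Kadj k1 k2 : k1 \in K -> k2 \in K -> k1 != k2 -> e k1 k2.
  by rewrite !KP => /andP [? ?] /andP [? ?]; apply: (no_c4 nab).
have cK : cliqueb e K.
  by apply/'forall_implyP => k1 k1K; apply/'forall_implyP => k2 k2K; apply/implyP; apply: Kadj.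
have w0K : w0 \notin K.
  apply/negP => wK; move: w0X; rewrite !(Kadj _ w0) //; by rewrite eq_sym.
have aK : a \notin K by rewrite KP irr.
have X a' : a' \in p -> e h a' = e v a'.
  rewrite in_cons mem_rcons in_cons => /or3P [/eqP ->|/eqP ->|am]; rewrite ?ha ?va ?hb ?vb //.
  have /andP [_ /negbTE ->] := allP nhm _ am.
  by have /andP [_ /negbTE ->] := allP nvm _ am.
have ac : has (e a) p.
  rewrite /p; case: (m) m0 sg => // c m' _; rewrite seg_cons => /andP [ac _].
  by rewrite /= ac orbT.
have w0K' : w0 \in ~: K by rewrite in_setC.
have [z [q [pq sq [zX qX] [lY bY]]]] := conn_link sym irr (X := fun w => e h w != e v w)
   (Y := fun w => has (e w) p) w0K' (Hncc cK w0K aK) w0X ac.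
have zp : z \notin p by apply: contraNN zX => /X ->.
have pP : {in z :: q, forall c, c \notin p}.
  move=> c cq; apply/negP => cp.
  have /split_first [r1 [c' [r2 [E h1 c'p]]]] : has (mem p) (z :: q) by apply/hasP; exists c.
  have [r10|[r1' [k Er]]] : r1 = [::] \/ exists r1' k, r1 = rcons r1' k.
    by case: (lastP r1) => [|r1' k]; [left|right; exists r1', k].
    by move: E; rewrite r10 => -[Ez _]; move: zp; rewrite Ez (c'p : c' \in p).
  subst r1; rewrite cat_rcons in E; rewrite E in pq.
  have := ipath_catr sym pq; rewrite ipath_cons2 => /andP [kc _].
  have kb : k \in belast z q.
    have : z :: q = (r1' ++ k :: belast c' r2) ++ [:: last c' r2] by rewrite -catA cat_cons cats1 -lastI.
    by rewrite lastI cats1 => /rcons_inj [-> _]; rewrite mem_cat mem_head orbT.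
  by case/hasP: bY; exists k => //; apply/hasP; exists c'.
have nK w : w \in z :: q -> w \notin K by move=> /sq; rewrite in_setC.
have hn k : k \in K -> k \notin z :: q by move=> kK; apply/negP => /nK; rewrite kK.
have fp : far (belast z q) p.
  apply/allP => c cb; apply/nadP; split; last by apply: (hasPn bY).
  by apply: pP; rewrite lastI mem_rcons in_cons cb orbT.
have lq := mem_last z q.
have nl : ~~ (e (last z q) a && e (last z q) b) by rewrite -KP nK.
have hq w : w \in q -> e v w = e h w by move=> wq; have := hasPn qX _ wq; rewrite negbK => /eqP.
case: (boolP (e h z)) zX => hz zX; [have nvz : ~~ e v z by case: (e v z) zX|have vz : e v z by case: (e v z) zX].
  by case: (twins_aux H Hv hv pq hz nvz hq (hn _ hK) (hn _ vK) fp (pP _ lq) lY nl).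
case: (twins_aux Hv H vh pq vz hz _ (hn _ vK) (hn _ hK) fp (pP _ lq) lY nl) => w /hq.
by [].
Qed.

End Attached.

Hypothesis Hncc : ncc e.
Hypothesis nonuniv : forall v, exists w, nn v w.
Implicit Types (m P Q A R p q r : seq V) (a b c d h k l s t u v w x y z : V) (B D K : {set V}).

(** If the neighbours of [b] are three consecutive vertices centred at [a] or [s], [attached_twins]
    applies. In every other incomplete case [b] is a cap of the given hole, or it cuts off a hole of
    which a vertex of the given one is a cap. *)
Lemma hole_twin a s P t b : hole a (s :: rcons P t) -> b \notin a :: s :: rcons P t ->
  e b a -> e b s -> [\/ cn b = cn a, cn b = cn s | all (e b) (a :: s :: rcons P t)].
Proof.
move=> H bC ba bs; set L := s :: rcons P t in H bC *.
case: (boolP (all (e b) L)) => hL; first by constructor 3; rewrite /= ba.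
have ab : e a b by rewrite sym.
have [r1 [x [r2 [EL h1 hx]]]] : exists r1 x r2, [/\ L = r1 ++ x :: r2, ~~ has (predC (e b)) r1 & ~~ e b x].
  by apply: split_first; rewrite has_predC.
have [r10|[r1' [l Er]]] : r1 = [::] \/ exists r1' l, r1 = rcons r1' l.
  by case: (lastP r1) => [|r1' l]; [left|right; exists r1', l].
  by move: EL hx; rewrite r10 => -[<- _]; rewrite bs.
subst r1; rewrite cat_rcons in EL.
have bl : e b l by have := hasPn h1 l; rewrite mem_rcons mem_head => /(_ isT) /=; rewrite negbK.
have bL w : w \in L -> b != w by move=> wL; apply: contraNneq bC => ->; rewrite in_cons wL orbT.
have pL : ipath L by case/and5P: H.
have nbx R : {subset R <= L} -> ~~ has (e b) R -> nad b R.
  move=> sR hR; apply/nadP; split=> //; apply/negP => bR; by have := bL _ (sR _ bR); rewrite eqxx.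
have hk r k : r1' = rcons r k -> e k b.
  move=> E; have := hasPn h1 k; rewrite E mem_rcons in_cons mem_rcons mem_head orbT => /(_ isT) /=.
  by rewrite negbK sym.
have r1'E : r1' = [::] \/ exists r k, r1' = rcons r k.
  by case: (lastP r1') => [|r k]; [left|right; exists r, k].
case: (boolP (has (e b) r2)) => [|nr2].
  case/split_first => r3 [y [r4 [Er2 h3 yb]]]; subst r2.
  have sg : seg l (x :: r3) y.
    by move: pL; rewrite EL => /(ipath_catr sym); rewrite -cat_cons ipath_seg => /and4P [].
  have Hb : hole b (l :: rcons (x :: r3) y).
    rewrite hole_seg // sg bl yb; apply/andP; split=> //; apply: nbx; last first.
      by rewrite /= negb_or hx.
    by move=> w wR; rewrite EL mem_cat in_cons -cat_cons mem_cat wR !orbT.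
  case: r1'E => [E|[r [k E]]]; subst r1'; last first.
    move: pL; rewrite EL cat_rcons => /(ipath_catr sym); rewrite ipath_cons2 => /and3P [kl nk _].
    have := capf Hb (hk _ _ erefl) kl; case/negP; apply/allP => w.
    rewrite rcons_cons in_cons mem_rcons in_cons => hw.
    by apply: (allP nk); rewrite in_cons mem_cat in_cons; case/or3P: hw => ->; rewrite ?orbT.
  case: EL => El EL; subst l; case: (lastP r4) EL => [|r4' t'] EL.
    move: EL; rewrite -cat_cons cats1 => /rcons_inj [EP Et]; subst P t.
    constructor 1; apply: (attached_twins Hncc H ba bs yb).
    apply: nbx; last by rewrite /= negb_or hx.
    by move=> w wR; rewrite /L in_cons mem_rcons in_cons wR !orbT.
  move: EL; rewrite -rcons_cons -rcons_cat -rcons_cons => /rcons_inj [EP Et].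
  have as' : e a s by case/and5P: H.
  have := capf Hb ab as'; case/negP.
  have := H; rewrite hole_seg // => /and5P [_ _ _ _]; rewrite EP -cat_cons nad_cat nad_cons.
  by case/and3P => naP nay _; rewrite nad_rcons nay.
have nbR : nad b (x :: r2).
  apply: nbx; last by rewrite /= negb_or hx.
  by move=> w wR; rewrite EL mem_cat in_cons wR !orbT.
case: r1'E => [E|[r [k E]]]; subst r1'.
  case: EL => El EL; subst l; rewrite /L EL in H.
  by have := capf H ba bs; rewrite nbR.
have kb := hk _ _ erefl; rewrite cat_rcons in EL.
case: r EL {h1 hk} => [|s' r] EL; case: EL => Es EL.
  subst k; constructor 2; rewrite /L EL in H; have := hole_rot sym irr H.
  rewrite rcons_cons => Hs; exact: (attached_twins Hncc Hs bs bl ba nbR).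
subst s'; have ic : icyc (a :: (s :: rcons r k) ++ l :: x :: r2).
  by move: (H : icyc (a :: L)); rewrite /L EL -cat_rcons.
rewrite icyc_split // in ic; case/and3P: ic => sg1 sg2 fr.
have Hb : hole b (l :: rcons (x :: r2) a) by rewrite hole_seg // sg2 bl ba nbR.
have kl : e k l.
  by move: sg1; rewrite /seg /= -cats1 cat_rcons => /(ipath_catr sym (s := a :: s :: r)); rewrite ipath_cons2 => /andP [].
have := capf Hb kb kl; case/negP; rewrite nad_rcons; apply/andP; split.
  rewrite (nnC sym); move: sg1; rewrite seg_cons nad_rcons nad_rcons => /and3P [_ /and3P [_ -> _] _].
  by [].
by move: fr; rewrite far_consl far_rconsl => /and3P [_ -> _].
Qed.

(** Along a path of [B] starting at [s], each next vertex is adjacent to a twin of [s], hence to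
    [s], and [hole_twin] makes it a twin of [s] too. *)
Lemma comp_twins a s P t B b c : hole a (s :: rcons P t) -> s \in B ->
  {in B &, forall x y, conn B x y} ->
  {in B, forall x, [/\ e a x, cn x != cn a & ~~ all (e x) (a :: s :: rcons P t)]} ->
  b \in B -> c \in B -> cn b = cn c.
Proof.
move=> H sB cB hB.
suff E x : x \in B -> cn x = cn s by move=> bB cB'; rewrite !E.
move=> xB; have /connectP [p + ->] := cB _ _ sB xB.
have: cn s = cn s by []; move: {1 3 4}s => y Ey; elim: p y Ey => //= y' p IH y Ey.
case/andP => /and3P [yB y'B yy'] pp; apply: IH pp; have [ay' ny' nc] := hB _ y'B.
case: (eqVneq y' s) => [-> //|y's].
have y'a : e y' a by rewrite sym.
have y's' : e y' s.
  case: (eqVneq y s) => [<-|ys]; first by rewrite sym.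
  have yy'' : y' != y by rewrite eq_sym (e_neq irr).
  by rewrite sym -(cn_edge Ey yy'' y's).
have y'C : y' \notin a :: s :: rcons P t.
  rewrite !in_cons mem_rcons in_cons !negb_or y's (e_neq irr y'a) /=.
  have nst := hole_ends H; apply/andP; split.
    by apply: contraTneq y's' => ->; rewrite sym; case/andP: nst.
  have := H; rewrite hole_seg // => /and5P [_ _ _ _ nP].
  by apply: contraTN ay' => /(allP nP) /andP [].
case: (hole_twin H y'C y'a y's') => // [E|h]; last by rewrite h in nc.
by rewrite E eqxx in ny'.
Qed.

(** The twins of [a] and the vertices complete to the hole form a clique [K]. The component [B] of
    [b] among the other neighbours of [a] contains [s], or else a link avoiding [K] leads from [B]
    to another such neighbour and closes a hole that starts in [B]. Either way [comp_twins]
    applies. *)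
Lemma nbr_twins a s P t b c : hole a (s :: rcons P t) -> e a b -> e a c -> e b c ->
  cn b != cn a -> cn c != cn a -> ~~ all (e b) (a :: s :: rcons P t) ->
  ~~ all (e c) (a :: s :: rcons P t) -> cn b = cn c.
Proof.
move=> H ab ac bc nb nc hb hc; set C := a :: s :: rcons P t in hb hc.
have nst := hole_ends H.
pose K := [set w | (cn w == cn a) || all (e w) C].
have KP w : (w \in K) = (cn w == cn a) || all (e w) C by rewrite inE.
have aK : a \in K by rewrite KP eqxx.
have allC w : all (e w) C -> [/\ e w a, e w s & e w t].
  move/allP => h; split; apply: h; rewrite !in_cons ?mem_rcons ?in_cons ?eqxx ?orbT //.
have cK : cliqueb e K.
  apply/'forall_implyP => k1 k1K; apply/'forall_implyP => k2 k2K; apply/implyP => k12.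
  have tw k k' : cn k = cn a -> all (e k') C -> k != k' -> e k k'.
    move=> Ek /allC [ka _ _] kk'; have := Ek => /setP /(_ k'); rewrite !inE.
    by rewrite [e a k']sym ka orbT eq_sym (negbTE kk').
  move: k1K k2K; rewrite !KP => /orP [/eqP E1|A1] /orP [/eqP E2|A2].
  - by apply: (cn_adj) => //; rewrite E1.
  - exact: tw.
  - by rewrite sym; apply: tw; rewrite // eq_sym.
  - have [_ s1 t1] := allC _ A1; have [_ s2 t2] := allC _ A2.
    exact: (no_c4 nst).
have sK : s \notin K.
  rewrite KP negb_or; apply/andP; split; last first.
    by apply/negP => /allC [_ + _]; rewrite irr.
  apply: cn_neq (nst); by have := H; rewrite hole_seg // => /and5P [].
pose N := [set w | e a w && (w \notin K)].
have NP w : (w \in N) = e a w && (w \notin K) by rewrite inE.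
have bN : b \in N by rewrite NP ab KP negb_or nb.
have cN : c \in N by rewrite NP ac KP negb_or nc.
pose B := comp N b; have bB : b \in B := comp_refl _ _ _.
have cB : c \in B by apply: (comp_closed bB bN cN bc).
have BN := comp_sub bN : {subset B <= N}.
have cnB : {in B &, forall x y, conn B x y} by move=> x y; apply: comp_conn.
have as' : e a s by case/and5P: H.
case: (boolP (s \in B)) => sB.
  apply: (comp_twins H sB cnB _ bB cB) => x /BN; rewrite NP KP negb_or.
  by case/and3P.
have bK : b \in ~: K by rewrite in_setC; have := bN; rewrite NP => /andP [].
have cbs : conn (~: K) b s by apply: Hncc; rewrite // -in_setC.
have Ys : e a s && (s \notin B) by rewrite as'.
have [z [q [pq sq [zB qB] [/andP [al lB] bY]]]] := conn_link sym irr (X := mem B)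
  (Y := fun w => e a w && (w \notin B)) bK cbs bB Ys.
have lN : last z q \in N by rewrite NP al -in_setC sq // mem_last.
have nB x : x \in B -> ~~ e x (last z q).
  by move=> xB; apply: contra lB => xl; apply: (comp_closed xB (BN _ xB) lN xl).
have [q0|[q' [l Eq]]] : q = [::] \/ exists q' l, q = rcons q' l.
    by case: (lastP q) => [|q' l]; [left|right; exists q', l].
  by move: lB; rewrite q0 /= (zB : z \in B).
subst q; rewrite last_rcons in al lB lN nB; rewrite belast_rcons in bY.
have az : e a z by have := BN _ zB; rewrite NP => /andP [].
have H' : hole a (z :: rcons q' l).
  rewrite hole_seg //; apply/and5P; split=> //.
    apply: contraTneq pq => ->; rewrite /= ipath_cons2; apply/negP => /andP [zl _].
    by have := nB _ zB; rewrite zl.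
  apply/nadP; split.
    apply/negP => aq; have := sq a; rewrite in_cons mem_rcons in_cons aq !orbT => /(_ isT).
    by rewrite in_setC aK.
  apply/hasPn => w wq; apply/negP => aw; case/hasP: bY; exists w; first by rewrite in_cons wq orbT.
  by rewrite aw; apply: (hasPn qB); rewrite mem_rcons in_cons wq orbT.
apply: (comp_twins H' zB cnB _ bB cB) => x xB; have := BN _ xB; rewrite NP KP negb_or.
case/and3P => ax nx _; split=> //; apply/negP => /allP /(_ l); rewrite (negbTE (nB _ xB)).
by rewrite !in_cons mem_rcons mem_head !orbT => /(_ isT).
Qed.

(** The attachments of a component of non-neighbours of [v] would otherwise form a clique cutset;
    two non-adjacent ones close a hole along the component. *)
Lemma hole_through v : exists s P t, hole v (s :: rcons P t).
Proof.
have [w vw] := nonuniv v; have wD : w \in away v by rewrite awayP.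
have Cv x : x \in comp (away v) w -> nn v x by move/(comp_sub wD); rewrite awayP.
case: (boolP (cliqueb e (comps_attach e v w))) => [cK|].
  exfalso; apply: (ncc_sep Hncc (C := comp (away v) w) (c := w) (w := v) cK).
  - exact: comp_refl.
  - by rewrite inE negb_and; case/andP: vw => _ ->.
  - by apply/negP => /Cv; rewrite /nn eqxx.
  - by rewrite inE irr.
  - move=> x y xC xy; case: (boolP (e v y)) => vy.
      by right; rewrite inE vy; apply/attachedP; exists x; rewrite // sym.
    left; apply: (comp_closed xC (comp_sub wD xC) _ xy); rewrite awayP /nn vy andbT.
    by apply: contraTneq xy => <-; rewrite sym; case/andP: (Cv _ xC).
rewrite /cliqueb => /forall_inPn [s sA] /forall_inPn [t tA]; rewrite negb_imply => /andP [st nst].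
move: sA tA; rewrite !inE => /andP [vs /attachedP [c cC sc]] /andP [vt /attachedP [d dC td]].
have [z [p [pp sP [sz hs] [tl ht]]]] :=
  conn_link sym irr (X := e s) (Y := e t) cC (comp_conn sym wD cC dC) sc td.
have nC x : e v x -> x \notin z :: p by move=> vx; apply/negP => /sP /Cv /andP [_]; rewrite vx.
exists s, (z :: p), t; rewrite hole_seg //; apply/and5P; split=> //.
  by apply: seg_of_link => //; rewrite ?nC // /nn st.
by apply/allP => x /sP /Cv.
Qed.

(** Let [C2] be a hole through [d]. Vertices complete to [C2] are pairwise adjacent, for lack of
    holes of length four. Each edge of the given hole has an end complete to [C2], since [nbr_twins]
    would make its ends twins. But no clique meets all edges of a hole; the edges near [x] suffice
    to see this. *)
Lemma not_complete_to_hole d x a m b : hole x (a :: rcons m b) ->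
  ~~ all (e d) (x :: a :: rcons m b).
Proof.
move=> H; apply/negP => /allP dC; have [s [P [t H2]]] := hole_through d.
set C2 := d :: s :: rcons P t; have nst := hole_ends H2; have nab := hole_ends H.
have nba : nn b a by rewrite (nnC sym).
have QQ u v : all (e u) C2 -> all (e v) C2 -> ~~ nn u v.
  have hm w : w \in [:: s; t] -> w \in C2.
    by rewrite !in_cons in_nil orbF mem_rcons in_cons => /orP [] ->; rewrite !orbT.
  move=> /allP hu /allP hv; apply/negP => /andP [uv]; rewrite (no_c4 nst) //.
  - by apply: hu; apply: hm; rewrite !inE eqxx.
  - by apply: hu; apply: hm; rewrite !inE eqxx orbT.
  - by apply: hv; apply: hm; rewrite !inE eqxx.
  - by apply: hv; apply: hm; rewrite !inE eqxx orbT.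
have ncd u z : z \in x :: a :: rcons m b -> nn u z -> cn u != cn d.
  by move=> /dC dz uz; apply: cn_neq uz.
have edge u v z zu zv : u \in x :: a :: rcons m b -> v \in x :: a :: rcons m b ->
  zu \in x :: a :: rcons m b -> zv \in x :: a :: rcons m b -> e u v -> nn u zu -> nn v zv ->
  e v z -> nn u z -> all (e u) C2 \/ all (e v) C2.
  move=> uC vC zuC zvC uv nu nv vz uz.
  case: (boolP (all (e u) C2)) => hu; first by left.
  case: (boolP (all (e v) C2)) => hv; first by right.
  have E := nbr_twins H2 (dC _ uC) (dC _ vC) uv (ncd _ _ zuC nu) (ncd _ _ zvC nv) hu hv.
  by have := cn_neq vz uz; rewrite E eqxx.
have xC : x \in x :: a :: rcons m b by rewrite mem_head.
have aC : a \in x :: a :: rcons m b by rewrite !in_cons eqxx orbT.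
have bC : b \in x :: a :: rcons m b by rewrite !in_cons mem_rcons mem_head !orbT.
have mC w : w \in m -> w \in x :: a :: rcons m b.
  by move=> wm; rewrite !in_cons mem_rcons in_cons wm !orbT.
have := H; rewrite hole_seg // => /and5P [m0 sg xa xb nxm].
have ax : e a x by rewrite sym.
have bx : e b x by rewrite sym.
have [c cm ac] : exists2 c, c \in m & e a c.
  case: (m) m0 sg => // c m' _; rewrite seg_cons => /andP [ac _]; exists c => //; exact: mem_head.
have [l lm bl] : exists2 l, l \in m & e b l.
  case: (lastP m) m0 sg => // m' l _; rewrite -(seg_rev sym) rev_rcons seg_cons => /andP [bl _].
  by exists l; rewrite // mem_rcons mem_head.
have nxc := allP nxm _ cm : nn x c; have nxl := allP nxm _ lm : nn x l.
have ncx : nn c x by rewrite (nnC sym).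
have nlx : nn l x by rewrite (nnC sym).
have ca : e c a by rewrite sym.
have lb : e l b by rewrite sym.
have cC := mC _ cm; have lC := mC _ lm.
have Exa := edge x a c c b xC aC cC bC xa nxc nab ac nxc.
have Eca := edge c a x x b cC aC xC bC ca ncx nab ax ncx.
have Exb := edge x b l l a xC bC lC aC xb nxl nba bl nxl.
have Elb := edge l b x x a lC bC xC aC lb nlx nba bx nlx.
case: (boolP (all (e x) C2)) => Qx.
  case: Eca => Qc; first by have := QQ _ _ Qx Qc; rewrite nxc.
  case: Elb => Qb; first by have := QQ _ _ Qx Qb; rewrite nxl.
  by have := QQ _ _ Qc Qb; rewrite nab.
case: Exa => [h|Qa]; first by rewrite h in Qx.
case: Exb => [h|Qb]; first by rewrite h in Qx.
by have := QQ _ _ Qa Qb; rewrite nab.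
Qed.

Theorem triangle_twins x y z : e x y -> e y z -> e x z ->
  [\/ cn x = cn y, cn y = cn z | cn x = cn z].
Proof.
move=> xy yz xz; have [s [P [t H]]] := hole_through x.
case: (eqVneq (cn y) (cn x)) => [->|nyx]; first by constructor 1.
case: (eqVneq (cn z) (cn x)) => [->|nzx]; first by constructor 3.
constructor 2; apply: (nbr_twins H) => //; exact: not_complete_to_hole H.
Qed.

End Twins.

(** * Gluing, twin classes and the induction *)

Section Contains.
Variables (V : finType) (e : rel V).
Hypotheses (sym : symmetric e) (irr : irreflexive e).
Implicit Types (p s : seq V) (x y v a b : V).

Lemma ipath_nth x0 s i j : ipath e s -> i < j < size s -> e (nth x0 s i) (nth x0 s j) = (j == i.+1).
Proof.
elim: s i j => [|x s IH] i j ps; first by rewrite andbF.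
case: i => [|i]; case: j => // j.
  case: s ps {IH} => [|y s] //; rewrite ipath_cons2 => /and3P [xy nx _] lt.
  case: j lt => [|j] //= lt; have /andP [_ /negbTE ->] // := allP nx (nth x0 s j) (mem_nth _ lt).
rewrite /= !ltnS eqSS; exact: IH (ipath_behead ps).
Qed.

Lemma hole_nth x a s i j : hole e x (a :: s) -> i < j < (size s).+2 ->
  e (nth x (x :: a :: s) i) (nth x (x :: a :: s) j) =
  (j == i.+1) || (i == 0) && (j == (size s).+1).
Proof.
move=> H; case: i => [|i]; case: j => // j; last first.
  rewrite /= !ltnS eqSS orbF => lt; apply: ipath_nth => //; by case/and5P: H.
rewrite [i in i < _]/= !ltnS eqSS /= => le; case: (lastP s) H le => [|m b] H; first by case/and5P: H.
move: H; rewrite hole_seg // => /and5P [_ _ xa xb nm]; rewrite size_rcons.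
case: j => [|j] //=; rewrite nth_rcons !eqSS leq_eqVlt => /orP [/eqP [->]|].
  by rewrite ltnn !eqxx xb.
rewrite ltnS => lt; have nj : (j == size m) = false by apply/eqP => E; rewrite E ltnn in lt.
by rewrite lt nj; have /andP [_ /negbTE ->] // := allP nm (nth x m j) (mem_nth _ lt).
Qed.

Lemma hole_cycle x a s (i j : 'I_(size s).+2) : hole e x (a :: s) ->
  e (nth x (x :: a :: s) i) (nth x (x :: a :: s) j) = cycle_rel i j.
Proof.
move=> H; rewrite /cycle_rel; set k := (size s).+2.
have s1 : 1 < size s by case/and5P: H.
wlog lt : i j / i < j => [hw|].
  case: (ltngtP i j) => [lt|gt|E]; first exact: hw.
    by rewrite sym hw // orbC [j == i]eq_sym.
  have -> : i = j by apply: val_inj.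
  by rewrite irr eqxx andbF.
have ne : i != j by apply: contraTneq lt => ->; rewrite ltnn.
have ij : i < j < k by rewrite lt ltn_ord.
rewrite (hole_nth H ij) ne andbT.
have -> : i.+1 %% k = i.+1 by rewrite modn_small // (leq_ltn_trans lt) ?ltn_ord.
rewrite [i.+1 == j]eq_sym; congr orb.
have := ltn_ord j; rewrite leq_eqVlt => /orP [/eqP E|jk].
  have -> : j = (size s).+1 :> nat by move: E; rewrite /k => -[].
  by rewrite /k modnn eqxx andbT eq_sym.
rewrite modn_small //.
have -> : (j == (size s).+1 :> nat) = false by apply/eqP => E; rewrite E ltnn in jk.
by rewrite andbF; apply/esym/eqP => E; move: lt; rewrite -E ltnNge leqnSn.
Qed.

Lemma hole_has_hole x p : hole e x p -> has_hole_of_length e (size p).+1.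
Proof.
case: p => [|a s] H; first by case/and5P: H.
split; first by case/and5P: H.
exists (fun i : 'I_(size s).+2 => nth x (x :: a :: s) i); split.
  move=> i j /eqP; rewrite nth_uniq //; first by move/eqP/val_inj.
  by apply: (icyc_uniq irr (c := x :: a :: s)).
by move=> i j; apply: hole_cycle.
Qed.

Lemma hole_cap v x a s : hole e x (a :: s) -> e v x -> e v a -> nad e v s ->
  contains e (@cap_rel (size s).+2).
Proof.
move=> H vx va nv; have nE j : j < (size s).+2 -> e v (nth x (x :: a :: s) j) = (j == 0) || (j == 1).
  case: j => [|[|j]] //= lt; have /andP [_ /negbTE ->] // := allP nv (nth x s j) (mem_nth _ lt).
have vc : v \notin x :: a :: s.
  rewrite !in_cons !negb_or (nad_notin nv) andbT; apply/andP; split.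
    by apply: contraTneq vx => ->; rewrite irr.
  by apply: contraTneq va => ->; rewrite irr.
exists (fun i => if i is Some i then nth x (x :: a :: s) (i : 'I_(size s).+2) else v); split.
  move=> [i|] [j|] //=.
  - move/eqP; rewrite (nth_uniq x (s := x :: a :: s)) //; first by move/eqP/val_inj ->.
    by apply: (icyc_uniq irr (c := x :: a :: s)).
  - by move=> E; rewrite -E mem_nth in vc.
  - by move=> E; rewrite E mem_nth in vc.
move=> [i|] [j|] /=; last by rewrite irr.
- exact: hole_cycle.
- by rewrite sym nE.
- by rewrite nE.
Qed.

End Contains.

(** * The hereditary class of the induction *)

Section Nice.
Variable r : nat.

(** Cap-freeness and odd holes of length at least [2r + 3], in terms of sequences. *)
Definition nice (V : finType) (e : rel V) :=
  [/\ symmetric e, irreflexive e,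
      forall v x a s, hole e x (a :: s) -> e v x -> e v a -> ~~ nad e v s,
      forall x p, hole e x p -> ~~ odd (size p) &
      forall x p, hole e x p -> r.*2.+2 <= size p].

Lemma nice_inj (V U : finType) (e : rel V) (h : rel U) (f : U -> V) : injective f ->
  (forall x y, e (f x) (f y) = h x y) -> nice e -> nice h.
Proof.
move=> fI fE [sym irr capf hodd hl].
have nnE x y : nn e (f x) (f y) = nn h x y by rewrite /nn fE (inj_eq fI).
have nadE x s : nad e (f x) (map f s) = nad h x s.
  by rewrite /nad all_map; apply: eq_all => y /=.
have ipathE s : ipath e (map f s) = ipath h s.
  elim: s => // x [|y s] IH //; rewrite [map _ _]/= !ipath_cons2 fE nadE.
  by rewrite -[f y :: _]/(map f (y :: s)) IH.
have holeE x p : hole h x p -> hole e (f x) (map f p).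
  have irrh : irreflexive h by move=> y; rewrite -fE irr.
  case/(holeP irrh) => a [m [b [-> [m0 sg nm] xa xb]]].
  rewrite [map _ _]/= map_rcons hole_seg // !fE xa xb nadE nm /seg.
  rewrite -map_rcons -[f a :: _]/(map f (a :: _)) ipathE; apply/and3P; split=> //.
  by case: (m) m0.
split.
- by move=> x y; rewrite -!fE sym.
- by move=> x; rewrite -fE irr.
- move=> v x a s /holeE H; rewrite -!fE -nadE; exact: capf.
- by move=> x p /holeE /hodd; rewrite size_map.
- by move=> x p /holeE /hl; rewrite size_map.
Qed.

End Nice.

Lemma nice_of (T : finType) (e : rel T) : simple_graph e -> cap_free e -> even_hole_free e ->
  nice 1 e.
Proof.
case=> sym irr cf ev; have ho x p : hole e x p -> ~~ odd (size p).
  move=> H; apply/negP => od; apply: (ev (size p).+1); first by rewrite /= od.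
  exact: (hole_has_hole sym irr H).
split=> //.
- move=> v x a s H vx va; apply/negP => nv; apply: (cf (size s).+2); last exact: (hole_cap sym irr H vx va nv).
  by case/and5P: H.
- move=> x p H; have := ho _ _ H; case/and5P: H => _ + _ _ _.
  by rewrite -[1.*2.+2]/4; case: p => [|a [|b [|c [|d p]]]].
Qed.

Lemma nice_of_five (T : finType) (e : rel T) : simple_graph e -> cap_free e -> even_hole_free e ->
  five_hole_free e -> nice 2 e.
Proof.
move=> sg cf ev fv; have [sym irr capf ho hl] := nice_of sg cf ev; split=> // x p H.
have := ho _ _ H; have := hl _ _ H; move: (H).
case: p H => [|a [|b [|c [|d [|f [|g p]]]]]] // H _ _ _.
by case: fv; apply: (hole_has_hole sym irr H).
Qed.

(** For aligning two colourings on a clique. Each step composes with the transposition of [g (c2 x)]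
    and [c1 x], which fixes the colours matched before. *)
Lemma match_colors (T : eqType) (s : seq T) (c1 c2 : T -> nat) N : uniq s ->
  {in s &, injective c1} -> {in s &, injective c2} ->
  {in s, forall x, c1 x < N /\ c2 x < N} ->
  exists g : nat -> nat, [/\ injective g, forall n, n < N -> g n < N & {in s, forall x, g (c2 x) = c1 x}].
Proof.
elim: s => [|x s IH]; first by move=> *; exists id; split=> // x.
rewrite cons_uniq => /andP [xs us] i1 i2 hN.
have sub y : y \in s -> y \in x :: s by rewrite in_cons => ->; rewrite orbT.
have [||y /sub/hN //|g [gI gN gs]] := IH us.
- by move=> a b /sub aS /sub bS; apply: i1.
- by move=> a b /sub aS /sub bS; apply: i2.
have [c1N c2N] := hN x (mem_head _ _).
set a := g (c2 x); set b := c1 x.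
pose sw n := if n == a then b else if n == b then a else n.
have swK : involutive sw.
  move=> n; rewrite /sw; case: (eqVneq n a) => [->|na]; first by rewrite eqxx; case: eqP.
  by case: (eqVneq n b) => [->|nb]; rewrite ?eqxx // (negbTE na) (negbTE nb).
exists (sw \o g); split.
- exact: inj_comp (inv_inj swK) gI.
- move=> n nN /=; rewrite /sw; case: eqP => // _; case: eqP => _; exact: gN.
- move=> y; rewrite in_cons /= /sw => /orP [/eqP ->|ys]; first by rewrite eqxx.
  have yx : y != x by apply: contraNneq xs => <-.
  have -> : (g (c2 y) == a) = false.
    apply/negbTE; apply: contra yx => /eqP /gI E; apply/eqP.
    by apply: i2 E; [exact: sub|exact: mem_head].
  rewrite gs //; case: eqP => // E; case/negP: yx; apply/eqP.
  by apply: i1 E; [exact: sub|exact: mem_head].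
Qed.

(** * Gluing along cliques, and universal vertices *)

Section Glue.
Variables (T : finType) (e : rel T).
Hypotheses (sym : symmetric e) (irr : irreflexive e).
Implicit Types (A C D K : {set T}) (N t : nat).

Definition colN D N := exists c : T -> nat,
  (forall x, x \in D -> c x < N) /\ forall x y, x \in D -> y \in D -> e x y -> c x != c y.

Definition clq D t := forall A, A \subset D -> cliqueb e A -> #|A| <= t.

Lemma cliqueP A : reflect {in A &, forall x y, x != y -> e x y} (cliqueb e A).
Proof.
apply: (iffP 'forall_implyP) => H x => [y xA yA xy|xA].
  by have /'forall_implyP /(_ y yA) /implyP := H x xA; apply.
by apply/'forall_implyP => y yA; apply/implyP; apply: H.
Qed.

Lemma clq_sub D D' t t' : D \subset D' -> t' <= t -> clq D' t' -> clq D t.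
Proof.
by move=> sD le H A AD cA; apply: leq_trans le; apply: H cA; apply: subset_trans sD.
Qed.

Lemma colN_le D N N' : N <= N' -> colN D N -> colN D N'.
Proof.
move=> le [c [h1 h2]]; exists c; split=> // x xD; apply: leq_trans le; exact: h1.
Qed.

(** Both colourings are injective on the clique, so a permutation of the colours makes them agree
    there. *)
Lemma glue K C N : cliqueb e K -> [disjoint C & K] ->
  (forall x y, x \in C -> e x y -> y \in C \/ y \in K) ->
  colN (C :|: K) N -> colN (~: C) N -> colN setT N.
Proof.
move=> /cliqueP cK dCK hC [c1 [h1 p1]] [c2 [h2 p2]].
have KC x : x \in K -> x \in ~: C.
  by move=> xK; rewrite in_setC; apply: contraL xK => xC; rewrite (disjointFr dCK xC).
have K1 x : x \in K -> x \in C :|: K by move=> xK; rewrite in_setU xK orbT.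
have [||||g [gI gN gs]] := @match_colors _ (enum K) c1 c2 N.
- exact: enum_uniq.
- move=> x y; rewrite !mem_enum => xK yK E; apply: contraTeq isT => xy.
  by have := p1 _ _ (K1 _ xK) (K1 _ yK) (cK _ _ xK yK xy); rewrite E eqxx.
- move=> x y; rewrite !mem_enum => xK yK E; apply: contraTeq isT => xy.
  by have := p2 _ _ (KC _ xK) (KC _ yK) (cK _ _ xK yK xy); rewrite E eqxx.
- by move=> x; rewrite mem_enum => xK; rewrite h1 ?h2 ?KC ?K1.
pose c x := if x \in C then c1 x else g (c2 x).
have cE x : x \in C :|: K -> c x = c1 x.
  rewrite /c in_setU; case: (x \in C) => //= xK; by rewrite gs // mem_enum.
exists c; split=> [x _|x y _ _ xy].
  by rewrite /c; case: (boolP (x \in C)) => xC; [apply: h1; rewrite in_setU xC|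
    apply: gN; apply: h2; rewrite in_setC].
have C1 z : z \in C -> z \in C :|: K by rewrite in_setU => ->.
case: (boolP (x \in C)) => xC.
  have yCK : y \in C :|: K by rewrite in_setU; case: (hC _ _ xC xy) => ->; rewrite ?orbT.
  rewrite (cE _ (C1 _ xC)) (cE _ yCK); exact: p1 (C1 _ xC) yCK xy.
case: (boolP (y \in C)) => yC.
  have yx : e y x by rewrite sym.
  have xCK : x \in C :|: K by rewrite in_setU; case: (hC _ _ yC yx) => ->; rewrite ?orbT.
  rewrite (cE _ (C1 _ yC)) (cE _ xCK); exact: p1 xCK (C1 _ yC) xy.
rewrite /c (negbTE xC) (negbTE yC); apply: contraNneq (p2 x y _ _ xy) => [/gI ->||];
  by rewrite ?in_setC.
Qed.

Lemma color_universal u t N : (forall v, v != u -> e u v) -> clq setT t.+1 ->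
  clq (~: [set u]) t /\ (colN (~: [set u]) N -> colN setT N.+1).
Proof.
move=> hu ht; split=> [A Au cA|[c [h1 h2]]].
  have uA : u \notin A by apply/negP => /(subsetP Au); rewrite !inE eqxx.
  have : cliqueb e (u |: A).
    apply/cliqueP => x y; rewrite !in_setU1 => /orP [/eqP ->|xA] /orP [/eqP ->|yA] xy.
    - by rewrite eqxx in xy.
    - by apply: hu; rewrite eq_sym.
    - by rewrite sym; apply: hu.
    - by have /cliqueP := cA; apply.
  by move/(ht _ (subsetT _)); rewrite cardsU1 uA.
exists (fun x => if x == u then N else c x); split=> [x _|x y _ _ xy].
  by case: eqVneq => // xu; rewrite ltnW // ltnS h1 // !inE.
case: (eqVneq x u) xy => [->|xu] xy; case: (eqVneq y u) xy => [->|yu] xy.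
- by rewrite irr in xy.
- by rewrite gtn_eqF // h1 // !inE.
- by rewrite ltn_eqF // h1 // !inE.
- by apply: h2; rewrite // !inE.
Qed.

End Glue.

(** * The graph of twin classes *)

Section Classes.
Variables (V : finType) (e : rel V) (r : nat).
Hypothesis ne : nice r e.
Hypothesis Hncc : ncc e.
Hypothesis nonuniv : forall v, exists w, nn e v w.
Implicit Types (x y z a b v w : V).

Local Notation cn := (cn e).

Let sym : symmetric e. Proof. by case: ne. Qed.
Let irr : irreflexive e. Proof. by case: ne. Qed.

(** The result of [pick] depends only on the class of [v], so twins get the same representative. *)
Definition rep v := odflt v [pick w | cn w == cn v].

Lemma rep_cn v : cn (rep v) = cn v.
Proof. by rewrite /rep; case: pickP => [w /eqP|]. Qed.

Lemma rep_eq v w : (rep v == rep w) = (cn v == cn w).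
Proof.
apply/eqP/eqP => E; first by rewrite -(rep_cn v) E rep_cn.
rewrite /rep; have -> : [pick x | cn x == cn v] = [pick x | cn x == cn w].
  by apply: eq_pick => x; rewrite E.
by case: pickP => // /(_ w); rewrite eqxx.
Qed.

Lemma rep_idem v : rep (rep v) == rep v.
Proof. by rewrite rep_eq rep_cn. Qed.

Lemma rep_adj x y : rep x != rep y -> e (rep x) (rep y) = e x y.
Proof.
have H a b : rep a != rep b -> e (rep a) b = e a b.
  rewrite rep_eq => ab; apply: cn_edge; first exact: rep_cn.
    by apply: contraNneq ab => ->; rewrite rep_cn.
  by apply: contraNneq ab => ->.
move=> xy; rewrite sym H; first by rewrite sym -[in RHS]H.
by rewrite (eqP (rep_idem x)) eq_sym.
Qed.

Lemma rep_twin x y : rep x = rep y -> x != y -> e x y.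
Proof. by move/eqP; rewrite rep_eq => /eqP; apply: cn_adj. Qed.

Definition reps := {v : V | rep v == v}.
Definition mk v : reps := exist (fun v => rep v == v) (rep v) (rep_idem v).
Definition er : rel reps := fun x y : reps => e (val x) (val y).
Definition cls (v : reps) := [set y | rep y == val v].

Lemma rep_val (v : reps) : rep (val v) = val v. Proof. exact: (eqP (valP v)). Qed.

Lemma mk_val (v : reps) : mk (val v) = v.
Proof. by apply: val_inj; apply: rep_val. Qed.

Lemma clsP (v : reps) x : (x \in cls v) = (mk x == v). Proof. by rewrite inE. Qed.

Lemma mk_adj x y : mk x != mk y -> er (mk x) (mk y) = e x y.
Proof. exact: rep_adj. Qed.

Lemma er_mk x y : er (mk x) (mk y) -> e x y.
Proof.
move=> xy; rewrite -rep_adj //; apply: contraTneq xy => E.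
by rewrite /er /= E irr.
Qed.

Lemma mk_cases x y : e x y -> mk x = mk y \/ er (mk x) (mk y).
Proof. by move=> xy; case: (eqVneq (mk x) (mk y)) => [->|/mk_adj ->]; [left|right]. Qed.

Lemma nice_er : nice r er.
Proof. by apply: (nice_inj (f := val)) ne; first exact: val_inj. Qed.

Let syme : symmetric er. Proof. by case: nice_er. Qed.
Let irre : irreflexive er. Proof. by case: nice_er. Qed.

(** [triangle_twins] finds two twins in a triangle, but distinct representatives are never twins. *)
Lemma tri_er (x y z : reps) : er x y -> er y z -> ~~ er x z.
Proof.
move=> xy yz; apply/negP => xz; have [_ _ capf ho _] := ne.
have c4f a p : hole e a p -> size p != 3 by move=> /ho; apply: contraNneq => ->.
have K (a b : reps) : er a b -> cn (val a) != cn (val b).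
  move=> ab; apply/negP; rewrite -rep_eq !rep_val => /eqP /val_inj E.
  by rewrite E irre in ab.
by case: (triangle_twins sym irr capf c4f Hncc nonuniv xy yz xz) => /eqP; apply/negP; apply: K.
Qed.

(** A clique of representatives blows up to a clique, and a path avoiding the latter projects to one
    avoiding the former. *)
Lemma ncc_er : ncc er.
Proof.
move=> K /cliqueP cK a b aK bK; pose K' := [set y | mk y \in K].
have K'P y : (y \in K') = (mk y \in K) by rewrite inE.
have cK' : cliqueb e K'.
  apply/cliqueP => x y; rewrite !K'P => xK yK xy; case: (eqVneq (mk x) (mk y)) => [E|nE].
    by apply: rep_twin => //; have := congr1 val E.
  by rewrite -mk_adj //; apply: cK.
have := Hncc cK' (a := val a) (b := val b); rewrite !K'P !mk_val => /(_ aK bK).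
have step x y : conn e (~: K') x y -> conn er (~: K) (mk x) (mk y).
  case/connectP => p + ->; elim: p x => [|z p IH] x /=; first by move=> _; apply: connect0.
  case/andP => /and3P [xK zK xz] /IH; apply: connect_trans.
  rewrite !in_setC !K'P in xK zK; case: (mk_cases xz) => [->|xz']; first exact: connect0.
  by apply: connect1; rewrite /= !in_setC xK zK.
by move/step; rewrite !mk_val.
Qed.

Lemma nonuniv_er (v : reps) : exists w : reps, nn er v w.
Proof.
have [w /andP [vw nvw]] := nonuniv (val v); exists (mk w).
have ne' : v != mk w.
  apply: contraNneq nvw => E; apply: rep_twin vw; by rewrite rep_val E.
by rewrite /nn ne' -{1}(mk_val v) mk_adj // mk_val.
Qed.

Lemma reps_reducible (v : V) : r > 0 -> long_run er r.*2.+1 \/ fork er r.*2.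
Proof.
move=> r0; have [_ _ _ ho hl] := nice_er.
exact: (reducible syme irre tri_er ho ncc_er nonuniv_er r0 hl (mk v)).
Qed.

Lemma cls_clique (v : reps) x y : x \in cls v -> y \in cls v -> x != y -> e x y.
Proof.
rewrite !clsP => /eqP xv /eqP yv; apply: rep_twin.
by have := congr1 val xv; have := congr1 val yv => /= -> ->.
Qed.

Lemma cls2_card t (x y : reps) : clq e setT t -> er x y -> #|cls x| + #|cls y| <= t.
Proof.
move=> ht xy; have dxy : [disjoint cls x & cls y].
  rewrite disjoints_subset; apply/subsetP => z; rewrite in_setC !clsP => /eqP ->.
  by apply: contraTneq xy => ->; rewrite irre.
move: (dxy); rewrite -leq_card_setU => /eqP <-; apply: ht; first exact: subsetT.
apply/cliqueP => a b; rewrite !in_setU => /orP [ax|ay] /orP [bx|by'].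
- exact: cls_clique ax bx.
- by move=> _; apply: er_mk; move: ax by'; rewrite !clsP => /eqP -> /eqP ->.
- by move=> _; apply: er_mk; rewrite syme; move: ay bx; rewrite !clsP => /eqP -> /eqP ->.
- exact: cls_clique ay by'.
Qed.

(** With [t + 1] colours the clique bound becomes the strict inequality required by
    [extend_reducible]. A colouring is turned into colour sets of classes, extended, and turned
    back. *)
Lemma class_reduce t (v : V) : (r == 1) || (r == 2) -> clq e setT t -> t <= r.*2.+2 ->
  exists X : {set V}, X != set0 /\ (colN e (~: X) t.+1 -> colN e setT t.+1).
Proof.
move=> hr ht ltr; have r0 : 0 < r by case: (r) hr.
have hw (x y : reps) : er x y -> #|cls x| + #|cls y| < t.+1 by move/(cls2_card ht).
have hN : t.+1 <= r.*2 + 3 by rewrite addn3.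
have [X [X0 HX]] := extend_reducible (card_ord t.+1) syme irre hw hr hN (reps_reducible v r0).
exists [set y | mk y \in X]; split.
  case/set0Pn: X0 => x xX; apply/set0Pn; exists (val x); by rewrite inE mk_val.
case=> c [h1 h2]; pose S (x : reps) := [set (inord (c y) : 'I_t.+1) | y in cls x].
have XP y : (y \in ~: [set y | mk y \in X]) = (mk y \in ~: X) by rewrite !inE.
have cI y y' : y \in ~: [set y | mk y \in X] -> y' \in ~: [set y | mk y \in X] ->
    (inord (c y) : 'I_t.+1) = inord (c y') -> c y = c y'.
  by move=> yX y'X /(congr1 val); rewrite /= !inordK ?h1.
have clX (x : reps) y : x \in ~: X -> y \in cls x -> y \in ~: [set y | mk y \in X].
  by move=> xX; rewrite clsP XP => /eqP ->.
have [|S' [S1 S2]] := HX S.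
  split=> [x xX|x y xX yX xy].
    rewrite card_in_imset // => a b ax bx /(cI _ _ (clX _ _ xX ax) (clX _ _ xX bx)) E.
    apply: contraTeq isT => ab; have := h2 _ _ (clX _ _ xX ax) (clX _ _ xX bx) (cls_clique ax bx ab).
    by rewrite E eqxx.
  rewrite /disj disjoints_subset; apply/subsetP => i /imsetP [a ax ->]; rewrite in_setC.
  apply/imsetP => -[b by' /(cI _ _ (clX _ _ xX ax) (clX _ _ yX by')) E].
  have ab : e a b by apply: er_mk; move: ax by'; rewrite !clsP => /eqP -> /eqP ->.
  by have := h2 _ _ (clX _ _ xX ax) (clX _ _ yX by') ab; rewrite E eqxx.
(* The vertices of a class receive the colours of its set in the order of enumeration. *)
pose c' y := nth ord0 (enum (S' (mk y))) (index y (enum (cls (mk y)))).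
have yc y : y \in cls (mk y) by rewrite clsP.
have iy y : index y (enum (cls (mk y))) < size (enum (S' (mk y))).
  by rewrite -cardE S1 ?inE // cardE index_mem mem_enum.
have cS y : c' y \in S' (mk y) by rewrite -mem_enum mem_nth.
exists (fun y => val (c' y)); split=> [y _|y z _ _ yz]; first exact: ltn_ord.
case: (mk_cases yz) => [E|yz'].
  have ym : y \in enum (cls (mk z)) by rewrite mem_enum -E.
  have zm : z \in enum (cls (mk z)) by rewrite mem_enum.
  apply: contraTneq yz => /val_inj; rewrite /c' E => /eqP.
  rewrite nth_uniq ?enum_uniq // -?E ?iy // ?E ?iy // => /eqP Ei.
  suff -> : y = z by rewrite irr.
  by rewrite -(nth_index z ym) Ei nth_index.
apply: contraTneq yz' => /val_inj E; apply/negP => yz'.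
have := S2 _ _ (in_setT _) (in_setT _) yz'; rewrite /disj disjoints_subset => /subsetP /(_ _ (cS y)).
by rewrite in_setC E cS.
Qed.

(** A clique meeting three classes would give a triangle of representatives. *)
Lemma clique_classes A : cliqueb e A -> A != set0 -> exists x y : reps,
  A \subset cls x :|: cls y /\ (x = y \/ er x y).
Proof.
move=> /cliqueP cA /set0Pn [a aA].
case: (boolP [exists b in A, mk b != mk a]) => [/exists_inP [b bA ba]|na]; last first.
  exists (mk a), (mk a); split; last by left.
  apply/subsetP => b bA; rewrite setUid clsP; apply: contraNT na => nb.
  by apply/exists_inP; exists b.
have ab : er (mk a) (mk b).
  rewrite mk_adj 1?eq_sym //; apply: cA => //; by apply: contraNneq ba => ->.
exists (mk a), (mk b); split; last by right.
apply/subsetP => d dA; rewrite in_setU !clsP -implyNb; apply/implyP => da; apply: contraT => db.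
have ad : er (mk a) (mk d).
  rewrite mk_adj 1?eq_sym //; apply: cA => //; by apply: contraNneq da => ->.
have bd : er (mk b) (mk d).
  rewrite mk_adj 1?eq_sym //; apply: cA => //; by apply: contraNneq db => ->.
by have := tri_er ab bd; rewrite ad.
Qed.

(** By [clique_classes] the bounds concern one class or two adjacent ones; at most [r + 1] vertices
    from each would give [2r + 2]. The last clause keeps [D] from being empty, so that its
    complement is a smaller graph. *)
Lemma class_split t : clq e setT t -> r.*2.+2 < t -> exists D : {set V},
  [/\ clq e D r.*2.+2, clq e (~: D) (t - r.*2.+2) & forall v, exists2 w, w \in D & mk w = mk v].
Proof.
move=> ht lt; set h := r.+1.
(* The second term leaves at most t - (2r + 2) vertices of the class outside D. *)
pose d (v : reps) := maxn (minn #|cls v| h) (#|cls v| + r.*2.+2 - t).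
pose ix y := index y (enum (cls (mk y))).
pose D := [set y | ix y < d (mk y)].
have iI (v : reps) : {in cls v &, injective ix}.
  move=> y z; rewrite !clsP => /eqP yv /eqP zv; rewrite /ix yv zv => E.
  have ym : y \in enum (cls v) by rewrite mem_enum clsP yv.
  have zm : z \in enum (cls v) by rewrite mem_enum clsP zv.
  by rewrite -(nth_index z ym) E nth_index.
have ixl y (v : reps) : y \in cls v -> ix y < #|cls v|.
  by move=> yv; rewrite /ix; move: (yv); rewrite clsP => /eqP ->; rewrite cardE index_mem mem_enum.
have cw (v : reps) : #|cls v| <= t.
  by apply: ht; rewrite ?subsetT //; apply/cliqueP => x y; apply: cls_clique.
have dle (v : reps) : d v <= #|cls v|.
  by rewrite geq_max geq_minl /=; have := cw v; move: lt; clear; lia.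
have bnd (v : reps) (B : {set V}) lo hi : B \subset cls v -> {in B, forall y, lo <= ix y < hi} ->
    #|B| <= hi - lo.
  move=> Bv hB; rewrite -(size_iota lo (hi - lo)) cardE -(size_map ix).
  apply: uniq_leq_size.
    rewrite map_inj_in_uniq ?enum_uniq // => y z; rewrite !mem_enum => yB zB.
    by apply: (iI v); apply: (subsetP Bv).
  move=> i /mapP [y]; rewrite mem_enum => yB ->; rewrite mem_iota subnKC ?hB //.
  by have /andP [h1 h2] := hB _ yB; apply: ltnW; apply: leq_ltn_trans h2.
have dD (v : reps) (A : {set V}) : A \subset D -> #|A :&: cls v| <= d v.
  move=> AD; rewrite -[d v]subn0; apply: (bnd v); first exact: subsetIr.
  move=> y; rewrite inE => /andP [/(subsetP AD)]; rewrite inE clsP => + /eqP yv.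
  by rewrite yv.
have dC (v : reps) (A : {set V}) : A \subset ~: D -> #|A :&: cls v| <= #|cls v| - d v.
  move=> AD; apply: (bnd v); first exact: subsetIr.
  move=> y; rewrite inE => /andP [/(subsetP AD)]; rewrite !inE -leqNgt => + yv.
  by have := yv; rewrite -[_ == _]clsP => /[dup] /ixl -> ; rewrite clsP => /eqP ->; rewrite andbT.
have two (A : {set V}) (x y : reps) : A \subset cls x :|: cls y ->
    #|A| <= #|A :&: cls x| + #|A :&: cls y|.
  move=> As; rewrite -{1}(setIidPl As) setIUr; exact: leq_card_setU.
exists D; split.
- move=> A AD cA; case: (eqVneq A set0) => [->|A0]; first by rewrite cards0.
  have [x [y [As [E|xy]]]] := clique_classes cA A0.
    subst y; rewrite setUid in As; rewrite -(setIidPl As); apply: leq_trans (dD x A AD) _.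
    rewrite /d /h; have := cw x; move: lt; clear; lia.
  apply: leq_trans (two _ _ _ As) _; have := dD x A AD; have := dD y A AD.
  have := cls2_card ht xy; rewrite /d /h; move: lt; clear; lia.
- move=> A AD cA; case: (eqVneq A set0) => [->|A0]; first by rewrite cards0.
  have [x [y [As [E|xy]]]] := clique_classes cA A0.
    subst y; rewrite setUid in As; rewrite -(setIidPl As); apply: leq_trans (dC x A AD) _.
    rewrite /d /h; have := cw x; move: lt; clear; lia.
  apply: leq_trans (two _ _ _ As) _; have := dC x A AD; have := dC y A AD.
  have := cls2_card ht xy; rewrite /d /h; move: lt; clear; lia.
- move=> v; have v0 : 0 < #|cls (mk v)| by apply/card_gt0P; exists v; rewrite clsP.
  pose w := nth v (enum (cls (mk v))) 0.
  have wv : w \in cls (mk v) by rewrite -mem_enum mem_nth -?cardE.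
  have E : mk w = mk v by move: wv; rewrite clsP => /eqP.
  exists w => //; rewrite inE /ix E /w index_uniq ?enum_uniq -?cardE //.
  by rewrite /d /h; move: v0; clear; lia.
Qed.

End Classes.

(** * The induction on the number of vertices *)

Section Subset.
Variables (T : finType) (e : rel T) (D : {set T}).

Lemma colN_sub N : colN (fun x y : {x | x \in D} => e (val x) (val y)) setT N -> colN e D N.
Proof.
case=> c [h1 h2]; exists (fun x => if insub x is Some v then c v else 0); split=> [x xD|x y xD yD xy].
  by rewrite insubT h1.
by rewrite !insubT; apply: h2.
Qed.

Lemma clq_val t : clq e D t -> clq (fun x y : {x | x \in D} => e (val x) (val y)) setT t.
Proof.
move=> h A _ /cliqueP cA; rewrite -(card_imset _ val_inj); apply: h.
  by apply/subsetP => x /imsetP [v _ ->]; apply: valP.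
apply/cliqueP => x y /imsetP [v vA ->] /imsetP [w wA ->] vw.
by apply: cA => //; apply: contraNneq vw => ->.
Qed.

End Subset.

Lemma colN_union (T : finType) (e : rel T) (D : {set T}) N1 N2 :
  colN e D N1 -> colN e (~: D) N2 -> colN e setT (N1 + N2).
Proof.
case=> c1 [h1 p1] [c2 [h2 p2]].
exists (fun x => if x \in D then c1 x else N1 + c2 x); split=> [x _|x y _ _ xy].
  case: (boolP (x \in D)) => xD; first by rewrite ltn_addr // h1.
  by rewrite ltn_add2l h2 // in_setC.
case: (boolP (x \in D)) => xD; case: (boolP (y \in D)) => yD.
- exact: p1.
- by rewrite ltn_eqF // ltn_addr // h1.
- by rewrite gtn_eqF // ltn_addr // h1.
- by rewrite eqn_add2l p2 // in_setC.
Qed.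

Theorem color_nice (r : nat) (T : finType) (e : rel T) t : (r == 1) || (r == 2) -> nice r e ->
  clq e setT t -> colN e setT (t + ceil_div t r.*2.+2).
Proof.
move=> hr; have [n] := ubnP #|T|; elim: n T e t => // n IH T e t ltn ne ht.
have [sym irr _ _ _] := ne.
have IHs (D : {set T}) s x : x \notin D -> clq e D s -> colN e D (s + ceil_div s r.*2.+2).
  move=> xD hs; apply: colN_sub; apply: IH.
  - rewrite card_sig -ltnS; apply: leq_trans ltn; rewrite ltnS.
    apply: (@leq_trans #|D|.+1); first by rewrite ltnS subset_leq_card //; apply/subsetP.
    rewrite -(cardsC D) -addn1 leq_add2l; apply/card_gt0P; exists x.
    by rewrite in_setC.
  - by apply: nice_inj ne; first exact: val_inj.
  - exact: clq_val.
have sub D : clq e D t by apply: clq_sub ht; rewrite ?subsetT.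
case: (posnP #|T|) => [T0|/card_gt0P [v _]].
  by exists (fun=> 0); split=> x; have := card0_eq T0 x.
(* A boolean form of [ncc], whose failure yields an explicit clique cutset. *)
pose nccb := [forall K : {set T}, cliqueb e K ==> [forall a, forall b,
  (a \notin K) ==> (b \notin K) ==> conn e (~: K) a b]].
case: (boolP nccb) => [nb|]; last first.
  case/forallPn => K; rewrite negb_imply => /andP [cK /forallPn [a /forallPn [b]]].
  rewrite !negb_imply => /and3P [aK bK nab].
  have aK' : a \in ~: K by rewrite in_setC.
  have CK := comp_sub (e := e) aK'; set C := comp e (~: K) a in CK.
  have bC : b \notin C by rewrite inE.
  apply: (glue sym (K := K) (C := C)) => //.
  - by rewrite disjoints_subset; apply/subsetP.
  - move=> x y xC xy; case: (boolP (y \in K)) => yK; [by right|left].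
    by apply: comp_closed xC (CK _ xC) _ xy; rewrite in_setC.
  - by apply: (IHs _ _ b) => //; rewrite in_setU negb_or bC.
  - by apply: (IHs _ _ a) => //; rewrite in_setC negbK comp_refl.
have Hncc : ncc e.
  move=> K cK a b aK bK.
  by have /forallP/(_ K)/implyP/(_ cK)/forallP/(_ a)/forallP/(_ b) := nb; rewrite aK bK.
case: (boolP [forall v, exists w, nn e v w]) => [/forallP nu|]; last first.
  case/forallPn => u /existsPn hu; have uV w : w != u -> e u w.
    by move=> wu; have := hu w; rewrite /nn eq_sym wu negbK.
  have t0 : 0 < t.
    by rewrite -(cards1 u); apply: ht; rewrite ?subsetT // clique1.
  case: t t0 ht sub => // t _ ht _.
  have [h1 h2] := color_universal sym irr (t + ceil_div t r.*2.+2) uV ht.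
  have /h2 : colN e (~: [set u]) (t + ceil_div t r.*2.+2).
    by apply: (IHs _ _ u) h1; rewrite !inE eqxx.
  apply: colN_le; rewrite addSn ltnS leq_add2l; apply: leq_div2r.
  by rewrite leq_add2r leqnSn.
have nonuniv w : exists w', nn e w w' by apply/existsP; apply: nu.
have t0 : 0 < t by rewrite -(cards1 v); apply: ht; rewrite ?subsetT // clique1.
(* If no clique exceeds [2r + 2], the smaller graph needs at most one colour more than the clique
   bound [minn t (2r + 2)], which is what [class_reduce] takes. *)
case: (boolP [forall A : {set T}, cliqueb e A ==> (#|A| <= r.*2.+2)]) => [/forallP hA|].
  have h1 : clq e setT (minn t r.*2.+2).
    move=> A _ cA; rewrite leq_min (implyP (hA A)) // andbT; exact: ht (subsetT _) cA.
  have [X [/set0Pn [x xX] HX]] := class_reduce ne Hncc nonuniv v hr h1 (geq_minr _ _).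
  have : colN e setT (minn t r.*2.+2).+1.
    apply: HX; have := IHs (~: X) _ x; rewrite in_setC xX => /(_ (minn t r.*2.+2) isT).
    move=> /(_ (clq_sub (subsetT _) (leqnn _) h1)); apply: colN_le.
    rewrite -[(minn _ _).+1]addn1 leq_add2l /ceil_div -ltnS ltn_divLR //.
    by have := geq_minr t r.*2.+2; move: (minn _ _); clear; lia.
  apply: colN_le; rewrite -[(minn _ _).+1]addn1; apply: leq_add; first exact: geq_minl.
  by rewrite /ceil_div divn_gt0 //; move: t0; clear; lia.
case/forallPn => A; rewrite negb_imply -ltnNge => /andP [cA ltA].
have ltt : r.*2.+2 < t by apply: leq_trans ltA _; apply: ht cA; apply: subsetT.
have [D [hD hC hm]] := class_split ne Hncc nonuniv ht ltt.
have [a aD] : exists a, a \notin D.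
  have /subsetPn [a _ aD] : ~~ (A \subset D) by apply: contraL ltA => AD; rewrite -leqNgt; apply: hD.
  by exists a.
have [b bD _] := hm v.
have c1 := IHs _ _ _ aD hD.
have bD' : b \notin ~: D by rewrite in_setC negbK.
have c2 := IHs _ _ _ bD' hC.
(* [D] costs [2r + 3] colours; lowering [t] by [2r + 2] lowers the bound by exactly as much. *)
apply: colN_le (colN_union c1 c2); move: ltt; rewrite /ceil_div.
by case/orP: hr => /eqP ->; clear; lia.
Qed.

(** * Chromatic number and clique number *)

Lemma chi_le (T : finType) (e : rel T) N : colN e setT N -> chi e <= N.
Proof.
case=> c [h1 h2]; have cN x : c x < N by apply: h1; rewrite inE.
have col : colorableb e N.
  apply/existsP; exists [ffun x => Ordinal (cN x)].
  apply/forallP => x; apply/forallP => y; apply/implyP => xy; rewrite !ffunE -val_eqE /=.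
  by apply: h2; rewrite ?inE.
have big_le (I : eqType) (s : seq I) (P : pred I) (F : I -> nat) d i : i \in s -> P i ->
  \big[minn/d]_(j <- s | P j) F j <= F i.
  elim: s => // j s IH; rewrite in_cons big_cons => /orP [/eqP <- -> |is' Pi].
    exact: geq_minl.
  case: (P j); last exact: IH.
  by apply: leq_trans (IH is' Pi); apply: geq_minr.
have big_le_d (I : eqType) (s : seq I) (P : pred I) (F : I -> nat) d :
  \big[minn/d]_(j <- s | P j) F j <= d.
  elim: s => [|j s IH]; rewrite ?big_nil // big_cons; case: (P j) => //.
  by apply: leq_trans IH; apply: geq_minr.
(* The minimum ranges over [k <= #|T|]; a larger [N] is above its default value. *)
case: (ltnP N #|T|.+1) => hN.
  have := @big_le _ (index_enum 'I_#|T|.+1) (fun k : 'I_#|T|.+1 => colorableb e k) val #|T| (Ordinal hN).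
  by apply; rewrite ?mem_index_enum.
by apply: leq_trans (ltnW hN); apply: big_le_d.
Qed.

Lemma chi_ge (T : finType) (e : rel T) N : N <= #|T| ->
  (forall k, colN e setT k -> N <= k) -> N <= chi e.
Proof.
move=> hT hN; apply: (big_ind (fun m => N <= m)) => // [m n h1 h2|k /existsP [c /forallP hc]].
  by rewrite leq_min h1.
apply: hN; exists (fun x => val (c x)); split=> [x _|x y _ _ xy]; first exact: ltn_ord.
by have /forallP/(_ y)/implyP/(_ xy) := hc x.
Qed.

Lemma clq_omega (T : finType) (e : rel T) : clq e setT (omega e).
Proof.
move=> A _ cA; exact: (@leq_bigmax_cond _ (fun A : {set T} => cliqueb e A) (fun A => #|A|) A cA).
Qed.

Lemma omega_le (T : finType) (e : rel T) t : clq e setT t -> omega e <= t.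
Proof. by move=> h; apply/bigmax_leqP => A; apply: h; apply: subsetT. Qed.

(** * Odd cycles *)

Section Cycle.
Variable n : nat.
Hypothesis n2 : 2 < n.
Local Notation C := (@cycle_rel n).

Lemma ordS_neq (x : 'I_n) : ordS x != x.
Proof.
apply/eqP => /(congr1 val) /=; case: (leqP n x.+1) => h.
  have E : x.+1 = n by apply/eqP; rewrite eqn_leq h ltn_ord.
  by rewrite E modnn => x0; move: n2; rewrite -E -x0.
by rewrite modn_small // => /eqP; rewrite gtn_eqF.
Qed.

Lemma cycle_relE x y : C x y = (y == ordS x) || (x == ordS y).
Proof.
rewrite /cycle_rel -!val_eqE /= [x.+1 %% n == y]eq_sym [y.+1 %% n == x]eq_sym.
case: (eqVneq (val x) (val y)) => [/val_inj ->|_]; last by rewrite andbT.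
by rewrite andbF orbb -[y.+1 %% n]/(val (ordS y)) val_eqE eq_sym (negbTE (ordS_neq y)).
Qed.

Lemma cycle_sym : symmetric C.
Proof. by move=> x y; rewrite !cycle_relE orbC. Qed.

Lemma cycle_irr : irreflexive C.
Proof. by move=> x; rewrite cycle_relE orbb eq_sym; apply/negbTE/ordS_neq. Qed.

Lemma cycle_deg x y : C x y -> y = ordS x \/ y = ord_pred x.
Proof.
rewrite cycle_relE => /orP [/eqP|/eqP ->]; first by left.
by right; rewrite ordSK.
Qed.

Lemma cycle_ordS x : C x (ordS x).
Proof. by rewrite cycle_relE eqxx. Qed.

Lemma cycle_deg2 x a b c : C x a -> C x b -> C x c -> [|| a == b, b == c | a == c].
Proof.
by do 3![case/cycle_deg => ->]; rewrite !eqxx ?orbT.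
Qed.

Lemma iter_ordS (x : 'I_n) m : val (iter m (@ordS n) x) = (x + m) %% n.
Proof.
elim: m => [|m IH]; first by rewrite addn0 modn_small.
by rewrite iterS /= IH -addn1 modnDml addn1 addnS.
Qed.

Lemma ordS_closed (S : {set 'I_n}) x : x \in S -> {in S, forall y, ordS y \in S} -> S = setT.
Proof.
move=> xS cS; apply/setP => y; rewrite inE.
have -> : y = iter (n - x + y) (@ordS n) x.
  apply: val_inj; rewrite iter_ordS addnA subnKC ?(ltnW (ltn_ord x)) //.
  by rewrite modnDl modn_small.
by elim: (_ + _) => //= m; apply: cS.
Qed.

End Cycle.

(** In a cycle all degrees are two, so the successor of [f i] is the image of a neighbour of [i].
    The image is closed under successors and hence everything. *)
Lemma cycle_contains n k : 2 < n -> 2 < k -> contains (@cycle_rel n) (@cycle_rel k) -> k = n.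
Proof.
move=> n2 k2 [f [fI fE]].
have k0 : 0 < k by apply: leq_trans k2.
suff E : f @: setT = setT.
  by rewrite -[LHS]card_ord -[RHS]card_ord -cardsT -[in RHS]cardsT -E card_imset.
apply: (@ordS_closed n _ (f (Ordinal k0))); first exact: imset_f.
move=> y /imsetP [i _ ->].
have e1 : cycle_rel (f i) (f (ordS i)) by rewrite fE cycle_ordS.
have e2 : cycle_rel (f i) (f (ord_pred i)).
  by rewrite fE cycle_relE // ord_predK eqxx orbT.
have := cycle_deg2 n2 (cycle_ordS n2 (f i)) e1 e2.
case/or3P => /eqP E; rewrite ?E ?imset_f //; have := fI _ _ E => E'.
(* Both neighbours of [i] would coincide, that is, [i + 2] and [i] would agree modulo [k > 2]. *)
have := congr1 (@ordS k) E'; rewrite ord_predK => E2.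
have : val (iter 2 (@ordS k) i) = i by rewrite /= -[in RHS]E2.
rewrite iter_ordS; case: (ltnP (i + 2) k) => h.
  by rewrite modn_small // => /eqP; rewrite -[X in _ == X]addn0 eqn_add2l.
rewrite -(subnK h) modnDr modn_small; last by have := ltn_ord i; move: h k2; clear; lia.
by have := ltn_ord i; move: h k2; clear; lia.
Qed.

Lemma ordS_val n (x : 'I_n) : ordS x = x.+1 :> nat \/ (x.+1 = n /\ ordS x = 0 :> nat).
Proof.
rewrite /=; case: (leqP n x.+1) => h; last by left; rewrite modn_small.
have E : x.+1 = n by apply/eqP; rewrite eqn_leq h ltn_ord.
by right; rewrite E modnn.
Qed.

Section OddCycle.
Variable n : nat.
Hypothesis n3 : 3 < n.
Hypothesis n_odd : odd n.
Local Notation C := (@cycle_rel n).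

Let n2 : 2 < n. Proof. exact: ltnW. Qed.

Lemma cycle_simple : simple_graph C.
Proof. by split; [apply: cycle_sym|apply: cycle_irr]. Qed.

Lemma cycle_even_hole_free : even_hole_free C.
Proof.
move=> k ek [k4 /(cycle_contains n2 (ltnW k4)) E].
by rewrite E n_odd in ek.
Qed.

(** Vertex [0] of the hole in a cap has three neighbours: the added vertex, [1] and [k - 1]. *)
Lemma cycle_cap_free : cap_free C.
Proof.
move=> k k4 [f [fI fE]]; have k2 : 2 < k := ltnW k4.
have [k0 k1] : 0 < k /\ 1 < k by split; apply: leq_trans k4.
have kl : k.-1 < k by rewrite prednK.
have h (i : option 'I_k) : cap_rel (Some (Ordinal k0)) i -> C (f (Some (Ordinal k0))) (f i) by rewrite fE.
have := @cycle_deg2 n n2 (f (Some (Ordinal k0))) (f None) (f (Some (Ordinal k1))) (f (Some (Ordinal kl))).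
rewrite !h //; last first.
- by rewrite /= cycle_relE // -!val_eqE /= modn_small // eqxx.
- by rewrite /= cycle_relE // -!val_eqE /= prednK // modnn eqxx orbT.
move=> /(_ isT isT isT); rewrite !(inj_eq fI) => /or3P [//|/eqP [E]|//].
by move: k4; rewrite -(prednK k0) -E.
Qed.

Lemma cycle_three : colN C setT 3.
Proof.
exists (fun x : 'I_n => if x == 0 :> nat then 2 else odd x); split=> [x _|x y _ _].
  by case: eqP => // _; case: odd.
have H (a b : 'I_n) : b == ordS a ->
    (if a == 0 :> nat then 2 else odd a) != (if b == 0 :> nat then 2 else odd b) :> nat.
  move/eqP => ->; case: (ordS_val a) => [->|[E ->]].
    by rewrite /=; case: (eqVneq (a : nat) 0) => _; case: (odd a).
  rewrite /=; case: (eqVneq (a : nat) 0) => [a0|_]; last by case: (odd a).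
  by move: n2; rewrite -E a0.
by rewrite cycle_relE // => /orP [/H //|/H]; rewrite eq_sym.
Qed.

(** Two colours would alternate along the cycle, and an odd number of steps returns to the start. *)
Lemma cycle_not_two k : colN C setT k -> 3 <= k.
Proof.
rewrite leqNgt => hc; apply/negP => k3; have [|c [h1 h2]] := @colN_le _ C setT k 2 _ hc.
  by rewrite -ltnS.
have n0 : 0 < n by apply: ltn_trans n2.
have b01 a : c a = odd (c a) :> nat by have := h1 a; rewrite inE => /(_ isT); case: (c a) => [|[|]].
have st (x : 'I_n) : odd (c (ordS x)) = ~~ odd (c x).
  have := h2 x (ordS x); rewrite !inE cycle_ordS // => /(_ isT isT isT).
  by rewrite (b01 x) (b01 (ordS x)); case: (odd (c x)); case: (odd _).
have it m (x : 'I_n) : odd (c (iter m (@ordS n) x)) = odd m (+) odd (c x).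
  by elim: m => //= m IH; rewrite st IH addNb.
have := it n (Ordinal n0).
have -> : iter n (@ordS n) (Ordinal n0) = Ordinal n0.
  by apply: val_inj; rewrite iter_ordS modnDr modn_small.
by rewrite n_odd; case: (odd _).
Qed.

Lemma cycle_chi : chi C = 3.
Proof.
apply/eqP; rewrite eqn_leq; apply/andP; split; first exact: chi_le cycle_three.
by apply: chi_ge; [rewrite card_ord ltnW|exact: cycle_not_two].
Qed.

Lemma cycle_val (x y : 'I_n) : C x y ->
  [\/ y = x.+1 :> nat, x = y.+1 :> nat, x.+1 = n /\ y = 0 :> nat | y.+1 = n /\ x = 0 :> nat].
Proof.
rewrite cycle_relE // => /orP [] /eqP ->.
  by case: (ordS_val x) => [->|[h1 h2]]; [constructor 1|constructor 3].
by case: (ordS_val y) => [->|[h1 h2]]; [constructor 2|constructor 4].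
Qed.

Lemma cycle_omega : omega C = 2.
Proof.
apply/eqP; rewrite eqn_leq; apply/andP; split.
  apply: omega_le => A _ /cliqueP cA; rewrite leqNgt; apply/negP => /card_gt2P.
  case=> a [b [c [[aA bA cA'] [ab bc ca]]]].
  have := cycle_val (cA _ _ aA bA ab); have := cycle_val (cA _ _ bA cA' bc).
  have := cycle_val (cA _ _ cA' aA ca); have := ltn_ord a; have := ltn_ord b; have := ltn_ord c.
  move: n3 ab bc ca; rewrite -!val_eqE /=; move: (val a) (val b) (val c); clear => a b c.
  by move=> ? ? ? ? ? ? ? [?|?|[? ?]|[? ?]] [?|?|[? ?]|[? ?]] [?|?|[? ?]|[? ?]]; lia.
have n0 : 0 < n by apply: ltn_trans n2.
have e01 := cycle_ordS n2 (Ordinal n0).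
have := clq_omega (subsetT _) (clique2 (cycle_sym n2) e01).
by rewrite cards2 eq_sym (negbTE (ordS_neq n2 _)).
Qed.

End OddCycle.

Theorem theorem1p2 :
  (forall (T : finType) (e : rel T),
      simple_graph e -> cap_free e -> even_hole_free e ->
      chi e <= ceil_div (5 * omega e) 4)
  /\
  (forall (T : finType) (e : rel T),
      simple_graph e -> cap_free e -> even_hole_free e -> five_hole_free e ->
      chi e <= ceil_div (7 * omega e) 6)
  /\
  (exists (T : finType) (e : rel T),
      [/\ simple_graph e, cap_free e, even_hole_free e, 0 < #|T|
        & chi e = ceil_div (5 * omega e) 4])
  /\
  (exists (T : finType) (e : rel T),
      simple_graph e /\ cap_free e /\ even_hole_free e /\ five_hole_free e /\
      0 < #|T| /\ chi e = ceil_div (7 * omega e) 6).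
Proof.
split=> [T e sg cf ev|].
  have := chi_le (color_nice (r := 1) isT (nice_of sg cf ev) (@clq_omega _ e)).
  by rewrite /ceil_div; move: (omega e) (chi e); clear; lia.
split=> [T e sg cf ev fv|].
  have := chi_le (color_nice (r := 2) isT (nice_of_five sg cf ev fv) (@clq_omega _ e)).
  by rewrite /ceil_div; move: (omega e) (chi e); clear; lia.
split.
  (* Both cycles have [chi = 3] and [omega = 2], and ceil(10/4) = ceil(14/6) = 3. *)
  exists 'I_5, (@cycle_rel 5); rewrite cycle_chi // cycle_omega // card_ord; split=> //.
  - exact: cycle_simple.
  - exact: cycle_cap_free.
  - exact: cycle_even_hole_free.
exists 'I_7, (@cycle_rel 7); rewrite cycle_chi // cycle_omega // card_ord.
split; first exact: cycle_simple.
split; first exact: cycle_cap_free.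
split; first exact: cycle_even_hole_free.
by split=> // -[_ h]; have := cycle_contains (isT : 2 < 7) (isT : 2 < 5) h.
Qed.
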